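(* Let $n=2m\geq 4$, let $\pi(\chi)$ be a depth-zero cuspidal representation of $\mathrm{GL}_n(F)$ attached to a tame admissible pair $(L,\chi)$, let $\mu$ be a character of $E^*$, and suppose that $E/F$ is unramified. If $\pi(\chi)$ is $\mu$-distinguished, then $\mathrm{Hom}_{\mathrm{GL}_m(E)}(\pi(\chi),\mu)\simeq\mathbb{C}$.
   Context: $F$ is a non-archimedean local field of residual characteristic different from $2$, $E/F$ is a quadratic extension, $n=2m$. For a local field $\bullet$, $\mathcal{O}_\bullet$, $\mathcal{P}_\bullet$, $k_\bullet$ denote the ring of integers, its maximal ideal and the residue field. $H\simeq\mathrm{GL}_m(E)$ is embedded in $G=\mathrm{GL}_n(F)$ by identifying $E^m$ with $F^n$ via the $F$-basis $(\delta e_1,\dots,\delta e_m,e_1,\dots,e_m)$, where $(e_i)$ is the canonical basis of $E^m$ and $\delta\in E\setminus F$ satisfies $\delta^2\in F$. A character $\mu$ of $E^*$ is also viewed as the character $\mu\circ\det_E$ of $H$, with $\det_E$ the determinant of $\mathrm{GL}_m(E)$. A representation $\pi$ of $G$ is $\mu$-distinguished if $\mathrm{Hom}_H(\pi,\mu)\neq\{0\}$. $L/F$ is the unramified extension of degree $n$. A pair $(L,\chi)$ is tame admissible if $\chi$ is a character of $L^*$ trivial on $1+\mathcal{P}_L$ which is regular, i.e. $\chi\circ\gamma=\chi$ with $\gamma\in\mathrm{Gal}_F(L)$ implies $\gamma=\mathrm{id}$. Then $\chi$ induces a regular character $\overline\chi$ of $k_L^*$, and $\overline\pi_{\overline\chi}$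 denotes the irreducible cuspidal representation of $\mathrm{GL}_n(k_F)$ attached to it by Green's parametrization. Inflate $\overline\pi_{\overline\chi}$ to $\mathrm{GL}_n(\mathcal{O}_F)$, extend it to $\mathcal{K}=F^*\mathrm{GL}_n(\mathcal{O}_F)$ by $\lambda_\chi(xk)=\chi(x)\overline\pi_{\overline\chi}(k)$ for $x\in F^*$, $k\in \mathrm{GL}_n(\mathcal{O}_F)$, and set $\pi(\chi)=\mathrm{c\text{-}Ind}_{\mathcal{K}}^{G}(\lambda_\chi)$. These are exactly the depth-zero cuspidal representations of $G$. *)

(* Defs.v *)
From HB Require Import structures.
From mathcomp Require Import all_boot all_order all_algebra all_fingroup.
From mathcomp Require Import all_field mxrepresentation.
From mathcomp Require Import boolp classical_sets functions.
From mathcomp Require Import zify.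
From mathcomp Require Import complex reals.

Set Implicit Arguments.
Unset Strict Implicit.
Unset Printing Implicit Defensive.

Import Order.TTheory GRing.Theory Num.Theory.
Local Open Scope ring_scope.

(* The fractional ideal P^N, for v : K -> int a valuation whose value at 0 is
   irrelevant (0 belongs to every P^N). *)
Definition pideal (K : fieldType) (v : K -> int) (N : int) : {pred K} :=
  [pred x | (x == 0) || (N <= v x)].

(* A complete field for a normalized discrete valuation, with finite residue
   field.  The residue field is presented by the reduction map O -> O/P: a ring
   morphism from O = P^0 onto a finite field, with kernel P = P^1; the values
   of the reduction map outside O are irrelevant. *)
Record localField (K : fieldType) := LocalField {
  lval : K -> int;
  resField : finFieldType;
  red : K -> resField;
  lvalM : forall x y, x != 0 -> y != 0 -> lval (x * y) = lval x + lval y;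
  lvalD : forall x y, x != 0 -> y != 0 -> x + y != 0 ->
    Num.min (lval x) (lval y) <= lval (x + y);
  lval_unif : exists2 x, x != 0 & lval x = 1;
  lcomplete : forall u : nat -> K,
    (forall N : int, exists n0, forall i j,
       (n0 <= i)%N -> (n0 <= j)%N -> u i - u j \in pideal lval N) ->
    exists l, forall N : int, exists n0, forall i,
       (n0 <= i)%N -> u i - l \in pideal lval N;
  red1 : red 1 = 1;
  redD : {in pideal lval 0 &, {morph red : x y / x + y}};
  redM : {in pideal lval 0 &, {morph red : x y / x * y}};
  red_surj : forall a, exists x, (x \in pideal lval 0) && (red x == a);
  red_eq0 : {in pideal lval 0, forall x, (red x == 0) = (x \in pideal lval 1)}
}.

Section LocalFieldTheory.
Variables (K : fieldType) (vK : localField K).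

Definition ideal (N : int) : {pred K} := pideal (lval vK) N.
Definition integers : {pred K} := ideal 0.

Definition lift (a : resField vK) : K := xchoose (red_surj a).

Lemma ideal0 N : 0 \in ideal N.
Proof. by rewrite inE eqxx. Qed.

Lemma lval1 : lval vK 1 = 0.
Proof.
have := lvalM vK (oner_neq0 K) (oner_neq0 K); rewrite mulr1 => e.
by apply: (@addrI _ (lval vK 1)); rewrite -e addr0.
Qed.

Lemma integers1 : 1 \in integers.
Proof. by rewrite inE lval1 lexx orbT. Qed.

Lemma ideal_le M N x : N <= M -> x \in ideal M -> x \in ideal N.
Proof.
by rewrite !inE => NM /orP[->//|Mx]; rewrite (le_trans NM Mx) orbT.
Qed.

Lemma idealD N x y : x \in ideal N -> y \in ideal N -> x + y \in ideal N.
Proof.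
have [->|x0] := eqVneq x 0; first by rewrite add0r.
have [->|y0] := eqVneq y 0; first by rewrite addr0.
rewrite !inE (negPf x0) (negPf y0) /= => Nx Ny.
case: eqVneq => //= s0; apply: le_trans (lvalD _ x0 y0 s0).
by rewrite le_min Nx Ny.
Qed.

Lemma idealM M N x y : x \in ideal M -> y \in ideal N -> x * y \in ideal (M + N).
Proof.
have [->|x0] := eqVneq x 0; first by move=> _ _; rewrite mul0r ideal0.
have [->|y0] := eqVneq y 0; first by move=> _ _; rewrite mulr0 ideal0.
rewrite !inE (negPf x0) (negPf y0) /= => Nx Ny.
by rewrite lvalM // lerD ?orbT.
Qed.

Lemma ideal_sum N (I : Type) (r : seq I) (P : pred I) (F : I -> K) :
  (forall i, P i -> F i \in ideal N) -> \sum_(i <- r | P i) F i \in ideal N.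
Proof.
move=> h; apply: (big_ind (fun x => x \in ideal N)) => //; first exact: ideal0.
by move=> x y; exact: idealD.
Qed.

Lemma liftP a : lift a \in integers /\ red vK (lift a) = a.
Proof. by have /andP[h /eqP] := xchooseP (red_surj a); split. Qed.

End LocalFieldTheory.

(* The valuation of K extends the one of F with ramification index 1 (the
   residue extension is automatically separable). *)
Definition unramified (F : fieldType) (vF : localField F)
    (K : fieldExtType F) (vK : localField K) : Prop :=
  forall x : F, x != 0 -> lval vK x%:A = lval vF x.

(* the embedding k_F -> k_K induced by F -> K *)
Definition resEmb (F : fieldType) (vF : localField F)
    (K : fieldExtType F) (vK : localField K) (a : resField vF) : resField vK :=
  red vK (lift a)%:A.
Arguments resEmb {F} vF {K} vK a.

Section Characters.
Variables (C : numClosedFieldType) (K : fieldType) (vK : localField K).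

(* A smooth, not necessarily unitary, character of K^*; the value of chi at 0
   is irrelevant. *)
Record character (chi : K -> C) : Prop := Character {
  char_neq0 : forall x, x != 0 -> chi x != 0;
  charM : forall x y, x != 0 -> y != 0 -> chi (x * y) = chi x * chi y;
  char_smooth : exists2 N : nat, (0 < N)%N &
    forall x, x \in ideal vK N%:Z -> chi (1 + x) = 1
}.

(* For a tame chi this does not depend on the choice of the lift of a != 0. *)
Definition resChar (chi : K -> C) (a : resField vK) : C := chi (lift a).

End Characters.
Arguments resChar {C K} vK chi a.

(* Gal_F(L) consists of the F-automorphisms f of L. *)
Record tameAdmissible (C : numClosedFieldType) (F : fieldType)
    (L : fieldExtType F) (vL : localField L) (chi : L -> C) : Prop :=
  TameAdmissible {
  tame_char : character vL chi;
  tame_level0 : forall x, x \in ideal vL 1 -> chi (1 + x) = 1;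
  tame_regular : forall f : 'End(L), kAut 1%VS {:L}%VS f ->
    (forall x, x != 0 -> chi (f x) = chi x) -> f = \1%VF
}.

Record GL (n : nat) (K : fieldType) := MkGL {
  GLval :> 'M[K]_n;
  GLvalP : GLval \in unitmx
}.
Arguments MkGL {n K}.

HB.instance Definition _ n K := [isSub for @GLval n K].
HB.instance Definition _ n K := [Choice of GL n K by <:].

Section GLgroup.
Variables (n : nat) (K : fieldType).
Implicit Types g h : GL n K.

Definition GLone : GL n K := MkGL 1%:M (unitmx1 K n).

Lemma GLmul_subproof g h : g *m h \in unitmx.
Proof. by rewrite unitmx_mul !GLvalP. Qed.
Definition GLmul g h : GL n K := MkGL (g *m h) (GLmul_subproof g h).

Lemma GLinv_subproof g : invmx g \in unitmx.
Proof. by rewrite unitmx_inv GLvalP. Qed.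
Definition GLinv g : GL n K := MkGL (invmx g) (GLinv_subproof g).

Lemma GLmulA : associative GLmul.
Proof. by move=> g h k; apply: val_inj; rewrite /= mulmxA. Qed.
Lemma GLmul1g : left_id GLone GLmul.
Proof. by move=> g; apply: val_inj; rewrite /= mul1mx. Qed.
Lemma GLmulg1 : right_id GLone GLmul.
Proof. by move=> g; apply: val_inj; rewrite /= mulmx1. Qed.
Lemma GLmulVg : left_inverse GLone GLinv GLmul.
Proof. by move=> g; apply: val_inj; rewrite /= mulVmx ?GLvalP. Qed.
Lemma GLmulgV : right_inverse GLone GLinv GLmul.
Proof. by move=> g; apply: val_inj; rewrite /= mulmxV ?GLvalP. Qed.

HB.instance Definition _ :=
  isGroup.Build (GL n K) GLmulA GLmul1g GLmulg1 GLmulVg GLmulgV.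

End GLgroup.

HB.instance Definition _ n (k : finFieldType) := [Finite of GL n k by <:].

(* GL_n(O) *)
Definition GLint (n : nat) (K : fieldType) (vK : localField K)
    (g : GL n K) : Prop :=
  forall i j, (g i j \in integers vK) /\ ((g^-1)%g i j \in integers vK).

(* the congruence subgroups 1 + M_n(P^N), for N > 0 *)
Definition GLcongr (n : nat) (K : fieldType) (vK : localField K) (N : nat)
    (g : GL n K) : Prop :=
  forall i j, ((g : 'M_n) - 1%:M) i j \in ideal vK N%:Z.

(* reduction GL_n(O) -> GL_n(k); irrelevant default value 1 outside GL_n(O),
   see redGLE *)
Definition redGL (n : nat) (K : fieldType) (vK : localField K) (g : GL n K) :
  GL n (resField vK) := insubd (1%g : GL n (resField vK)) (map_mx (red vK) g).

(* K = F^* GL_n(O) *)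
Definition GLmodcenter (n : nat) (K : fieldType) (vK : localField K)
    (g : GL n K) : Prop :=
  exists x (k : GL n K), [/\ x != 0, GLint vK k & (g : 'M_n) = x *: (k : 'M_n)].

Section RedGL.
Variables (n : nat) (K : fieldType) (vK : localField K).

Lemma red0 : red vK 0 = 0.
Proof.
by apply/eqP; rewrite (red_eq0 (ideal0 vK 0)); exact: (ideal0 vK 1).
Qed.

Lemma red_sum (I : Type) (r : seq I) (F : I -> K) :
  (forall i, F i \in integers vK) ->
  red vK (\sum_(i <- r) F i) = \sum_(i <- r) red vK (F i).
Proof.
move=> h; elim: r => [|i r IH]; first by rewrite !big_nil red0.
rewrite !big_cons redD ?IH //.
by apply: ideal_sum => j _; exact: h.
Qed.

Lemma red_mulmx (A B : 'M[K]_n) :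
  (forall i j, A i j \in integers vK) -> (forall i j, B i j \in integers vK) ->
  map_mx (red vK) (A *m B) = map_mx (red vK) A *m map_mx (red vK) B.
Proof.
move=> hA hB; apply/matrixP => i j; rewrite !mxE red_sum; last first.
  by move=> k; have := idealM (hA i k) (hB k j); rewrite addr0.
by apply: eq_bigr => k _; rewrite redM ?mxE //.
Qed.

Lemma red_mx1 : map_mx (red vK) (1%:M : 'M_n) = 1%:M.
Proof.
by apply/matrixP => i j; rewrite !mxE; case: (i == j); rewrite ?red1 ?red0.
Qed.

Lemma redGLE (g : GL n K) : GLint vK g ->
  redGL vK g = map_mx (red vK) g :> 'M[resField vK]_n.
Proof.
move=> hg; rewrite /redGL -[LHS]/(\val _) insubdK //.
rewrite -topredE /=.
have: map_mx (red vK) g *m map_mx (red vK) (g^-1)%g = 1%:M.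
  rewrite -red_mulmx ?red_mx1; last by move=> i j; case: (hg i j).
    by rewrite -[X in map_mx _ X]/(\val (g * g^-1)%g) mulgV red_mx1.
  by move=> i j; case: (hg i j).
by case/mulmx1_unit.
Qed.

End RedGL.

Section Finite.
Variables (C : numClosedFieldType) (n : nat) (k : finFieldType) (d : nat).
Variable rho : mx_representation C [set: GL n k] d.

(* rho g acts on column vectors; this is the unipotent radical of the standard
   maximal parabolic subgroup of block sizes (a, n - a). *)
Definition unipRadical (a : nat) (u : GL n k) : Prop :=
  forall i j : 'I_n, ~~ ((i < a)%N && (a <= j)%N) -> u i j = (i == j)%:R.

Definition cuspidal : Prop :=
  forall a, (0 < a < n)%N -> forall w : 'cV[C]_d,
    (forall u, unipRadical a u -> rho u *m w = w) -> w = 0.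

(* Green's formula for the character of the cuspidal representation attached
   to theta, for kn/k an extension of degree n, with embedding iota.  If the
   characteristic polynomial of g is a power of an irreducible f of degree e
   with root x in kn, and x-eigenspace of g has dimension r, the value at g is
   (-1)^(n-1) (sum_(i < e) theta (x^(q^i))) (1-q^e)(1-q^(2e))...(1-q^((r-1)e));
   the value is 0 at the other elements. *)
Definition greenCharacter (kn : finFieldType) (iota : k -> kn)
    (theta : kn -> C) : Prop :=
  (forall (g : GL n k) (f : {poly k}) (s : nat) (x : kn),
     irreducible_poly f -> char_poly g = f ^+ s -> root (map_poly iota f) x ->
     let e := (size f).-1 in
     let r := \rank (eigenspace (map_mx iota g) x) in
     \tr (rho g) = (-1) ^+ n.-1 *
       (\sum_(i < e) theta (x ^+ (#|k| ^ i))) *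
       \prod_(1 <= j < r) (1 - #|k|%:R ^+ (j * e)))
  /\
  (forall g : GL n k,
     (forall (f : {poly k}) (s : nat), irreducible_poly f ->
        char_poly g <> f ^+ s) ->
     \tr (rho g) = 0).

Definition isGreenCuspidal (kn : finFieldType) (iota : k -> kn)
    (theta : kn -> C) : Prop :=
  [/\ mx_irreducible rho, cuspidal & greenCharacter iota theta].

End Finite.

Record representation (C : fieldType) (G : groupType) (V : lmodType C) :=
  Representation {
  ract :> G -> {linear V -> V};
  ract1 : forall v, ract 1%g v = v;
  ractM : forall g h v, ract (g * h)%g v = ract g (ract h v)
}.

Section Hom.
Variables (C : fieldType) (G H : groupType) (V : lmodType C).
Variables (pi : representation G V) (emb : H -> G) (mu : H -> C).

Definition homPred : {pred V -> C^o} := fun l =>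
  `[< (forall a v w, l (a *: v + w) = a * l v + l w) /\
      (forall h v, l (pi (emb h) v) = mu h * l v) >].

Lemma homPred_submod : submod_closed homPred.
Proof.
split=> [|a f g].
  by apply/asboolP; split=> [b v w|h v]; rewrite /= ?mulr0 ?addr0.
move=> /asboolP[fl fe] /asboolP[gl ge]; apply/asboolP; split=> [b v w|h v].
  rewrite -![(a *: f + g) _]/(a * f _ + g _) fl gl !mulrDr !addrA.
  by rewrite mulrCA -!addrA; congr (_ + _); rewrite addrCA.
by rewrite -![(a *: f + g) _]/(a * f _ + g _) fe ge mulrDr mulrCA.
Qed.

HB.instance Definition _ :=
  GRing.isSubmodClosed.Build C (V -> C^o) homPred homPred_submod.

(* Hom_H(pi, mu), where H acts on pi through emb : H -> G *)
Record HomSpace := MkHomSpace { homVal :> V -> C^o; homP : homVal \in homPred }.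

HB.instance Definition _ := [isSub for homVal].
HB.instance Definition _ := [Choice of HomSpace by <:].
HB.instance Definition _ := [SubChoice_isSubLmodule of HomSpace by <:].

Definition distinguished : Prop := exists l : HomSpace, l != 0.

End Hom.

Section CInd.
Variables (C : numClosedFieldType) (n : nat) (F : fieldType).
Variable vF : localField F.
Variables (K : GL n F -> Prop) (d : nat) (lam : GL n F -> 'M[C]_d).

(* K is meant to be an open subgroup, and lam a representation of K; the values
   of lam outside K are irrelevant.  As K is open, a support is
   compact modulo K if and only if it is contained in a finite union of cosets
   K g'. *)
Definition cIndPred : {pred GL n F -> 'cV[C]_d} := fun f =>
  `[< [/\ forall k g : GL n F, K k -> f (k * g)%g = lam k *m f g,
          exists2 N : nat, (0 < N)%N &
            forall g u : GL n F, GLcongr vF N u -> f (g * u)%g = f g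
        & exists s : seq (GL n F), forall g : GL n F, f g != 0 ->
            exists k g' : GL n F, [/\ K k, g' \in s & g = (k * g')%g]] >].

Lemma GLcongr_le M N (u : GL n F) :
  (N <= M)%N -> GLcongr vF M u -> GLcongr vF N u.
Proof. by move=> NM h i j; apply: ideal_le (h i j); rewrite lez_nat. Qed.

Lemma cIndPred_submod : submod_closed cIndPred.
Proof.
split=> [|a f h].
  apply/asboolP; split=> [k g _|| ]; first by rewrite mulmx0.
    by exists 1%N.
  by exists [::] => g /eqP.
move=> /asboolP[fK [N N0 fN] [s fs]] /asboolP[hK [M M0 hM] [t ht]].
apply/asboolP; split=> [k g Kk||].
- rewrite -![(a *: f + h) _]/(a *: f _ + h _).
  by rewrite fK // hK // mulmxDr -scalemxAr.
- exists (maxn N M) => [|g u hu]; first by rewrite leq_max N0.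
  rewrite -![(a *: f + h) _]/(a *: f _ + h _).
  by rewrite fN ?hM //; apply: GLcongr_le hu; rewrite leq_max leqnn ?orbT.
- exists (s ++ t) => g; rewrite -![(a *: f + h) _]/(a *: f _ + h _) => nz.
  have [fg|/fs[k [g' [Kk g's ->]]]] := eqVneq (f g) 0; last first.
    by exists k, g'; rewrite mem_cat g's.
  have [|k [g' [Kk g't ->]]] := ht g; last first.
    by exists k, g'; rewrite mem_cat g't orbT.
  by apply: contraNneq nz => ->; rewrite fg scaler0 addr0.
Qed.

HB.instance Definition _ :=
  GRing.isSubmodClosed.Build C (GL n F -> 'cV[C]_d) cIndPred cIndPred_submod.

Record cInd := MkCInd {
  cIndVal :> GL n F -> 'cV[C]_d;
  cIndP : cIndVal \in cIndPred
}.

HB.instance Definition _ := [isSub for cIndVal].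
HB.instance Definition _ := [Choice of cInd by <:].
HB.instance Definition _ := [SubChoice_isSubLmodule of cInd by <:].

Lemma GLbound (x : GL n F) :
  exists B : nat, forall i j, x i j \in ideal vF (- B%:Z).
Proof.
exists (\max_(i < n) \max_(j < n) `|lval vF (x i j)|)%N => i j.
rewrite !inE; case: eqVneq => //= _; rewrite lerNl.
apply: le_trans (_ : `|lval vF (x i j)| <= _).
  by rewrite -normrN ler_norm.
rewrite -abszE lez_nat; apply: leq_trans (leq_bigmax i).
exact: (leq_bigmax (F := fun j => `|lval vF (x i j)|%N) j).
Qed.

Lemma GLcongr_conj (x : GL n F) (N : nat) :
  exists2 M : nat, (0 < M)%N &
    forall u, GLcongr vF M u -> GLcongr vF N (x^-1 * u * x)%g.
Proof.
have [B hB] := GLbound x; have [B' hB'] := GLbound x^-1%g.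
exists (N + B + B').+1 => // u hu i j.
have -> : ((x^-1 * u * x)%g : 'M_n) - 1%:M =
    (x^-1)%g *m ((u : 'M_n) - 1%:M) *m x.
  rewrite mulmxBr mulmxBl mulmx1; congr (_ - _).
  by rewrite -[RHS]/(\val (x^-1 * x)%g) mulVg.
rewrite mxE; apply: ideal_sum => k _; rewrite mxE.
apply: (@ideal_le _ _ (- B'%:Z + (N + B + B').+1%:Z + - B%:Z)).
  by rewrite -addn1 !PoszD; lia.
by apply: idealM (hB _ _); apply: ideal_sum => l _; exact: idealM.
Qed.

Lemma cInd_transl_subproof (x : GL n F) (f : cInd) :
  (fun g => f (g * x)%g) \in cIndPred.
Proof.
have /asboolP[fK [N N0 fN] [s fs]] := cIndP f.
apply/asboolP; split=> [k g Kk||].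
- by rewrite -mulgA (fK k (g * x)%g).
- have [M M0 hM] := GLcongr_conj x N; exists M => // g u /hM hu /=.
  rewrite -(fN (g * x)%g _ hu) !mulgA mulgK //.
- exists [seq (g' * x^-1)%g | g' <- s] => g /fs[k [g' [Kk g's e]]].
  exists k, (g' * x^-1)%g; split => //; first exact: map_f.
  by rewrite mulgA -e mulgK.
Qed.

Definition cInd_transl (x : GL n F) (f : cInd) : cInd :=
  MkCInd (cInd_transl_subproof x f).

Lemma cInd_transl_linear x : linear (cInd_transl x).
Proof. by move=> a f h; apply: val_inj. Qed.

HB.instance Definition _ x :=
  GRing.isLinear.Build C cInd cInd _ (cInd_transl x) (cInd_transl_linear x).

Lemma cInd_transl1 f : cInd_transl 1%g f = f.
Proof. by apply/val_inj/funext => g /=; rewrite mulg1. Qed.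

Lemma cInd_translM x y f :
  cInd_transl (x * y)%g f = cInd_transl x (cInd_transl y f).
Proof. by apply/val_inj/funext => g /=; rewrite mulgA. Qed.

(* G acts by right translation: (x f)(g) = f (g x) *)
Definition cIndRep : representation (GL n F) cInd :=
  @Representation C (GL n F) cInd cInd_transl cInd_transl1 cInd_translM.

End CInd.

(* lam is lambda_chi on F^* GL_n(O), where rho is a representation of GL_n(k_F):
   lam (x k) = chi(x) rho (k mod P) *)
Definition isLambda (C : numClosedFieldType) (n d : nat) (F : fieldType)
    (vF : localField F) (L : fieldExtType F) (chi : L -> C)
    (rho : mx_representation C [set: GL n (resField vF)] d)
    (lam : GL n F -> 'M[C]_d) : Prop :=
  forall (x : F) (k g : GL n F), x != 0 -> GLint vF k ->
    (g : 'M_n) = x *: (k : 'M_n) -> lam g = chi x%:A *: rho (redGL vF k).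

Section Embedding.
Variables (F : fieldType) (E : fieldExtType F) (m : nat).
Variable delta : E.
Hypothesis dimE : \dim {:E} = 2.
Hypothesis deltaNF : delta \notin 1%VS.

Definition quadBasis : 2.-tuple E := [tuple delta; 1].

(* the F-basis (delta e_1, ..., delta e_m, e_1, ..., e_m) of E^m *)
Definition vecBasis (j : 'I_(m + m)) : 'cV[E]_m :=
  match fintype.split j with
  | inl j => delta *: delta_mx j 0
  | inr j => delta_mx j 0
  end.

(* coordinates in this basis *)
Definition vecCoord (w : 'cV[E]_m) : 'cV[F]_(m + m) :=
  \col_i match fintype.split i with
         | inl i => coord quadBasis 0 (w i 0)
         | inr i => coord quadBasis 1 (w i 0)
         end.

Lemma quadBasis_free : free quadBasis.
Proof.
rewrite /quadBasis free_cons span_seq1 seq1_free oner_neq0 andbT.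
exact: deltaNF.
Qed.

Lemma quadBasis_basis : basis_of {:E} quadBasis.
Proof. by rewrite basisEfree quadBasis_free subvf size_tuple dimE. Qed.

Lemma quadBasisE (x : E) :
  x = (coord quadBasis 0 x)%:A * delta + (coord quadBasis 1 x)%:A.
Proof.
have := coord_basis quadBasis_basis (memvf x).
rewrite !big_ord_recl big_ord0 addr0 /= => {1}->; rewrite mulr_algl.
by congr (_ + _%:A); congr (coord _ _ _); apply: val_inj.
Qed.

Lemma vecBasisE (w : 'cV[E]_m) :
  w = \sum_i (vecCoord w i 0)%:A *: vecBasis i.
Proof.
rewrite big_split_ord /= -big_split /= [LHS]matrix_sum_delta.
apply: eq_bigr => i _; rewrite big_ord1 !mxE /vecBasis.
rewrite -[lshift m i]/(unsplit (inl i)) -[rshift m i]/(unsplit (inr i)).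
by rewrite !unsplitK scalerA -scalerDl -quadBasisE.
Qed.

(* the matrix of the F-linear map w |-> h w of E^m in this basis *)
Definition embedMx (h : 'M[E]_m) : 'M[F]_(m + m) :=
  \matrix_(i, j) vecCoord (h *m vecBasis j) i 0.

Lemma vecCoordD w z : vecCoord (w + z) = vecCoord w + vecCoord z.
Proof. by apply/colP => i; rewrite !mxE; case: fintype.split => j; rewrite mxE raddfD. Qed.

Lemma vecCoordZ (a : F) w : vecCoord (a%:A *: w) = a *: vecCoord w.
Proof.
by apply/colP => i; rewrite !mxE; case: fintype.split => j; rewrite mxE mulr_algl linearZ.
Qed.

Lemma vecCoord_sum (I : Type) (r : seq I) (f : I -> 'cV[E]_m) :
  vecCoord (\sum_(i <- r) f i) = \sum_(i <- r) vecCoord (f i).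
Proof.
elim: r => [|i r IH]; last by rewrite !big_cons vecCoordD IH.
by rewrite !big_nil; have := vecCoordZ 0 0; rewrite scaler0 scale0r.
Qed.

Lemma vecCoord_inj : injective vecCoord.
Proof. by move=> w z e; rewrite (vecBasisE w) (vecBasisE z) e. Qed.

Lemma vecCoord_basis j : vecCoord (vecBasis j) = delta_mx j 0.
Proof.
have c0 : coord quadBasis 0 delta = 1 /\ coord quadBasis 1 delta = 0.
  have := coord_free (0 : 'I_2) (0 : 'I_2) quadBasis_free.
  by have := coord_free (0 : 'I_2) (1 : 'I_2) quadBasis_free => /= -> ->.
have c1 : coord quadBasis 0 1 = 0 /\ coord quadBasis 1 1 = 1.
  have := coord_free (1 : 'I_2) (0 : 'I_2) quadBasis_free.
  by have := coord_free (1 : 'I_2) (1 : 'I_2) quadBasis_free => /= -> ->.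
apply/colP => i; rewrite !mxE eqxx andbT /vecBasis.
rewrite -(splitK i) -(splitK j).
move: (fintype.split i) (fintype.split j) => {}i {}j; rewrite !unsplitK.
have [[c01 c02] [c11 c12]] := (c0, c1).
case: i => i; case: j => j /=; rewrite !mxE eqxx andbT;
  rewrite ?eq_lshift ?eq_rshift ?eq_lrshift ?eq_rlshift;
  by case: (i == j); rewrite ?mulr1 ?mulr0 ?linear0 // ?c01 ?c02 ?c11 ?c12.
Qed.

(* embedMx h is h seen through the identification of E^m with F^(2m) *)
Lemma embedMxP (h : 'M[E]_m) w : vecCoord (h *m w) = embedMx h *m vecCoord w.
Proof.
rewrite {1}(vecBasisE w) mulmx_sumr vecCoord_sum.
apply/colP => i; rewrite summxE mxE; apply: eq_bigr => j _.
by rewrite -scalemxAr vecCoordZ mxE [embedMx _ _ _]mxE mulrC.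
Qed.

Lemma embedMxM h h' : embedMx (h *m h') = embedMx h *m embedMx h'.
Proof.
apply/matrixP => i j; rewrite mxE -mulmxA embedMxP !mxE.
by apply: eq_bigr => k _; rewrite [embedMx h' k j]mxE.
Qed.

Lemma embedMx1 : embedMx 1%:M = 1%:M.
Proof. by apply/matrixP => i j; rewrite mxE mul1mx vecCoord_basis !mxE andbT. Qed.

Lemma embedGL_subproof (h : GL m E) : embedMx h \in unitmx.
Proof.
have : embedMx h *m embedMx (invmx h) = 1%:M.
  by rewrite -embedMxM mulmxV ?GLvalP // embedMx1.
by case/mulmx1_unit.
Qed.

Definition embedGL (h : GL m E) : GL (m + m) F := MkGL (embedMx h) (embedGL_subproof h).

End Embedding.

(* Main.v *)
(* Evaluating an element of Hom_H(pi, mu) on the functions of pi supported on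
   K g, K = F^* GL_n(O_F), gives a row vector lam_g in the dual of the cuspidal
   representation rho of GL_n(k_F), and lam_g rho(red(g h g^-1)) = mu(det h) lam_g
   whenever h is in H and g h g^-1 in GL_n(O_F).  Let J be the matrix of delta and
   suppose that lam_g <> 0.  Let a >= 0 be minimal such that the multiple eps of
   g J g^-1 by a power of a uniformizer w, whose square has valuation 2a, is
   integral.  If a > 0, then the equation at the elements g h g^-1 of the form
   1 + eps x z + x z eps shows that the unipotent radical attached to the image of
   the reduction of eps fixes lam_g when that reduction has rank < m, which
   cuspidality forbids.  Hence g is in K g_a H, where g_a = diag(w^-i, 1) has
   2 x 2 block form for some i depending only on a.  Cuspidality also shows that mu
   is nontrivial on 1 + O_F eps_E if a > 0, eps_E in E being the analogue of eps,
   whereas mu is trivial on 1 + w O_F eps_E.  So a is the same for all g with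
   lam_g <> 0, and it remains to bound the space of the vectors lam_{g_a} by 1.
   If a = 0, they are equivariant under GL_m(k_E): the operators E rho(g) E, E the
   projector on the equivariant vectors, commute by the Gelfand trick for the
   anti-involution g |-> s g^-1 s, where s is antilinear.
   If a > 0, they are equivariant under the Shalika subgroup, for a nontrivial
   character psi; such a vector is determined by its product with the projector
   on the Whittaker vectors, and this projector has rank 1 because
   dim rho = (q - 1)(q^2 - 1)...(q^(n-1) - 1). *)

From HB Require Import structures.
From mathcomp Require Import all_boot all_order all_algebra all_fingroup.
From mathcomp Require Import all_field mxrepresentation.
From mathcomp Require Import boolp.
From mathcomp Require Import zify ring.
From mathcomp Require Import complex reals.
Require Import Defs.

Set Implicit Arguments.
Unset Strict Implicit.
Unset Printing Implicit Defensive.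
Import Order.TTheory GRing.Theory Num.Theory.
Local Open Scope ring_scope.

(** * Operators of a representation of a finite GL_n *)

(** The double cosets of K and H in G are never classified: g enters only through g J g^-1 and the
    reduction of its smallest integral multiple, so that lam_g <> 0 alone confines g to K g_a H. The
    integer a is the depth of mu. In the case a = 0 the Gelfand trick is twisted, because mu need
    not be trivial: with phi g = E rho(g) E and tau g = s g^-1 s, the relation is phi g = kap(det g)
    phi (tau g), kap being mu on F^*, and it rests on the determinant over F being the norm of the
    determinant over E. It is proved by explicit factorizations when the linear or the antilinear
    part of g is invertible; for the remaining g both sides vanish by cuspidality. In the case a > 0
    the uniqueness of Whittaker vectors is derived from the dimension, which is Green's formula at
    the identity: each row of the upper unipotent group divides the trace of the projector by some
    q^i - 1, until 1 is left. The passage from Shalika to Whittaker vectors interleaves the two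
    halves of the basis and goes row by row: a character of a row either cannot occur in the
    functional or is conjugate to the standard one under the Shalika subgroup. *)

Section MatrixGroup.
Variables (K : fieldType) (n : nat).

Definition mkGL (A : 'M[K]_n) : GL n K := insubd (1%g : GL n K) A.

Lemma mkGLE A : A \in unitmx -> mkGL A = A :> 'M_n.
Proof. by move=> uA; rewrite -[LHS]/(\val _) insubdK. Qed.

Lemma mkGL_val (g : GL n K) : mkGL g = g.
Proof. by apply: val_inj; rewrite /= mkGLE ?GLvalP. Qed.

Lemma mkGLM A B : A \in unitmx -> B \in unitmx ->
  mkGL (A *m B) = (mkGL A * mkGL B)%g.
Proof.
by move=> uA uB; apply: val_inj; rewrite /= !mkGLE // unitmx_mul uA.
Qed.

Lemma mkGL1 : mkGL 1%:M = 1%g.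
Proof. by apply: val_inj; rewrite /= mkGLE ?unitmx1. Qed.

End MatrixGroup.

Lemma unitmx_1D (K : fieldType) n (f : 'M[K]_n) :
  f *m f = 0 -> 1%:M + f \in unitmx.
Proof.
move=> f2; have : (1%:M + f) *m (1%:M - f) = 1%:M.
  by rewrite mulmxDl mul1mx mulmxBr mulmx1 f2 subr0 subrK.
by case/mulmx1_unit.
Qed.

(* extended by 1 at the singular matrices *)
Definition repm (C : fieldType) (k : finFieldType) (n d : nat)
  (rho : mx_representation C [set: GL n k] d) (A : 'M[k]_n) : 'M[C]_d :=
  rho (mkGL A).

(* f runs over Hom(W / im p, im p), so that 1 + f runs over the unipotent
   radical of the stabilizer of im p. *)
Definition radp (K : fieldType) n (p f : 'M[K]_n) :=
  (p *m f == f) && (f *m p == 0).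

Lemma radpP (K : fieldType) n (p f : 'M[K]_n) :
  reflect (p *m f = f /\ f *m p = 0) (radp p f).
Proof. by apply: (iffP andP) => -[/eqP ? /eqP ?]. Qed.

Lemma radp_mul (K : fieldType) n (p f g : 'M[K]_n) :
  radp p f -> radp p g -> f *m g = 0.
Proof.
by move=> /radpP[_ fp] /radpP[<- _]; rewrite mulmxA fp mul0mx.
Qed.

Lemma radpD (K : fieldType) n (p f g : 'M[K]_n) :
  radp p f -> radp p g -> radp p (f + g).
Proof.
move=> /radpP[pf fp] /radpP[pg gp]; apply/radpP.
by rewrite mulmxDr mulmxDl pf fp pg gp addr0.
Qed.

Lemma radpN (K : fieldType) n (p f : 'M[K]_n) : radp p (- f) = radp p f.
Proof. by rewrite /radp mulmxN mulNmx eqr_opp oppr_eq0. Qed.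

Section Rep.
Variables (C : numClosedFieldType) (k : finFieldType) (n d : nat).
Variable rho : mx_representation C [set: GL n k] d.
Local Notation R := (repm rho).

Lemma repm1 : R 1%:M = 1%:M.
Proof. by rewrite /repm mkGL1 repr_mx1. Qed.

Lemma repmM A B : A \in unitmx -> B \in unitmx -> R (A *m B) = R A *m R B.
Proof. by move=> uA uB; rewrite /repm mkGLM // repr_mxM ?inE. Qed.

(** Burnside's theorem: over the algebraically closed [C] irreducibility is absolute. It lets
    identities checked on the operators [R A] pass to all matrices. *)
Lemma repm_span : mx_irreducible rho -> forall M, exists a : 'M[k]_n -> C,
  M = \sum_(A in unitmx) a A *: R A.
Proof.
move=> irr M; have := group_closure_closed_field irr.
case/mx_abs_irrP=> _ [a aE]; exists (fun A => a (mkGL A) M).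
rewrite {1}(aE M) (reindex_onto (fun A => mkGL A) (fun g : GL n k => g : 'M_n));
  last by move=> g _; exact: mkGL_val.
apply: eq_bigl => A; rewrite inE /=; apply/eqP/idP => [<-|uA].
  exact: GLvalP.
exact: mkGLE.
Qed.

(** [cuspidal] speaks of the standard parabolics only. The image of the sum is fixed by the radical
    of [p], which the basis [col_ebase p] carries to a standard one, so the image is zero. *)
Lemma cuspidal_sum : cuspidal rho -> forall p : 'M[k]_n,
  p *m p = p -> p != 0 -> p != 1%:M ->
  \sum_(f | radp p f) R (1%:M + f) = 0.
Proof.
move=> cusp p pp p0 p1; set S := \sum_(f | _) _.
have rn : (0 < \rank p < n)%N.
  rewrite lt0n mxrank_eq0 p0 /= ltnNge; apply: contra p1 => h.
  have up : p \in unitmx by rewrite -row_full_unit -col_leq_rank.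
  by rewrite -(mulKmx up p) pp mulVmx.
have inv f : radp p f -> R (1%:M + f) *m S = S.
  move=> pf; rewrite mulmx_sumr [RHS](reindex_inj (addrI f)) /=.
  apply: eq_big => [g|g pg].
    apply/idP/idP => [pg|pfg]; first exact: radpD.
    by rewrite -(addKr f g) radpD // radpN.
  rewrite -repmM ?unitmx_1D ?(radp_mul pf pf) ?(radp_mul pg pg) //.
  by rewrite mulmxDl mul1mx mulmxDr mulmx1 (radp_mul pf pg) addr0 -addrA (addrC g).
set L := col_ebase p; have uL : L \in unitmx by exact: col_ebase_unit.
have uL' : invmx L \in unitmx by rewrite unitmx_inv.
have pE : p = L *m pid_mx (\rank p) *m row_ebase p by rewrite mulmx_ebase.
have key w : R (invmx L) *m (S *m w) = 0 :> 'cV_d.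
  apply: (cusp _ rn) => u hu; rewrite -[u]mkGL_val -[rho _]/(R u).
  set N := (u : 'M_n) - 1%:M.
  have N0 (i j : 'I_n) : ~~ ((i < \rank p)%N && (\rank p <= j)%N) -> N i j = 0.
    by move=> h; rewrite /N !mxE hu // subrr.
  have pidN : pid_mx (\rank p) *m N = N.
    apply/matrixP=> i j; rewrite mxE (bigD1 i) //= big1 => [|l li]; last first.
      by rewrite mxE eq_sym (negPf (li : val l != val i)) mul0r.
    rewrite addr0 mxE eqxx /=; case: ltnP => h; rewrite ?mul1r // mul0r N0 //.
    by rewrite ltnNge h.
  have Npid : N *m pid_mx (\rank p) = 0 :> 'M_n.
    apply/matrixP=> i j; rewrite !mxE big1 // => l _; rewrite [pid_mx _ _ _]mxE.
    case lj: (l == j :> nat); last by rewrite mulr0.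
    case: ltnP => h; last by rewrite andbF mulr0.
    by rewrite N0 ?mul0r // (leqNgt _ l) h andbF.
  have pLpid : p *m (L *m pid_mx (\rank p)) = L *m pid_mx (\rank p) :> 'M_n.
    have uR := row_ebase_unit p; apply: (can_inj (mulmxK uR)).
    by rewrite -[RHS]pE -{4}pp {5}pE !mulmxA.
  have pf : radp p (L *m N *m invmx L).
    apply/radpP; split.
      by rewrite -pidN !mulmxA -(mulmxA p L) pLpid.
    by rewrite {1}pE !mulmxA mulmxKV // -(mulmxA L) Npid mulmx0 mul0mx.
  have uE : u = invmx L *m (1%:M + L *m N *m invmx L) *m L :> 'M_n.
    rewrite mulmxDr mulmx1 mulmxDl mulVmx // !mulmxA mulVmx // mul1mx mulmxKV //.
    by rewrite /N addrC subrK.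
  have u1 := unitmx_1D (radp_mul pf pf).
  rewrite uE !repmM ?unitmx_mul ?u1 ?uL' // -!mulmxA.
  congr (_ *m _); rewrite [R L *m _]mulmxA -repmM // mulmxV // repm1 mul1mx.
  by rewrite (mulmxA L) (mulmxA (R _) S w) inv.
have Sw w : S *m w = 0 :> 'cV_d.
  have /(congr1 (mulmx (R L))) := key w.
  by rewrite mulmx0 mulmxA -repmM // mulmxV // repm1 mul1mx.
apply/matrixP=> i j; have /colP/(_ i) := Sw (delta_mx j 0).
by rewrite -colE !mxE.
Qed.

End Rep.

(** * Semilinear matrices *)

(* J makes the space K^n of row vectors a vector space over K[sqrt D]; a matrix
   anticommuting with J is semilinear for the conjugation of K[sqrt D] / K. *)
Section Semilinear.
Variables (K : fieldType) (n : nat) (J : 'M[K]_n) (D : K).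
Hypothesis JJ : J *m J = D%:M.
Hypothesis Dns : forall x : K, x * x != D.

(** Multiplying a v + b v J by its conjugate a - b J gives (a^2 - D b^2) v, and this norm is nonzero
    because D is not a square. Hence v and v J are independent modulo a J-stable space that avoids
    v. *)
Lemma line_free m (A : 'M_(m, n)) (v : 'rV_n) (u : 'rV_(1 + 1)) :
  (A *m J <= A)%MS -> ~~ (v <= A)%MS -> (u *m col_mx v (v *m J) <= A)%MS -> u = 0.
Proof.
move=> AJ vA; rewrite -[u]hsubmxK mul_row_col.
set a := lsubmx u; set b := rsubmx u => h.
rewrite [a]mx11_scalar [b]mx11_scalar !mul_scalar_mx in h *.
move: (a 0 0) (b 0 0) h => {u}{}a {}b h.
have vJJ : v *m J *m J = D *: v by rewrite -mulmxA JJ mul_mx_scalar.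
have : ((a * a - D * b * b) *: v <= A)%MS.
  have -> : (a * a - D * b * b) *: v =
      a *: (a *: v + b *: (v *m J)) - b *: ((a *: v + b *: (v *m J)) *m J).
    rewrite mulmxDl -!scalemxAl vJJ !scalerDr !scalerA (mulrC b a).
    rewrite opprD addrA addrK -scalerBl; congr ((_ - _) *: _).
    by ring.
  apply: addmx_sub; first exact: scalemx_sub.
  rewrite eqmx_opp; apply: scalemx_sub; apply: submx_trans AJ; exact: submxMr.
have [c0|c0] := eqVneq (a * a - D * b * b) 0; last first.
  by rewrite (eqmx_scale _ c0) (negPf vA).
have [b0|b0] := eqVneq b 0.
  move/eqP: c0; rewrite b0 mulr0 subr0 mulf_eq0 orbb => /eqP->.
  by rewrite !raddf0 row_mx0.
case/eqP: (Dns (a / b)); move/eqP: c0; rewrite subr_eq0 => /eqP e.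
by rewrite mulrACA e -mulrA -invfM mulfK ?mulf_neq0.
Qed.

(** [X] is a basis over K[J] of a complement of A in B, in K-linear terms; a semilinear map may be
    prescribed freely on the rows of [X]. *)
Lemma lbasis_ext (A B : 'M_n) :
  (A *m J <= A)%MS -> (B *m J <= B)%MS -> (A <= B)%MS ->
  exists r (X : 'M_(r, n)), [/\ (X <= B)%MS, (B <= A + col_mx X (X *m J))%MS
    & \rank B = (\rank A + (r + r))%N].
Proof.
move=> AJ BJ; move: {-1}(\rank B - \rank A)%N (leqnn (\rank B - \rank A)) => N.
elim: N A AJ => [|N IH] A AJ hN AB.
  exists 0, 0; split; first exact: sub0mx; last first.
    by move: hN (mxrankS AB); lia.
  apply: submx_trans (addsmxSl _ _).
  by rewrite -(geq_leqif (mxrank_leqif_sup AB)) -subn_eq0 -leqn0.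
have [BA|/row_subPn[i vA]] := boolP (B <= A)%MS.
  exists 0, 0; split; first exact: sub0mx; first by apply: submx_trans BA (addsmxSl _ _).
  by move: (mxrankS AB) (mxrankS BA); lia.
set v := row i B in vA; set W := col_mx v (v *m J).
have vB : (v <= B)%MS by exact: row_sub.
have vJB : (v *m J <= B)%MS by apply: submx_trans BJ; apply: submxMr.
have free u (h : (u *m W <= A)%MS) : u = 0 := line_free AJ vA h.
have rW : \rank W = 2.
  by apply/eqP; apply/inj_row_free => u uW; apply: free; rewrite uW sub0mx.
have dis : (A :&: W)%MS = 0.
  apply/eqP/rowV0P => w; rewrite sub_capmx => /andP[wA /submxP[u uw]].
  by rewrite uw (free u) ?mul0mx // -uw.
have rA1 : \rank (A + W)%MS = (\rank A + 2)%N by rewrite mxrank_disjoint_sum // rW.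
have A1B : (A + W <= B)%MS by rewrite addsmx_sub AB col_mx_sub vB.
have vJJ : v *m J *m J = D *: v by rewrite -mulmxA JJ mul_mx_scalar.
have A1J : ((A + W)%MS *m J <= A + W)%MS.
  rewrite addsmxMr addsmxS //.
  have : (W <= W)%MS by [].
  rewrite {1}/W mul_col_mx !col_mx_sub vJJ => /andP[vW ->].
  by rewrite scalemx_sub.
have := mxrankS A1B; rewrite rA1 => le2.
have [|r [X [XB BX rB]]] := IH _ A1J _ A1B; first by rewrite rA1; lia.
exists (1 + r)%N, (col_mx v X); split.
- by rewrite col_mx_sub vB.
- apply: submx_trans BX _; set T := (A + col_mx (col_mx v X) _)%MS.
  have : (col_mx (col_mx v X) (col_mx v X *m J) <= T)%MS by exact: addsmxSr.
  rewrite mul_col_mx !col_mx_sub => /andP[/andP[vT XT] /andP[vJT XJT]].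
  by rewrite !addsmx_sub addsmxSl !col_mx_sub vT XT vJT XJT.
- by rewrite rB rA1; lia.
Qed.

(** Induction on a space V stable under J and y. If y is bijective on V, take c = y. Otherwise c is
    already known on V1 = V y; it is extended by fixing a K[J]-basis X1 of the kernel of y modulo
    V1, and by sending a basis X2 of the remaining complement to suitable preimages under y. *)
Lemma semilin_commute (y : 'M_n) : y *m J = - (J *m y) ->
  exists c : 'M_n, [/\ c \in unitmx, c *m J = - (J *m c) & c *m y = y *m c].
Proof.
move=> yJ.
have Jy : J *m y = - (y *m J) by rewrite yJ opprK.
suff key N (V : 'M_n) : (\rank V <= N)%N -> (V *m J <= V)%MS -> (V *m y <= V)%MS ->
    exists c : 'M_n, [/\ (V *m c <= V)%MS, \rank (V *m c) = \rank V,
      V *m J *m c = - (V *m c *m J) & V *m y *m c = V *m c *m y].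
  have [||c [_ rc cJ cy]] := key n 1%:M (rank_leq_row _); rewrite ?submx1 //.
  rewrite !mul1mx mxrank1 in rc cJ cy; exists c; split => //.
    by rewrite -row_free_unit -row_leq_rank rc.
  by rewrite cJ opprK.
elim: N V => [|N IH] V rV VJ Vy.
  move: rV; rewrite leqn0 mxrank_eq0 => /eqP->.
  by exists 0; rewrite !mulmx0 !mul0mx oppr0.
set V1 := V *m y.
have [rV1|ltV1] := eqVneq (\rank V1) (\rank V).
  by exists y; split=> //; rewrite -!mulmxA yJ mulmxN opprK.
have {ltV1} ltV1 : (\rank V1 < \rank V)%N by rewrite ltn_neqAle ltV1 mxrankS.
have V1J : (V1 *m J <= V1)%MS.
  by rewrite /V1 -mulmxA yJ mulmxN eqmx_opp mulmxA submxMr.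
have V1y : (V1 *m y <= V1)%MS by rewrite submxMr.
have V1V : (V1 <= V)%MS by [].
have [|c0 [V1c rV1c c0J c0y]] := IH V1 _ V1J V1y.
  by rewrite -ltnS (leq_trans ltV1).
set K1 := (V :&: kermx y)%MS.
have K1y m (A : 'M_(m, n)) : (A <= K1)%MS = (A <= V)%MS && (A *m y == 0).
  by rewrite sub_capmx; congr andb; apply/sub_kermxP/eqP.
have K1J : (K1 *m J <= K1)%MS.
  rewrite K1y (submx_trans _ VJ) ?submxMr ?capmxSl //=.
  rewrite -mulmxA Jy mulmxN mulmxA.
  have : (K1 <= K1)%MS by []. rewrite {1}K1y => /andP[_ /eqP->].
  by rewrite mul0mx oppr0.
have capJ : ((V1 :&: K1)%MS *m J <= (V1 :&: K1)%MS)%MS.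
  rewrite sub_capmx (submx_trans _ V1J) ?submxMr ?capmxSl //=.
  by rewrite (submx_trans _ K1J) ?submxMr ?capmxSr.
have addJ : ((V1 + K1)%MS *m J <= (V1 + K1)%MS)%MS.
  by rewrite addsmxMr addsmxS.
have addV : (V1 + K1 <= V)%MS by rewrite addsmx_sub V1V capmxSl.
have [r1 [X1 [X1K K1X rK1]]] := lbasis_ext capJ K1J (capmxSr _ _).
have [r2 [X2 [X2V VX rV2]]] := lbasis_ext addJ VJ addV.
have rsum : \rank (V1 + K1)%MS = (\rank V1 + (r1 + r1))%N.
  apply: (@addIn (\rank (V1 :&: K1)%MS)).
  by rewrite mxrank_sum_cap rK1 addnAC addnA.
have c0J' m (A : 'M_(m, n)) : (A <= V1)%MS -> A *m J *m c0 = - (A *m c0 *m J).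
  by case/submxP=> Q ->; rewrite -!(mulmxA Q) c0J mulmxN.
have c0y' m (A : 'M_(m, n)) : (A <= V1)%MS -> A *m y *m c0 = A *m c0 *m y.
  by case/submxP=> Q ->; rewrite -!(mulmxA Q) c0y.
have c0V m (A : 'M_(m, n)) : (A <= V1)%MS -> (A *m c0 <= V1)%MS.
  by move=> AV; apply: submx_trans V1c; exact: submxMr.
have c0I m (A : 'M_(m, n)) : (A <= V1)%MS -> A *m c0 = 0 -> A = 0.
  move=> AV /sub_kermxP Ac; apply/eqP; rewrite -submx0.
  have /mxrank_injP/eqP <- := rV1c; by rewrite sub_capmx AV.
have X2yV1 : (X2 *m y <= V1)%MS by exact: submxMr.
(* Commutation with y imposes Z2 y = X2 y c0, which is solvable because c0 maps V1 into V1 = V y. *)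
have [Z2 Z2V Z2y] : exists2 Z : 'M_(r2, n), (Z <= V)%MS & Z *m y = X2 *m y *m c0.
  have /submxP[Q ->] := c0V _ _ X2yV1.
  by exists (Q *m V); rewrite ?submxMl // mulmxA.
pose B1 := row_base V1; have B1V1 : (B1 <= V1)%MS by rewrite eq_row_base.
pose M := col_mx B1 (col_mx (col_mx X1 (X1 *m J)) (col_mx X2 (X2 *m J))).
pose N' := col_mx (B1 *m c0) (col_mx (col_mx X1 (- (X1 *m J))) (col_mx Z2 (- (Z2 *m J)))).
have VM : (V <= M)%MS.
  apply: submx_trans VX _; rewrite addsmx_sub.
  have : (col_mx B1 (col_mx (col_mx X1 (X1 *m J)) (col_mx X2 (X2 *m J))) <= M)%MS.
    exact: submx_refl.
  rewrite !col_mx_sub => /and3P[B1M /andP[X1M X1JM] /andP[X2M X2JM]].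
  rewrite X2M X2JM !andbT addsmx_sub.
  have V1M : (V1 <= M)%MS by rewrite -(eq_row_base V1).
  rewrite V1M /=; apply: submx_trans K1X _; rewrite addsmx_sub.
  by rewrite (submx_trans (capmxSl _ _) V1M) !col_mx_sub X1M.
have freeM : row_free M.
  rewrite -row_leq_rank; apply: leq_trans (mxrankS VM).
  by rewrite rV2 rsum addnA.
have [c Mc] : exists c, M *m c = N'.
  by exists (pinvmx M *m N'); rewrite mulmxA mulmxVp // mul1mx.
have [B1c X1c X1Jc X2c X2Jc] : [/\ B1 *m c = B1 *m c0, X1 *m c = X1,
    X1 *m J *m c = - (X1 *m J), X2 *m c = Z2 & X2 *m J *m c = - (Z2 *m J)].
  by move: Mc; rewrite !mul_col_mx => /eq_col_mx[? /eq_col_mx[/eq_col_mx[? ?] /eq_col_mx[? ?]]].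
have cV1 m (A : 'M_(m, n)) : (A <= V1)%MS -> A *m c = A *m c0.
  by rewrite -(eq_row_base V1) => /submxP[Q ->]; rewrite -!(mulmxA Q) -/B1 B1c.
have X1y : X1 *m y = 0 by move: X1K; rewrite K1y => /andP[_ /eqP].
have JJr m (A : 'M_(m, n)) : A *m J *m J = D *: A.
  by rewrite -mulmxA JJ mul_mx_scalar.
have yJr m (A : 'M_(m, n)) : A *m y *m J = - (A *m J *m y).
  by rewrite -mulmxA yJ mulmxN mulmxA.
have genM p (f g : 'M_(n, p)) : M *m f = M *m g -> V *m f = V *m g.
  by move/submxP: VM => [Q ->] e; rewrite -!mulmxA e.
have VcJ : V *m J *m c = - (V *m c *m J).
  rewrite -!mulmxA -mulmxN; apply: genM; rewrite mulmxN !mulmxA Mc !mul_col_mx.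
  rewrite !opp_col_mx; congr col_mx; last congr col_mx; try congr col_mx.
  - by rewrite cV1 ?c0J' // (submx_trans _ V1J) // submxMr.
  - by [].
  - by rewrite JJr -scalemxAl X1c mulNmx JJr opprK.
  - by [].
  - by rewrite JJr -scalemxAl X2c mulNmx JJr opprK.
have Vcy : V *m y *m c = V *m c *m y.
  rewrite -!mulmxA; apply: genM; rewrite !mulmxA Mc !mul_col_mx.
  congr col_mx; last congr col_mx; try congr col_mx.
  - by rewrite cV1 ?c0y' // (submx_trans _ V1y) // submxMr.
  - by rewrite X1y mul0mx.
  - by rewrite mulNmx -[X1 *m J *m y]opprK -yJr X1y !mul0mx oppr0 mul0mx oppr0.
  - by rewrite cV1 // Z2y.
  - rewrite mulNmx -[X2 *m J *m y]opprK -yJr mulNmx cV1; last first.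
      by apply: submx_trans V1J; exact: submxMr.
    by rewrite c0J' // opprK -Z2y yJr.
have Vc : (V *m c <= V)%MS.
  have : (N' <= V)%MS.
    rewrite /N' !col_mx_sub !eqmx_opp Z2V (submx_trans _ V1V) ?c0V //=.
    rewrite (submx_trans X1K) ?capmxSl //= !(submx_trans _ VJ) ?submxMr //.
    by rewrite (submx_trans X1K) ?capmxSl.
  by case/submxP: VM => Q VE; rewrite [X in X *m c]VE -(mulmxA Q) Mc; apply: submx_trans; exact: submxMl.
exists c; split=> //.
pose B := row_base (V1 :&: K1)%MS.
have freeK : row_free (col_mx B (col_mx X1 (X1 *m J))).
  rewrite -row_leq_rank -[X in (X <= _)%N]rK1; apply: mxrankS; apply: submx_trans K1X _.
  rewrite addsmx_sub -(eq_row_base (V1 :&: K1)%MS).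
  have := submx_refl (col_mx B (col_mx X1 (X1 *m J))).
  by rewrite {1}col_mx_sub.
(* Injectivity: u c = 0 gives (u y) c0 = 0, so u lies in the kernel of y. There c is c0 on the
   intersection with V1, and 1 on X1, -1 on X1 J. *)
apply/mxrank_injP/rowV0P => u; rewrite sub_capmx => /andP[uV /sub_kermxP uc].
have uy0 : u *m y = 0.
  apply: c0I; first exact: submxMr.
  rewrite -cV1 ?submxMr //; case/submxP: uV uc => Q -> uc.
  by rewrite -!mulmxA (mulmxA V) Vcy !mulmxA uc mul0mx.
have uK : (u <= K1)%MS by rewrite K1y uV uy0 eqxx.
case/sub_addsmxP: (submx_trans uK K1X) => -[u1 u2] /= uE.
rewrite -[u2]hsubmxK mul_row_col in uE.
set s1 := lsubmx u2 in uE; set s2 := rsubmx u2 in uE.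
have capK : (u1 *m (V1 :&: K1)%MS <= V1 :&: K1)%MS by exact: submxMl.
have capV : (u1 *m (V1 :&: K1)%MS <= V1)%MS by apply: submx_trans capK (capmxSl _ _).
have capy : u1 *m (V1 :&: K1)%MS *m y = 0.
  by move: (submx_trans capK (capmxSr _ _)); rewrite K1y => /andP[_ /eqP].
have : (u1 *m (V1 :&: K1)%MS *m c0 <= B)%MS.
  rewrite eq_row_base sub_capmx c0V //= K1y -c0y' // capy mul0mx eqxx.
  by rewrite (submx_trans (c0V _ _ capV)).
case/submxP=> Q QE.
have : row_mx Q (row_mx s1 (- s2)) *m col_mx B (col_mx X1 (X1 *m J)) = 0.
  rewrite !mul_row_col -QE -cV1 //.
  move: uc; rewrite uE !mulmxDl -!mulmxA X1c (mulmxA X1) X1Jc.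
  by rewrite mulmxN mulNmx !mulmxA.
rewrite -[RHS](mul0mx _ (col_mx B (col_mx X1 (X1 *m J)))) => /(row_free_inj freeK).
rewrite -row_mx0 -row_mx0 => /eq_row_mx[Q0 /eq_row_mx[s10 s20]].
move/eqP: s20; rewrite oppr_eq0 => /eqP s20.
by rewrite uE s10 s20 !mul0mx !addr0 (c0I _ _ capV) // QE Q0 mul0mx.
Qed.

End Semilinear.

(** * Multiplicity one for the centralizer of a square root of a nonsquare *)

(** The powers of x are eventually periodic, and any large multiple of the period is a suitable
    exponent. The idempotent obtained is the Fitting projector onto the part where x is
    invertible. *)
Lemma idempotent_power (k : finFieldType) n (x : 'M[k]_n) :
  exists2 M, (0 < M)%N & x ^+ M *m x ^+ M = x ^+ M.
Proof.
pose f (i : 'I_#|{: 'M[k]_n}|.+1) := x ^+ i.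
have /injectivePn[i [j ij fij]] : ~~ injectiveb f.
  by apply/negP => /injectiveP/leq_card; rewrite card_ord ltnn.
wlog lt_ij : i j ij fij / (i < j)%N.
  move=> h; case: (ltngtP i j) => [|lt|/val_inj e]; first exact: h.
    by apply: (h j i) => //; rewrite eq_sym.
  by rewrite e eqxx in ij.
set t := (j - i)%N; have t0 : (0 < t)%N by rewrite subn_gt0.
have step w : (i <= w)%N -> x ^+ (w + t) = x ^+ w.
  move=> iw; rewrite -(subnK iw) -addnA exprD [RHS]exprD subnKC ?(ltnW lt_ij) //.
  by congr (_ * _); exact/esym.
have per u v : (i <= u)%N -> x ^+ (u + t * v) = x ^+ u.
  move=> iu; elim: v => [|v IH]; first by rewrite muln0 addn0.
  by rewrite mulnSr addnA step ?IH // (leq_trans iu) ?leq_addr.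
exists (t * i.+1)%N; first by rewrite muln_gt0 t0.
by rewrite mulmxE -exprD per // (leq_trans (leqnSn i)) // leq_pmull.
Qed.

Lemma sum_inj_on (T : finType) (V : nmodType) (P : pred T) (h : T -> T) (F : T -> V) :
  {in P &, injective h} -> {in P, forall x, h x \in P} ->
  \sum_(x | P x) F (h x) = \sum_(x | P x) F x.
Proof.
move=> hI hP; pose S := [set x | P x].
have SI : {in S &, injective h} by move=> x y; rewrite !inE; exact: hI.
have hS : h @: S = S.
  apply/eqP; rewrite eqEcard card_in_imset // leqnn andbT.
  by apply/subsetP => _ /imsetP[x xS ->]; move: xS; rewrite !inE; exact: hP.
have := big_imset F SI; rewrite hS => e.
transitivity (\sum_(x in S) F (h x)); first by apply: eq_bigl => x; rewrite inE.
by rewrite -e; apply: eq_bigl => x; rewrite inE.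
Qed.

Section Gelfand.
Variables (C : numClosedFieldType) (k : finFieldType) (n d : nat).
Variable rho : mx_representation C [set: GL n k] d.
Hypotheses (irr : mx_irreducible rho) (cusp : cuspidal rho).
Local Notation R := (repm rho).
Variables (J s : 'M[k]_n) (D : k).
Hypotheses (two0 : 2%:R != 0 :> k) (JJ : J *m J = D%:M).
Hypothesis Dns : forall x : k, x * x != D.
Hypotheses (ss : s *m s = 1%:M) (sJ : s *m J = - (J *m s)).
Variables (nu : 'M[k]_n -> C) (kap : k -> C).
Definition centJ (A : 'M[k]_n) := (A \in unitmx) && (A *m J == J *m A).
Hypothesis nu_neq0 : forall A, centJ A -> nu A != 0.
Hypothesis nuM : forall A B, centJ A -> centJ B -> nu (A *m B) = nu A * nu B.
Hypothesis kap_neq0 : forall x, x != 0 -> kap x != 0.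
Hypothesis kapM : forall x y, x != 0 -> y != 0 -> kap (x * y) = kap x * kap y.
(** With nu in the role of mu of the determinant over E, and kap of mu on F^*, this hypothesis says
    that the determinant over F is the norm of the one over E. The next two say that det(1 - y^2)
    over E is det(1 + y) over F for antilinear y, and that det s = (-1)^m. *)
Hypothesis nu_kap : forall A, centJ A -> nu A * nu (s *m A *m s) = kap (\det A).
Hypothesis nu_sq : forall y, y *m J = - (J *m y) -> 1%:M + y \in unitmx ->
  nu (1%:M - y *m y) = kap (\det (1%:M + y)).
Hypothesis nuN1 : nu (- 1%:M) = kap (\det s).

Lemma centJP A : reflect (A \in unitmx /\ A *m J = J *m A) (centJ A).
Proof. by apply: (iffP andP) => -[? /eqP]. Qed.

Lemma D_neq0 : D != 0. Proof. by rewrite eq_sym -(mulr0 0) Dns. Qed.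

Lemma J_unit : J \in unitmx.
Proof.
have : J *m (D^-1 *: J) = 1%:M.
  by rewrite -scalemxAr JJ scale_scalar_mx mulVf ?D_neq0.
by case/mulmx1_unit.
Qed.

Lemma s_unit : s \in unitmx. Proof. by case/mulmx1_unit: ss. Qed.

Lemma centJM A B : centJ A -> centJ B -> centJ (A *m B).
Proof.
case/centJP=> uA AJ /centJP[uB BJ]; apply/centJP; rewrite unitmx_mul uA uB.
by rewrite -mulmxA BJ !mulmxA AJ.
Qed.

Lemma centJV A : centJ A -> centJ (invmx A).
Proof.
case/centJP=> uA AJ; apply/centJP; rewrite unitmx_inv; split=> //.
by apply: (can_inj (mulKmx uA)); rewrite mulmxA mulmxV // mul1mx mulmxA AJ mulmxK.
Qed.

Lemma centJ_anti A B : A \in unitmx -> B \in unitmx ->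
  A *m J = - (J *m A) -> B *m J = - (J *m B) -> centJ (A *m B).
Proof.
move=> uA uB AJ BJ; apply/centJP; rewrite unitmx_mul uA uB; split=> //.
by rewrite -mulmxA BJ mulmxN mulmxA AJ mulNmx opprK mulmxA.
Qed.

Lemma anti_inv A : A \in unitmx -> A *m J = - (J *m A) ->
  invmx A *m J = - (J *m invmx A).
Proof.
move=> uA AJ; apply: (can_inj (mulKmx uA)).
by rewrite mulmxN !mulmxA mulmxV // mul1mx AJ mulNmx opprK mulmxK.
Qed.

Lemma centJ_s A : centJ A -> centJ (s *m A *m s).
Proof.
case/centJP=> uA AJ; rewrite -mulmxA; apply: centJ_anti => //.
- exact: s_unit.
- by rewrite unitmx_mul uA s_unit.
by rewrite -mulmxA sJ mulmxN !mulmxA AJ.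
Qed.

Lemma centJ1 : centJ 1%:M.
Proof. by apply/centJP; rewrite unitmx1 mul1mx mulmx1. Qed.

Lemma centJ_J : centJ J. Proof. by apply/centJP; rewrite J_unit. Qed.

Lemma centJN A : centJ A -> centJ (- A).
Proof.
case/centJP=> uA AJ; apply/centJP; rewrite -scaleN1r unitmxZ ?unitrN1 //.
by rewrite -scalemxAl -scalemxAr AJ.
Qed.

Lemma nu1 : nu 1%:M = 1.
Proof.
apply: (mulfI (nu_neq0 centJ1)).
by rewrite -nuM ?centJ1 // mulmx1 mulr1.
Qed.

Lemma kap1 : kap 1 = 1.
Proof.
by apply: (mulfI (kap_neq0 (oner_neq0 k))); rewrite -kapM ?oner_neq0 // !mulr1.
Qed.

Lemma nuV A : centJ A -> nu (invmx A) = (nu A)^-1.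
Proof.
move=> HA; apply: (mulfI (nu_neq0 HA)); rewrite -nuM ?centJV //.
by case/centJP: HA (HA) => uA _ HA; rewrite mulmxV // nu1 mulfV ?nu_neq0.
Qed.

Lemma det0 (A : 'M[k]_n) : A \in unitmx -> \det A != 0.
Proof. by rewrite unitmxE unitfE. Qed.

Lemma kapV x : x != 0 -> kap x^-1 = (kap x)^-1.
Proof.
move=> x0; apply: (mulfI (kap_neq0 x0)).
by rewrite -kapM ?invr_eq0 // !mulfV ?kap1 ?kap_neq0.
Qed.

Definition proj := \sum_(A | centJ A) (nu A)^-1 *: R A.
Local Notation E := proj.

Lemma centJ_unit A : centJ A -> A \in unitmx. Proof. by case/andP. Qed.

Lemma proj_l A : centJ A -> R A *m E = nu A *: E.
Proof.
move=> HA; have uA := centJ_unit HA.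
rewrite [in RHS]/E (reindex_inj (can_inj (mulKmx uA))) /=.
rewrite mulmx_sumr scaler_sumr; apply: eq_big => [B|B HB].
  apply/idP/idP => [|h]; first exact: centJM.
  by rewrite -(mulKmx uA B) centJM ?centJV.
rewrite -scalemxAr -repmM ?centJ_unit // scalerA nuM // invfM mulrA.
by rewrite mulfV ?nu_neq0 // mul1r.
Qed.

Lemma proj_r A : centJ A -> E *m R A = nu A *: E.
Proof.
move=> HA; have uA := centJ_unit HA.
rewrite [in RHS]/E (reindex_inj (can_inj (mulmxK uA))) /=.
rewrite mulmx_suml scaler_sumr; apply: eq_big => [B|B HB].
  apply/idP/idP => [h|h]; first exact: centJM.
  by rewrite -(mulmxK uA B) centJM ?centJV.
rewrite -scalemxAl -repmM ?centJ_unit // scalerA nuM // invfM.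
by rewrite mulrCA mulfV ?nu_neq0 // mulr1.
Qed.

Definition Nc : C := #|[pred A | centJ A]|%:R.

Lemma Nc_neq0 : Nc != 0.
Proof. by rewrite pnatr_eq0 -lt0n; apply/card_gt0P; exists 1%:M; exact: centJ1. Qed.

Lemma fun_proj (lam : 'rV_d) : (forall A, centJ A -> lam *m R A = nu A *: lam) ->
  lam *m E = Nc *: lam.
Proof.
move=> h; rewrite mulmx_sumr (eq_bigr (fun=> lam)) => [|A HA].
  by rewrite sumr_const scaler_nat.
by rewrite -scalemxAr h // scalerA mulVf ?nu_neq0 // scale1r.
Qed.

Lemma projE : E *m E = Nc *: E.
Proof.
rewrite {2}/E mulmx_sumr (eq_bigr (fun=> E)) => [|A HA].
  by rewrite sumr_const scaler_nat.
by rewrite -scalemxAr proj_r // scalerA mulVf ?nu_neq0 // scale1r.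
Qed.

Definition phi g := E *m R g *m E.

Lemma phi_l A g : centJ A -> g \in unitmx -> phi (A *m g) = nu A *: phi g.
Proof.
move=> HA ug; rewrite /phi repmM // ?centJ_unit // mulmxA proj_r //.
by rewrite -!scalemxAl.
Qed.

Lemma phi_r A g : centJ A -> g \in unitmx -> phi (g *m A) = nu A *: phi g.
Proof.
move=> HA ug; rewrite /phi repmM // ?centJ_unit // -!mulmxA proj_l //.
by rewrite -!scalemxAr.
Qed.

Definition tau (g : 'M[k]_n) := s *m invmx g *m s.

Lemma tau_unit g : g \in unitmx -> tau g \in unitmx.
Proof. by move=> ug; rewrite !unitmx_mul s_unit unitmx_inv ug. Qed.

Lemma tauK g : g \in unitmx -> tau (tau g) = g.
Proof.
move=> ug; have e : tau g *m (s *m g *m s) = 1%:M.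
  by rewrite /tau !mulmxA -(mulmxA _ s s) ss mulmx1 mulmxKV // ss.
have e' : invmx (tau g) = s *m g *m s.
  by rewrite -[LHS]mulmx1 -e mulKmx ?tau_unit.
rewrite [LHS]/tau e'.
by rewrite !mulmxA ss mul1mx -mulmxA ss mulmx1.
Qed.

(** As J^-1 = D^-1 J, these are the half sum and half difference of g and J g J^-1: the parts of g
    commuting and anticommuting with J. *)
Definition linp g : 'M[k]_n := 2%:R^-1 *: (g + D^-1 *: (J *m g *m J)).
Definition semip g : 'M[k]_n := 2%:R^-1 *: (g - D^-1 *: (J *m g *m J)).

Lemma lin_semi g : linp g + semip g = g.
Proof.
rewrite -scalerDr addrACA subrr addr0 -mulr2n -scaler_nat scalerA mulVf //.
by rewrite scale1r.
Qed.

Lemma J_JgJ g : J *m (D^-1 *: (J *m g *m J)) = g *m J.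
Proof.
by rewrite -scalemxAr !mulmxA JJ !mul_scalar_mx -scalemxAl scalerA mulVf ?D_neq0 // scale1r.
Qed.

Lemma JgJ_J g : D^-1 *: (J *m g *m J) *m J = J *m g.
Proof.
by rewrite -scalemxAl -(mulmxA (J *m g)) JJ mul_mx_scalar scalerA mulVf ?D_neq0 // scale1r.
Qed.

Lemma linpJ g : linp g *m J = J *m linp g.
Proof.
by rewrite -scalemxAl -scalemxAr mulmxDl mulmxDr JgJ_J J_JgJ addrC.
Qed.

Lemma semipJ g : semip g *m J = - (J *m semip g).
Proof.
rewrite /semip -scalemxAl -scalemxAr -[in RHS]scalerN mulmxBl mulmxBr JgJ_J J_JgJ opprB.
by [].
Qed.

Lemma J_lin g : (2%:R *: (J *m linp g)) = J *m g + g *m J.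
Proof.
by rewrite -scalemxAr scalerA mulfV // scale1r mulmxDr J_JgJ.
Qed.

Lemma J_semi g : (2%:R *: (J *m semip g)) = J *m g - g *m J.
Proof.
by rewrite -scalemxAr scalerA mulfV // scale1r mulmxBr J_JgJ.
Qed.

(* Unipotent elements of the centralizer of J are commutators there:
   1 + p conjugates 1 + f to (1 + f)^2. *)
Lemma nu_rad p f : p *m p = p -> p *m J = J *m p -> radp p f ->
  f *m J = J *m f -> nu (1%:M + f) = 1.
Proof.
move=> pp pJ pf fJ; have ff := radp_mul pf pf; case/radpP: pf => pf fp.
have Hf : centJ (1%:M + f).
  by apply/centJP; rewrite unitmx_1D // mulmxDl mulmxDr fJ mul1mx mulmx1.
have up : 1%:M + p \in unitmx.
  have : (1%:M + p) *m (1%:M - 2%:R^-1 *: p) = 1%:M.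
    have pE : p = 2%:R^-1 *: p + 2%:R^-1 *: p.
      by rewrite -scalerDl -mulr2n -(mulr_natl 2%:R^-1) mulfV // scale1r.
    by rewrite mulmxDl mul1mx mulmxBr mulmx1 -scalemxAr pp {2}pE addrK subrK.
  by case/mulmx1_unit.
have Hp : centJ (1%:M + p).
  by apply/centJP; rewrite up mulmxDl mulmxDr pJ mul1mx mulmx1.
have e : (1%:M + p) *m (1%:M + f) = (1%:M + f) *m (1%:M + f) *m (1%:M + p).
  rewrite !(mulmxDl, mulmxDr) !mul1mx !mulmx1 ff mul0mx pf fp !addr0.
  by rewrite -!addrA; congr (_ + _); rewrite addrC -!addrA (addrC p).
have /(congr1 nu) := e; rewrite !nuM ?centJM // mulrC => /(mulIf (nu_neq0 Hp)).
by rewrite -[LHS]mulr1 => /(mulfI (nu_neq0 Hf)).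
Qed.

(** Write g = (1 + y) b with b the antilinear part. Since (1 + y)^-1 = (1 - y)(1 - y^2)^-1, and J
    conjugates 1 + y into 1 - y, tau g equals h1 g h2 with h1 and h2 commuting with J, b^-1 s being
    one of the linear factors. What remains is nu h1 * nu h2 = kap(det g)^-1. *)
Lemma phi_semi_unit g : g \in unitmx -> semip g \in unitmx ->
  phi g = kap (\det g) *: phi (tau g).
Proof.
move=> ug ub; set a := linp g; set b := semip g.
have aJ : a *m J = J *m a := linpJ g.
have bJ : b *m J = - (J *m b) := semipJ g.
have b'J := anti_inv ub bJ.
have ub' : invmx b \in unitmx by rewrite unitmx_inv.
pose y := a *m invmx b.
have yJ : y *m J = - (J *m y) by rewrite /y -mulmxA b'J mulmxN !mulmxA aJ.
have gE : g = (1%:M + y) *m b.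
  by rewrite mulmxDl mul1mx mulmxKV // addrC lin_semi.
have u1y : 1%:M + y \in unitmx by move: ug; rewrite gE unitmx_mul => /andP[].
have J1y : J *m (1%:M + y) *m invmx J = 1%:M - y.
  rewrite mulmxDr mulmx1 mulmxDl mulmxV ?J_unit //.
  by rewrite -[J *m y]opprK -yJ mulNmx mulmxK ?J_unit.
have u1y' : 1%:M - y \in unitmx by rewrite -J1y !unitmx_mul u1y unitmx_inv J_unit.
have gb : g *m invmx b = 1%:M + y by rewrite gE mulmxK.
clearbody y; pose w := 1%:M - y *m y.
have wE : w = (1%:M + y) *m (1%:M - y).
  by rewrite mulmxDl mul1mx mulmxBr mulmx1 addrA subrK.
have wE' : w = (1%:M - y) *m (1%:M + y).
  by rewrite mulmxBl mul1mx mulmxDr mulmx1 opprD addrA addrK.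
have uw : w \in unitmx by rewrite wE unitmx_mul u1y.
have Hw : centJ w.
  apply/centJP; split=> //; rewrite mulmxBl mulmxBr mul1mx mulmx1; congr (_ - _).
  by rewrite -mulmxA yJ mulmxN !mulmxA yJ mulNmx opprK.
have nuw : nu w = kap (\det (1%:M + y)) by exact: nu_sq.
have detw : \det w = \det (1%:M + y) * \det (1%:M + y).
  rewrite wE det_mulmx -J1y !det_mulmx det_inv mulrAC mulfV ?mul1r //.
  exact: det0 J_unit.
clearbody w.
have V1y : invmx (1%:M + y) = J *m g *m invmx b *m invmx J *m invmx w.
  apply: (can_inj (mulKmx u1y)); rewrite mulmxV // -(mulmxA J) gb J1y.
  by rewrite mulmxA -wE mulmxV.
have gV : invmx g = invmx b *m J *m g *m invmx b *m invmx J *m invmx w.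
  apply: (can_inj (mulKmx ug)); rewrite mulmxV // !mulmxA gb.
  by move: (mulmxV u1y); rewrite V1y !mulmxA.
pose x := invmx b *m s.
have Hx : centJ x by apply: centJ_anti => //; exact: s_unit.
have HJV := centJV centJ_J; have HwV := centJV Hw.
have bJV : invmx b *m invmx J = - (invmx J *m invmx b).
  apply: (can_inj (mulKmx J_unit)); apply: (can_inj (mulmxK J_unit)).
  by rewrite mulmxN mulKVmx ?J_unit // mulNmx b'J opprK mulmxA mulmxKV ?J_unit.
have h1E : s *m invmx b *m J = s *m x *m s *m J.
  by rewrite /x !mulmxA -(mulmxA _ s s) ss mulmx1.
have h2E : invmx b *m invmx J *m invmx w *m s =
    - 1%:M *m invmx J *m x *m (s *m invmx w *m s).
  by rewrite /x bJV mulNmx !mulmxA -(mulmxA _ s s) ss mulmx1 !mulNmx mul1mx.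
have HN1 : centJ (- 1%:M) by apply/centJN/centJ1.
have -> : tau g = (s *m x *m s *m J) *m g *m
    (- 1%:M *m invmx J *m x *m (s *m invmx w *m s)).
  by rewrite -h1E -h2E /tau gV !mulmxA.
have HJ := centJ_J; have Hsx := centJ_s Hx; have Hsw := centJ_s HwV.
have H1 := centJM Hsx HJ; have H2 := centJM (centJM (centJM HN1 HJV) Hx) Hsw.
have uH1g : s *m x *m s *m J *m g \in unitmx.
  by rewrite unitmx_mul (centJ_unit H1).
rewrite phi_r // phi_l //.
rewrite !scalerA [X in X *: _](_ : _ = 1) ?scale1r //.
have H3 := centJM HN1 HJV; have H4 := centJM H3 Hx.
rewrite (nuM Hsx HJ) (nuM H4 Hsw) (nuM H3 Hx) (nuM HN1 HJV) nuV //.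
have sw : nu (s *m invmx w *m s) = (kap (\det (1%:M + y)))^-1.
  have := nu_kap HwV; rewrite nuV // nuw det_inv kapV ?det0 //.
  rewrite detw kapM ?det0 // invfM => /mulfI -> //.
  by rewrite invr_eq0 kap_neq0 ?det0.
have nx : nu (s *m x *m s) * nu x = (kap (\det b))^-1 * kap (\det s).
  by rewrite mulrC nu_kap // det_mulmx det_inv kapM ?kapV ?invr_eq0 ?det0 ?s_unit.
have detg : kap (\det g) = kap (\det (1%:M + y)) * kap (\det b).
  by rewrite gE det_mulmx kapM ?det0.
have ks : kap (\det s) * kap (\det s) = 1.
  by rewrite -kapM ?det0 ?s_unit // -det_mulmx ss det1 kap1.
have k1 := kap_neq0 (det0 u1y); have k2 := kap_neq0 (det0 ub).
have k3 := nu_neq0 centJ_J; rewrite sw detg nuN1.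
move: (kap (\det (1%:M + y))) (kap (\det b)) (nu J) (nu (s *m x *m s)) (nu x)
  (kap (\det s)) nx ks k1 k2 k3 => a1 a2 a3 a4 a5 a6 nx ks k1 k2 k3.
transitivity ((a4 * a5) * a2 * a6); first by field; rewrite k1.
by rewrite nx; transitivity (a6 * a6) => //; field.
Qed.

(** Now g = (1 + y) a with a linear, and the antilinear s has to be absorbed. [semilin_commute]
    provides an antilinear c commuting with y; then s = q c with q linear, c disappears in the
    conjugation, and only q, J and 1 - y^2 are left. *)
Lemma phi_lin_unit g : g \in unitmx -> linp g \in unitmx ->
  phi g = kap (\det g) *: phi (tau g).
Proof.
move=> ug ua; set a := linp g; set b := semip g.
have aJ : a *m J = J *m a := linpJ g.
have bJ : b *m J = - (J *m b) := semipJ g.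
have Ha : centJ a by apply/centJP.
have ua' : invmx a \in unitmx by rewrite unitmx_inv.
pose y := b *m invmx a.
have yJ : y *m J = - (J *m y).
  by rewrite /y -mulmxA; case/centJP: (centJV Ha) => _ ->; rewrite !mulmxA bJ mulNmx.
have gE : g = (1%:M + y) *m a by rewrite mulmxDl mul1mx mulmxKV // lin_semi.
have u1y : 1%:M + y \in unitmx by move: ug; rewrite gE unitmx_mul => /andP[].
clearbody y.
have J1y : J *m (1%:M + y) *m invmx J = 1%:M - y.
  rewrite mulmxDr mulmx1 mulmxDl mulmxV ?J_unit //.
  by rewrite -[J *m y]opprK -yJ mulNmx mulmxK ?J_unit.
have u1y' : 1%:M - y \in unitmx by rewrite -J1y !unitmx_mul u1y unitmx_inv J_unit.
have nuw := nu_sq yJ u1y.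
have [c [uc cJ cy]] := semilin_commute JJ Dns yJ.
have wE' : 1%:M - y *m y = (1%:M - y) *m (1%:M + y).
  by rewrite mulmxBl mul1mx mulmxDr mulmx1 opprD addrA addrK.
have Hw : centJ (1%:M - y *m y).
  apply/centJP; rewrite wE' unitmx_mul u1y u1y' -wE'; split=> //.
  rewrite mulmxBl mulmxBr mul1mx mulmx1; congr (_ - _).
  by rewrite -mulmxA yJ mulmxN !mulmxA yJ mulNmx opprK.
have cw : c *m (1%:M - y *m y) = (1%:M - y *m y) *m c.
  by rewrite mulmxBl mulmxBr mul1mx mulmx1 mulmxA cy -!mulmxA cy.
set w := 1%:M - y *m y in nuw wE' Hw cw *; clearbody w.
have uw := centJ_unit Hw.
have V1y : invmx (1%:M + y) = invmx w *m J *m (1%:M + y) *m invmx J.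
  apply: (can_inj (mulmxK u1y)); rewrite mulVmx // -!mulmxA (mulmxA J) (mulmxA (J *m _)) J1y.
  by rewrite -wE' mulVmx.
pose q := s *m invmx c.
have cVJ := anti_inv uc cJ.
have Hq : centJ q.
  by apply: centJ_anti => //; rewrite ?s_unit ?unitmx_inv.
have qc : q *m c = s by rewrite mulmxKV.
have sq : s = invmx c *m invmx q.
  have uq := centJ_unit Hq.
  apply: (can_inj (mulKmx s_unit)); rewrite ss -{1}qc !mulmxA mulmxK // mulmxV //.
clearbody q.
have cJV : invmx J *m invmx c = - (invmx c *m invmx J).
  apply: (can_inj (mulKmx J_unit)); apply: (can_inj (mulmxK J_unit)).
  by rewrite mulKVmx ?J_unit // cVJ mulmxN !mulmxA mulNmx mulmxKV ?J_unit.
have cwV : c *m invmx w = invmx w *m c.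
  by apply: (can_inj (mulKmx uw)); rewrite mulKVmx // mulmxA -cw mulmxK.
have c1y : c *m (1%:M + y) *m invmx c = 1%:M + y.
  by rewrite mulmxDr mulmx1 mulmxDl cy mulmxV // mulmxK.
have tau1 : tau (1%:M + y) = (q *m invmx w *m J) *m (1%:M + y) *m (invmx J *m invmx q).
  have mid : c *m invmx w *m J *m (1%:M + y) *m (invmx J *m invmx c) =
      invmx w *m J *m (1%:M + y) *m invmx J.
    rewrite cwV -(mulmxA _ c) cJ cJV !(mulmxN, mulNmx) opprK !mulmxA.
    congr (_ *m _); rewrite -!(mulmxA (invmx w)) -!(mulmxA J); congr (_ *m (_ *m _)).
    by rewrite ?mulmxA c1y.
  by rewrite /tau V1y -{1}qc sq !mulmxA -!(mulmxA q) -mid !mulmxA.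
have uqw := centJM (centJM Hq (centJV Hw)) centJ_J.
have uJq := centJM (centJV centJ_J) (centJV Hq).
have phi1 : phi (1%:M + y) = kap (\det (1%:M + y)) *: phi (tau (1%:M + y)).
  have uH1 : q *m invmx w *m J *m (1%:M + y) \in unitmx.
    by rewrite unitmx_mul (centJ_unit uqw).
  rewrite tau1 phi_r // phi_l //.
  rewrite !scalerA [X in X *: _](_ : _ = 1) ?scale1r //.
  have HJ := centJ_J; have HwV := centJV Hw; have HJV := centJV HJ; have HqV := centJV Hq.
  have H1 := centJM Hq HwV.
  rewrite (nuM H1 HJ) (nuM Hq HwV) (nuM HJV HqV) !nuV // nuw.
  have k1 := kap_neq0 (det0 u1y); have k3 := nu_neq0 centJ_J; have k4 := nu_neq0 Hq.
  by field; rewrite ?k1 ?k3 ?k4.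
have tauM : tau g = s *m invmx a *m s *m tau (1%:M + y).
  have gV : invmx g = invmx a *m invmx (1%:M + y).
    apply: (can_inj (mulKmx ug)); rewrite mulmxV // {1}gE -!mulmxA mulKVmx //.
    by rewrite mulmxV.
  by rewrite /tau gV !mulmxA -(mulmxA _ s s) ss mulmx1.
rewrite tauM phi_l ?centJ_s ?centJV ?tau_unit // {1}gE phi_r // phi1 !scalerA.
congr (_ *: _); rewrite gE det_mulmx kapM ?det0 //.
have := nu_kap (centJV Ha); rewrite nuV // det_inv kapV ?det0 // => e.
have ka := kap_neq0 (det0 ua); have na := nu_neq0 Ha.
have -> : nu (s *m invmx a *m s) = nu a / kap (\det a).
  by rewrite -e mulrA mulfV ?mul1r.
by field.
Qed.

Lemma nilp_unit (z : 'M[k]_n) M : z ^+ M = 0 -> 1%:M - z \in unitmx.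
Proof.
move=> zM; have := subrX1 z M; rewrite zM sub0r => e.
have : (1%:M - z) *m (\sum_(i < M) z ^+ i) = 1%:M.
  by apply: oppr_inj; rewrite -mulNmx opprB mulmxE -e.
by case/mulmx1_unit.
Qed.

(* Put J1 = g J g^-1, d = J - J1, and let p be the projector on the generalized
   kernel of d.  On the radical of p, x |-> d x + x d is bijective, d being
   nilpotent on one side and invertible on the other.  Moreover 1 + d x + x d is the
   product of 1 + (J x + x J), which commutes with J, and 1 - (J1 x + x J1), which
   commutes with J1; the two projectors of phi g = E R(g) E absorb these factors.
   So phi g is an average over the radical, which vanishes by cuspidality. *)
Lemma phi_zero g : g \in unitmx -> linp g \notin unitmx ->
  semip g \notin unitmx -> phi g = 0.
Proof.
move=> ug na nb; have ugV : invmx g \in unitmx by rewrite unitmx_inv.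
pose J1 := g *m J *m invmx g.
have J1J1 : J1 *m J1 = D%:M.
  rewrite /J1 !mulmxA mulmxKV // -(mulmxA g) JJ mul_mx_scalar -scalemxAl mulmxV //.
  by rewrite scale_scalar_mx mulr1.
have J1g : J1 *m g = g *m J by rewrite mulmxKV.
clearbody J1; pose d' := J - J1; pose e := J + J1.
have dg : d' *m g = 2%:R *: (J *m semip g) by rewrite J_semi mulmxBl J1g.
have eg : e *m g = 2%:R *: (J *m linp g) by rewrite J_lin mulmxDl J1g.
have dJ : d' *m J = - (J1 *m d') by rewrite mulmxBl mulmxBr JJ J1J1 opprB.
have dJ1 : d' *m J1 = - (J *m d') by rewrite mulmxBl mulmxBr JJ J1J1 opprB.
have unit_of x y : x *m g = 2%:R *: (J *m y) -> x \in unitmx -> y \in unitmx.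
  move=> xy ux; have : x *m g \in unitmx by rewrite unitmx_mul ux.
  by rewrite xy unitmxZ ?unitfE // unitmx_mul => /andP[].
have nd : d' \notin unitmx by apply: contra nb; exact: unit_of.
have ne : e \notin unitmx by apply: contra na; exact: unit_of.
(* This relation makes the projector below proper: if d were nilpotent, e^2 = 4 D - d^2 would be
   invertible and so would the linear part of g; if d were invertible, so would the antilinear
   part. *)
have eedd : e *m e = (2%:R * 2%:R * D)%:M - d' *m d'.
  rewrite /e /d' !(mulmxDl, mulmxDr, mulmxN, mulNmx) opprK JJ J1J1 !opprD !opprK.
  have -> : (2%:R * 2%:R * D)%:M = D%:M + D%:M + (D%:M + D%:M) :> 'M[k]_n.
    by rewrite -!raddfD; congr (_%:M); ring.
  move: (J *m J1) (J1 *m J) (D%:M) => a b D'.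
  by apply/matrixP => i j; rewrite !mxE; ring.
clearbody e.
have d'E : d' = J - J1 by [].
clearbody d'.
have ddJ : d' *m d' *m J = J *m (d' *m d').
  by rewrite -mulmxA dJ mulmxN !mulmxA dJ1 mulNmx opprK.
have ddJ1 : d' *m d' *m J1 = J1 *m (d' *m d').
  by rewrite -mulmxA dJ1 mulmxN !mulmxA dJ mulNmx opprK.
(* d only intertwines J and -J1, whereas d^2 commutes with both; hence the projector is built from
   d^2. *)
have [M M0] := idempotent_power (d' *m d'); set q := (d' *m d') ^+ M => qq.
have commX x : d' *m d' *m x = x *m (d' *m d') -> q *m x = x *m q.
  by move=> h; apply/esym; exact: commrX (esym h).
have qJ := commX _ ddJ; have qJ1 := commX _ ddJ1.
have qd : q *m d' = d' *m q by apply: commX; rewrite mulmxA.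
have q1 : q != 1%:M.
  apply: contra nd => /eqP q1.
  have : d' *m (d' *m (d' *m d') ^+ M.-1) = 1%:M.
    by rewrite mulmxA [_ *m _](_ : _ = q) // mulmxE -exprS prednK.
  by case/mulmx1_unit.
have q0 : q != 0.
  apply: contra ne => /eqP q0; suff : e *m e \in unitmx by rewrite unitmx_mul => /andP[].
  have c0 : 2%:R * 2%:R * D != 0 by rewrite !mulf_neq0 // D_neq0.
  have -> : e *m e = (2%:R * 2%:R * D) *: (1%:M - (2%:R * 2%:R * D)^-1 *: (d' *m d')).
    by rewrite eedd scalerBr scalerA mulfV // scale1r scale_scalar_mx mulr1.
  rewrite unitmxZ ?unitfE // (@nilp_unit _ M) //.
  have expZ c (x : 'M[k]_n) N : (c *: x) ^+ N = c ^+ N *: x ^+ N.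
    elim: N => [|N IH]; first by rewrite !expr0 scale1r.
    by rewrite !exprS IH -!mulmxE -scalemxAl -scalemxAr scalerA.
  by rewrite expZ -/q q0 scaler0.
clearbody q.
pose p := 1%:M - q.
have pp : p *m p = p.
  by rewrite mulmxBl mul1mx mulmxBr mulmx1 qq subrr subr0.
have p0 : p != 0 by rewrite subr_eq0 eq_sym.
have p1 : p != 1%:M by rewrite -subr_eq0 addrAC subrr sub0r oppr_eq0.
have pcomm x : q *m x = x *m q -> p *m x = x *m p.
  by move=> h; rewrite mulmxBl mulmxBr mul1mx mulmx1 h.
have pJ := pcomm _ qJ; have pJ1 := pcomm _ qJ1; have pd := pcomm _ qd.
have rl x f : p *m x = x *m p -> radp p f -> radp p (x *m f).
  move=> px /radpP[pf fp]; apply/radpP.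
  by rewrite mulmxA px -!mulmxA pf fp mulmx0.
have rr x f : p *m x = x *m p -> radp p f -> radp p (f *m x).
  move=> px /radpP[pf fp]; apply/radpP.
  by rewrite mulmxA pf -mulmxA -px mulmxA fp mul0mx.
have inv1 x : radp p x -> E *m R (1%:M + (J *m x + x *m J)) = E.
  move=> px; set f := J *m x + x *m J.
  have pf : radp p f by apply: radpD; [exact: rl|exact: rr].
  have fJ : f *m J = J *m f.
    rewrite /f mulmxDl mulmxDr !mulmxA JJ -!mulmxA JJ addrC.
    by rewrite mul_scalar_mx mul_mx_scalar.
  rewrite proj_r ?(nu_rad pp _ pf) ?scale1r //.
  by apply/centJP; rewrite unitmx_1D ?(radp_mul pf pf) // mulmxDl mulmxDr fJ mul1mx mulmx1.
have inv2 x : radp p x -> R (1%:M - (J1 *m x + x *m J1)) *m (R g *m E) = R g *m E.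
  move=> px; set f := - (J1 *m x + x *m J1).
  have pf : radp p f by rewrite radpN; apply: radpD; [exact: rl|exact: rr].
  have fJ1 : f *m J1 = J1 *m f.
    rewrite /f mulmxN mulNmx mulmxDl mulmxDr !mulmxA J1J1 -!mulmxA J1J1 addrC.
    by rewrite mul_scalar_mx mul_mx_scalar.
  have u1f : 1%:M + f \in unitmx by rewrite unitmx_1D ?(radp_mul pf pf).
  clearbody f; pose cg (x : 'M[k]_n) := invmx g *m x *m g.
  have cgM x1 x2 : cg (x1 *m x2) = cg x1 *m cg x2.
    by rewrite /cg !mulmxA mulmxK.
  have cgJ1 : cg J1 = J by rewrite /cg -mulmxA J1g mulKmx.
  have cgf : 1%:M + cg f = cg (1%:M + f).
    by rewrite /cg mulmxDr mulmx1 mulmxDl mulVmx.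
  have gf : (1%:M + f) *m g = g *m (1%:M + cg f).
    by rewrite cgf /cg !mulmxA mulmxV // mul1mx.
  have H : centJ (1%:M + cg f).
    apply/centJP; rewrite {1}cgf !unitmx_mul ugV u1f ug; split => //.
    by rewrite mulmxDl mulmxDr mul1mx mulmx1 -cgJ1 -!cgM fJ1.
  rewrite mulmxA -repmM // gf repmM // ?centJ_unit // -mulmxA proj_l //.
  rewrite (@nu_rad (cg p)) ?scale1r // -?cgM ?pp //.
  - by rewrite -cgJ1 -!cgM pJ1.
  - by case/radpP: pf => pf fp; apply/radpP; rewrite -!cgM pf fp /cg mulmx0 mul0mx.
  - by rewrite -cgJ1 -!cgM fJ1.
pose h x := d' *m x + x *m d'.
have inv3 x : radp p x -> phi g = E *m R (1%:M + h x) *m (R g *m E).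
  move=> px; have pf1 : radp p (J *m x + x *m J) by apply: radpD; [exact: rl|exact: rr].
  have pf2 : radp p (- (J1 *m x + x *m J1)).
    by rewrite radpN; apply: radpD; [exact: rl|exact: rr].
  have <- : R (1%:M + (J *m x + x *m J)) *m R (1%:M - (J1 *m x + x *m J1)) =
      R (1%:M + h x).
    rewrite -repmM ?unitmx_1D ?(radp_mul pf1 pf1) ?(radp_mul pf2 pf2) //.
    congr (R _); rewrite mulmxDl mul1mx mulmxDr mulmx1 (radp_mul pf1 pf2) addr0.
    rewrite /h d'E mulmxBl mulmxBr.
    move: (J *m x) (x *m J) (J1 *m x) (x *m J1) => a b a' b'.
    by apply/matrixP => i j; rewrite !mxE; ring.
  by rewrite (mulmxA E) inv1 // -[RHS]mulmxA inv2 // mulmxA.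
have hP : {in radp p, forall x, h x \in radp p}.
  by move=> x px; apply: radpD; [exact: rl|exact: rr].
have hI : {in radp p &, injective h}.
  move=> x y px py hxy; apply/eqP; rewrite -subr_eq0; set z := x - y.
  have pz : radp p z by apply: radpD; rewrite ?radpN.
  have dz : d' *m z = - (z *m d').
    apply/eqP; rewrite -addr_eq0 /z mulmxBl mulmxBr addrACA -opprD subr_eq0.
    exact/eqP.
  clearbody z; case/radpP: pz => pz zp.
  have qz : q *m z = 0.
    by rewrite -[q](subKr 1%:M) -/p mulmxBl mul1mx pz subrr.
  have zq : z *m q = z by rewrite -[q](subKr 1%:M) -/p mulmxBr mulmx1 zp subr0.
  by rewrite -zq -commX ?qz // -mulmxA dz mulmxN !mulmxA dz mulNmx opprK.
have S0 : (0 < #|radp p|)%N.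
  by apply/card_gt0P; exists 0; apply/radpP; rewrite mulmx0 mul0mx.
have /eqP : #|radp p|%:R *: phi g = 0.
  rewrite scaler_nat -sumr_const.
  rewrite (eq_bigr (fun x => E *m R (1%:M + h x) *m (R g *m E))) //.
  rewrite -mulmx_suml -mulmx_sumr (sum_inj_on (fun f => R (1%:M + f)) hI hP).
  by rewrite cuspidal_sum // mulmx0 mul0mx.
by rewrite scaler_eq0 pnatr_eq0 eqn0Ngt S0 => /eqP.
Qed.

(** When phi g = 0, the vanishing of phi (tau g) comes from the same case distinction at tau g,
    because tau is an involution. *)
Lemma phi_tau g : g \in unitmx -> phi g = kap (\det g) *: phi (tau g).
Proof.
move=> ug.
have [ua|na] := boolP (linp g \in unitmx); first exact: phi_lin_unit.
have [ub|nb] := boolP (semip g \in unitmx); first exact: phi_semi_unit.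
have p0 := phi_zero ug na nb; rewrite p0.
suff -> : phi (tau g) = 0 by rewrite scaler0.
have ut := tau_unit ug.
have [ua|na'] := boolP (linp (tau g) \in unitmx).
  by rewrite phi_lin_unit // tauK // p0 scaler0.
have [ub|nb'] := boolP (semip (tau g) \in unitmx).
  by rewrite phi_semi_unit // tauK // p0 scaler0.
exact: phi_zero.
Qed.

Lemma phi_mul g h : g \in unitmx -> h \in unitmx ->
  phi g *m phi h = Nc *: \sum_(A | centJ A) (nu A)^-1 *: phi (g *m A *m h).
Proof.
move=> ug uh; rewrite /phi !mulmxA -(mulmxA (E *m R g)) projE.
rewrite -!scalemxAr -!scalemxAl; congr (_ *: _).
have -> : E *m R g *m E = \sum_(A | centJ A) (nu A)^-1 *: (E *m R g *m R A).
  by rewrite [LHS]mulmx_sumr; apply: eq_bigr => A _; rewrite -scalemxAr.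
rewrite 2!mulmx_suml; apply: eq_bigr => A HA; have uA := centJ_unit HA.
rewrite -!scalemxAl; congr (_ *: _).
by rewrite !repmM ?unitmx_mul ?ug ?uA ?uh // !mulmxA.
Qed.

(** phi g phi h is a combination of the phi (g A h). Applying tau reverses the product, and the
    substitution of tau A for A restores the weights because nu (tau A) = nu A / kap(det A). *)
Lemma phiC g h : g \in unitmx -> h \in unitmx -> phi g *m phi h = phi h *m phi g.
Proof.
move=> ug uh; rewrite [X in _ = X *m _]phi_tau // [X in _ = _ *m X]phi_tau //.
rewrite -[in RHS]scalemxAl -[in RHS]scalemxAr scalerA.
rewrite !phi_mul ?tau_unit // !scaler_sumr.
rewrite [RHS](reindex_onto tau tau) => [|A HA]; last by rewrite tauK ?centJ_unit.
apply: eq_big => [A|A HA].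
  apply/idP/andP => [HA|[HA /eqP <-]]; last by rewrite /tau; exact/centJ_s/centJV.
  by rewrite tauK ?centJ_unit //; split=> //; exact/centJ_s/centJV.
have uA := centJ_unit HA; have HsA := centJ_s HA.
have ugAh : g *m A *m h \in unitmx by rewrite !unitmx_mul ug uA.
have kd : kap (\det (g *m A *m h)) = kap (\det g) * kap (\det A) * kap (\det h).
  by rewrite !det_mulmx !kapM ?mulf_neq0 ?det0.
have tE : tau (g *m A *m h) = tau h *m tau A *m tau g.
  have e : invmx (g *m A *m h) = invmx h *m invmx A *m invmx g.
    apply: (can_inj (mulKmx ugAh)); rewrite mulmxV // !mulmxA mulmxK //.
    by rewrite mulmxK // mulmxV.
  by rewrite /tau e !mulmxA -!(mulmxA _ s s) ss !mulmx1.
have nA : nu (tau A) = nu A / kap (\det A).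
  have := nu_kap (centJV HA); rewrite nuV // det_inv kapV ?det0 // => <-.
  by rewrite mulrA mulfV ?mul1r ?nu_neq0.
have k1 := kap_neq0 (det0 uA); have k2 := nu_neq0 HA.
rewrite (phi_tau ugAh) kd tE nA !scalerA; congr (_ *: _).
by field; rewrite k1.
Qed.

(** The compressions E M E induce all endomorphisms of the image of E, and they commute by
    [repm_span] and [phiC], so this image has dimension at most 1. *)
Theorem gelfand_mult_one : exists r : 'rV[C]_d, forall lam : 'rV[C]_d,
  (forall A, centJ A -> lam *m R A = nu A *: lam) -> exists c, lam = c *: r.
Proof.
have [a aE] := choice (fun M => repm_span irr M).
have EME M : E *m M *m E = \sum_(A in unitmx) a M A *: phi A.
  have -> : E *m M = \sum_(A in unitmx) a M A *: (E *m R A).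
    by rewrite {1}(aE M) mulmx_sumr; apply: eq_bigr => A _; rewrite -scalemxAr.
  by rewrite mulmx_suml; apply: eq_bigr => A _; rewrite -scalemxAl.
have EC M N : (E *m M *m E) *m (E *m N *m E) = (E *m N *m E) *m (E *m M *m E).
  rewrite !EME !mulmx_suml; under eq_bigr do rewrite mulmx_sumr.
  rewrite exchange_big; apply: eq_bigr => A uA; rewrite mulmx_sumr.
  apply: eq_bigr => B uB; rewrite -!scalemxAr -!scalemxAl !scalerA mulrC.
  by rewrite phiC.
have [E0|] := eqVneq E 0.
  exists 0 => lam /fun_proj; rewrite E0 mulmx0 => /esym/eqP.
  by rewrite scaler_eq0 (negPf Nc_neq0) => /eqP->; exists 0; rewrite scaler0.
case/matrix0Pn=> i [j Eij].
exists (row i E) => lam /fun_proj lamE; set r := row i E; set b := col j E.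
have rE : r *m E = Nc *: r by rewrite -row_mul projE linearZ.
have Eb : E *m b = Nc *: b by rewrite /b !colE mulmxA projE -scalemxAl.
have rb : r *m b = (Nc * E i j)%:M.
  apply/matrixP => x y; rewrite !ord1 mxE [RHS]mxE eqxx mulr1n.
  have /matrixP/(_ i j) := projE; rewrite [LHS]mxE [RHS]mxE => <-.
  by apply: eq_bigr => l _; rewrite !mxE.
(* Commutativity is tested on the rank one operators b x and b y, where b is a column of E. *)
have key (x y : 'rV_d) : x *m E = Nc *: x -> y *m E = Nc *: y ->
    (x *m b) 0 0 *: y = (y *m b) 0 0 *: x.
  have G z : z *m E = Nc *: z -> E *m (b *m z) *m E = (Nc * Nc) *: (b *m z).
    move=> zE; rewrite mulmxA Eb -2!scalemxAl -mulmxA zE -scalemxAr scalerA.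
    by [].
  move=> xE yE; have := EC (b *m x) (b *m y); rewrite (G _ xE) (G _ yE).
  have N0 : Nc * Nc != 0 by rewrite mulf_neq0 ?Nc_neq0.
  rewrite -2!scalemxAl -2!scalemxAr => /(scalerI N0)/(scalerI N0).
  rewrite !mulmxA -(mulmxA b x) -(mulmxA b y) [x *m b]mx11_scalar [y *m b]mx11_scalar.
  rewrite !mul_mx_scalar -!scalemxAl => /(congr1 (mulmx (delta_mx 0 i : 'rV_d))).
  rewrite -!scalemxAr !mulmxA -[delta_mx 0 i *m b]rowE [row i b]mx11_scalar !mul_scalar_mx.
  rewrite !mxE !scalerA ![_ * E i j]mulrC -!scalerA; exact: (scalerI Eij).
have := key _ _ rE lamE; rewrite rb mxE eqxx mulr1n => e.
have c0 : Nc * E i j != 0 by rewrite mulf_neq0 ?Nc_neq0.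
by exists ((Nc * E i j)^-1 * (lam *m b) 0 0); rewrite -scalerA -e scalerA mulVf ?scale1r.
Qed.

End Gelfand.

(** * Multiplicity one for the Shalika subgroup *)

Lemma unitmx_rank1 (K : fieldType) n (u : 'cV[K]_n) (z : 'rV[K]_n) :
  1 + (z *m u) 0 0 != 0 -> 1%:M + u *m z \in unitmx.
Proof.
set c := (z *m u) 0 0 => c0.
have : (1%:M + u *m z) *m (1%:M - (1 + c)^-1 *: (u *m z)) = 1%:M.
  rewrite mulmxDl mul1mx mulmxBr mulmx1 -scalemxAr.
  have -> : u *m z *m (u *m z) = c *: (u *m z).
    rewrite !mulmxA -(mulmxA u z u) [z *m u]mx11_scalar -/c mul_mx_scalar.
    by rewrite -scalemxAl.
  clearbody c; move: (u *m z) => U.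
  by apply/matrixP => i j; rewrite !mxE; field.
by case/mulmx1_unit.
Qed.

(* The group of matrices fixing the first basis vectors is transitive on the
   nonzero vectors supported on the remaining coordinates. *)
Lemma trans_unitmx (K : fieldType) n (i : 'I_n) (w : 'cV[K]_n) :
  (forall b : 'I_n, (b < i)%N -> w b 0 = 0) -> w != 0 ->
  exists h : 'M[K]_n, [/\ h \in unitmx, h *m delta_mx i 0 = w &
    forall b : 'I_n, (b < i)%N -> h *m delta_mx b (0 : 'I_1) = delta_mx b 0].
Proof.
move=> w0 /cV0Pn[l wl].
(* h will be 1 + (w - e_i) z, so z must vanish on the earlier basis vectors, take the value 1 at e_i
   and be nonzero at w; the coordinate l takes care of w_i = 0. *)
pose z : 'rV[K]_n := delta_mx 0 i + (if w i 0 == 0 then delta_mx 0 l else 0).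
have il : (i <= l)%N by rewrite leqNgt; apply: contraNN wl => /w0->.
have zb (b : 'I_n) : z *m delta_mx b (0 : 'I_1) =
    (if b == i then 1 else if (w i 0 == 0) && (b == l) then 1 else 0)%:M.
  rewrite -colE; apply/matrixP => x y; rewrite !ord1 !mxE !eqxx mulr1n /=.
  case: (eqVneq b i) => [->|bi].
    case: ifP => [wi|_]; rewrite mxE ?addr0 //=.
    case: (eqVneq i l) => [e|_]; last by rewrite addr0.
    by rewrite -e wi in wl.
  rewrite add0r; case: ifP => _; rewrite mxE //=.
  by case: (b == l).
have zw : (z *m w) 0 0 != 0.
  rewrite mulmxDl mxE -rowE mxE; case: ifP => [/eqP wi|wi].
    by rewrite wi add0r -rowE mxE.
  by rewrite mul0mx mxE addr0 wi.
exists (1%:M + (w - delta_mx i 0) *m z); split.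
- apply: unitmx_rank1; suff -> : (z *m (w - delta_mx i 0)) 0 0 = (z *m w) 0 0 - 1.
    by rewrite addrC subrK.
  rewrite mulmxBr zb eqxx; move: (z *m w) => zw'.
  by rewrite !mxE.
- by rewrite mulmxDl mul1mx -mulmxA zb eqxx mulmx1 addrC subrK.
move=> b bi; rewrite mulmxDl mul1mx -mulmxA zb.
have -> : (b == i) = false by apply/negbTE; rewrite neq_ltn bi.
have -> : (b == l) = false by apply/negbTE; rewrite neq_ltn (leq_trans bi).
by rewrite andbF raddf0 mulmx0 addr0.
Qed.

(** In characteristic 0 the trace of an idempotent is its rank: the two factors of its rank
    decomposition, multiplied in the other order, give the identity. *)
Lemma idem_trace1 (K : fieldType) n (E : 'M[K]_n) : [pchar K] =i pred0 ->
  E *m E = E -> \tr E = 1 -> forall x y : 'rV_n, y *m E != 0 ->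
  exists c, x *m E = c *: (y *m E).
Proof.
move=> ch EE tr1 x y.
have r1 : \rank E = 1%N.
  have BC : row_base E *m col_base E = 1%:M.
    have f1 := row_base_free E; have f2 := col_base_full E.
    apply: (row_free_inj f1); rewrite mul1mx; apply: (row_full_inj f2).
    have -> : col_base E *m (row_base E *m col_base E *m row_base E) =
        col_base E *m row_base E *m (col_base E *m row_base E) by rewrite !mulmxA.
    by rewrite mulmx_base EE.
  have : (\rank E)%:R = 1 :> K.
    by rewrite -(mxtrace1 K (\rank E)) -BC mxtrace_mulC mulmx_base.
  case: (\rank E) => [/esym/eqP|r]; first by rewrite (negPf (oner_neq0 K)).
  rewrite -[r.+1]addn1 natrD => /(congr1 (fun z : K => z - 1)).
  by have /(pcharf0P K) ch0 := ch; rewrite addrK subrr => /eqP; rewrite ch0 => /eqP->.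
have [C [B EE']] : exists (C : 'cV_n) (B : 'rV_n), E = C *m B.
  move: (mulmx_base E); move: (col_base E) (row_base E); rewrite r1 => C B <-.
  by exists C, B.
rewrite EE' !mulmxA [x *m C]mx11_scalar [y *m C]mx11_scalar !mul_scalar_mx.
move=> nz; have y0 : (y *m C) 0 0 != 0 by apply: contraNneq nz => ->; rewrite scale0r.
by exists ((x *m C) 0 0 / (y *m C) 0 0); rewrite scalerA divfK.
Qed.

(** * The projector on Whittaker vectors and its trace *)

Section Whittaker.
Variables (C : numClosedFieldType) (k : finFieldType) (n d : nat).
(** [R] is kept abstract so that it can be [rho] read after a permutation of the basis. *)
Variable R : 'M[k]_n -> 'M[C]_d.
Hypothesis R1 : R 1%:M = 1%:M.
Hypothesis RM : forall A B, A \in unitmx -> B \in unitmx ->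
  R (A *m B) = R A *m R B.
Hypothesis Rcusp : forall p : 'M[k]_n, p *m p = p -> p != 0 -> p != 1%:M ->
  \sum_(f | radp p f) R (1%:M + f) = 0.
Variable idx : nat -> 'I_n.
Hypothesis idxE : forall j, (j < n)%N -> idx j = j :> nat.
Variable psi : k -> C.
Hypothesis psiD : forall x y, psi (x + y) = psi x * psi y.
Hypothesis psi_neq0 : forall x, psi x != 0.
Hypothesis psi_nt : exists x, psi x != 1.

Lemma psi0 : psi 0 = 1.
Proof. by apply: (mulfI (psi_neq0 0)); rewrite -psiD addr0 mulr1. Qed.

Lemma psiN x : psi (- x) = (psi x)^-1.
Proof.
by apply: (mulfI (psi_neq0 x)); rewrite -psiD subrr psi0 mulfV.
Qed.

Lemma psi_eq x y : (forall c, psi (c * x) = psi (c * y)) -> x = y.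
Proof.
move=> h; apply/eqP; rewrite -subr_eq0; apply/negPn/negP => xy.
have [t] := psi_nt; case/eqP.
have := h (t / (x - y)); set c := t / _ => e.
have -> : t = c * x - c * y by rewrite -mulrBr divfK.
by rewrite psiD psiN e mulfV.
Qed.

Definition supp j (g : 'rV[k]_n) := [forall b : 'I_n, (b <= j)%N ==> (g 0 b == 0)].

Lemma suppP j (g : 'rV[k]_n) : reflect (forall b : 'I_n, (b <= j)%N -> g 0 b = 0) (supp j g).
Proof.
apply: (iffP forallP) => h b; have := h b.
  by move=> /implyP h' /h'/eqP.
by move=> h'; apply/implyP => /h'/eqP.
Qed.

(** Under [supp j g] this is an element of row j of the upper unitriangular group. *)
Definition rowu j (g : 'rV[k]_n) : 'M[k]_n := 1%:M + delta_mx (idx j) 0 *m g.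

Lemma supp_le i j g : (i <= j)%N -> supp j g -> supp i g.
Proof. by move=> ij /suppP h; apply/suppP => b bi; apply: h; apply: leq_trans ij. Qed.

Lemma supp_dot i j g : (i < n)%N -> (i <= j)%N -> supp j g ->
  g *m delta_mx (idx i) (0 : 'I_1) = 0.
Proof.
move=> lin ij /suppP h; rewrite -colE; apply/matrixP => x y.
by rewrite !ord1 !mxE h // idxE.
Qed.

Lemma rowu_unit j g : (j < n)%N -> supp j g -> rowu j g \in unitmx.
Proof.
move=> jn sg; apply: unitmx_rank1.
by rewrite (supp_dot jn (leqnn j) sg) mxE addr0 oner_neq0.
Qed.

Lemma rowuD j g g' : (j < n)%N -> supp j g -> supp j g' ->
  rowu j (g + g') = rowu j g *m rowu j g'.
Proof.
move=> jn sg sg'; rewrite /rowu mulmxDl mul1mx !mulmxDr mulmx1.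
rewrite mulmxA -(mulmxA _ g) (supp_dot jn (leqnn j) sg) mulmx0 mul0mx addr0.
by rewrite -addrA (addrC (_ *m g')).
Qed.

Lemma rowu_comm i j g g' : (i < j < n)%N -> supp i g -> supp j g' ->
  rowu i g *m rowu j g' = rowu j g' *m rowu i (g + g 0 (idx j) *: g').
Proof.
case/andP=> ij jn sg sg'; rewrite /rowu !mulmxDl !mul1mx !mulmxDr !mulmx1.
have lin : (i < n)%N by exact: ltn_trans jn.
rewrite !mulmxA -!(mulmxA _ g) -!(mulmxA _ g') (supp_dot lin (ltnW ij) sg').
rewrite mulmx0 !mul0mx !addr0 -[g *m delta_mx _ _]colE.
rewrite [col _ _]mx11_scalar mxE mul_mx_scalar -scalemxAl -scalemxAr.
rewrite ?mulmxDr -?scalemxAr.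
move: (delta_mx (idx i) 0 *m g) (delta_mx (idx j) 0 *m g') (delta_mx (idx i) 0 *m g').
by move=> u v w; apply/matrixP => x y; rewrite !mxE; ring.
Qed.

Lemma suppD j g g' : supp j g -> supp j g' -> supp j (g + g').
Proof. by move=> /suppP h /suppP h'; apply/suppP => b bj; rewrite mxE h ?h' ?addr0. Qed.

Lemma suppN j g : supp j g -> supp j (- g).
Proof. by move=> /suppP h; apply/suppP => b bj; rewrite mxE h ?oppr0. Qed.

Lemma suppZ j c g : supp j g -> supp j (c *: g).
Proof. by move=> /suppP h; apply/suppP => b bj; rewrite mxE h ?mulr0. Qed.

Lemma supp0 j : supp j 0.
Proof. by apply/suppP => b _; rewrite mxE. Qed.

Definition nsupp j : C := #|supp j|%:R.

Lemma nsupp_neq0 j : nsupp j != 0.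
Proof. by rewrite pnatr_eq0 -lt0n; apply/card_gt0P; exists 0; exact: supp0. Qed.

(* The projector on the vectors on which row j of the upper unipotent group acts
   by the character g |-> psi (g *m w). *)
Definition four j (w : 'cV[k]_n) : 'M[C]_d :=
  (nsupp j)^-1 *: \sum_(g | supp j g) psi (- (g *m w) 0 0) *: R (rowu j g).

Lemma four_l j g w : (j < n)%N -> supp j g ->
  R (rowu j g) *m four j w = psi ((g *m w) 0 0) *: four j w.
Proof.
move=> jn sg; rewrite /four -scalemxAr scalerA mulrC -scalerA; congr (_ *: _).
rewrite mulmx_sumr [in RHS](reindex_inj (addrI g)) scaler_sumr /=.
apply: eq_big => [g'|g' sg'].
  apply/idP/idP => [|h]; first exact: suppD.
  by rewrite -(addKr g g') suppD ?suppN.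
rewrite -scalemxAr -RM ?rowu_unit // -rowuD // scalerA; congr (_ *: _).
by rewrite -psiD mulmxDl [X in _ - X]mxE opprD addrA subrr add0r.
Qed.

(** Moving row i past row j changes g by a multiple of a vector supported beyond j, which leaves the
    entry i + 1 alone. So an eigenvalue on Z that depends on this entry only survives multiplication
    by [four j w]. *)
Lemma four_comm i j g w Z t : (i < j < n)%N -> supp i g ->
  (forall g', supp i g' -> g' 0 (idx i.+1) = g 0 (idx i.+1) ->
     R (rowu i g') *m Z = t *: Z) ->
  R (rowu i g) *m (four j w *m Z) = t *: (four j w *m Z) :> 'M_d.
Proof.
move=> ijn sg hZ; case/andP: (ijn) => ij jn; have lin := ltn_trans ij jn.
rewrite /four -scalemxAl -scalemxAr scalerA mulrC -scalerA; congr (_ *: _).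
rewrite !mulmx_suml mulmx_sumr scaler_sumr; apply: eq_bigr => g' sg'.
have sg2 : supp i (g + g 0 (idx j) *: g') by rewrite suppD ?suppZ // (supp_le (ltnW ij)).
rewrite -!scalemxAl -scalemxAr mulmxA -RM ?rowu_unit // rowu_comm // RM ?rowu_unit //.
rewrite -mulmxA hZ // -?scalemxAr ?scalerA 1?mulrC //.
rewrite !mxE; have /suppP h := sg'.
by rewrite (h (idx i.+1)) ?mulr0 ?addr0 // idxE // (leq_ltn_trans ij).
Qed.

(* The projector on the vectors on which row i < j of the upper unipotent group
   acts by psi of its superdiagonal entry. *)
Fixpoint whit j : 'M[C]_d :=
  if j is j'.+1 then four j' (delta_mx (idx j) 0) *m whit j' else 1%:M.

Lemma dot_delta (g : 'rV[k]_n) i : (g *m delta_mx i (0 : 'I_1)) 0 0 = g 0 i.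
Proof. by rewrite -colE mxE. Qed.

Lemma whit_l i j g : (i < j < n)%N -> supp i g ->
  R (rowu i g) *m whit j = psi (g 0 (idx i.+1)) *: whit j.
Proof.
elim: j g => [//|j IH] g /andP[]; rewrite ltnS leq_eqVlt => /predU1P[->|ij] jn sg /=.
  by rewrite mulmxA four_l 1?ltnW // -scalemxAl dot_delta.
apply: four_comm; rewrite ?ij 1?ltnW // => g' sg' <-.
by apply: IH; rewrite ?ij 1?ltnW.
Qed.

Lemma four_whit_l i j g w : (i < j < n)%N -> supp i g ->
  R (rowu i g) *m (four j w *m whit j) = psi (g 0 (idx i.+1)) *: (four j w *m whit j).
Proof.
by move=> ijn sg; apply: four_comm => // g' sg' <-; exact: whit_l.
Qed.

Lemma four_whit i j : (i < j < n)%N ->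
  four i (delta_mx (idx i.+1) 0) *m whit j = whit j.
Proof.
move=> ijn; rewrite /four -scalemxAl mulmx_suml (eq_bigr (fun=> whit j)).
  by rewrite sumr_const -scaler_nat scalerA mulVf ?nsupp_neq0 // scale1r.
move=> g sg; rewrite -scalemxAl whit_l // scalerA dot_delta -psiD addNr psi0.
by rewrite scale1r.
Qed.

(** For i = j this is the idempotency of the Whittaker projector. *)
Lemma whitM i j : (i <= j < n)%N -> whit i *m whit j = whit j.
Proof.
elim: i => [|i IH] /andP[ij jn]; first by rewrite mul1mx.
rewrite /= -mulmxA IH; last by rewrite (ltnW ij).
by rewrite four_whit // ij.
Qed.

(** These elements permute the characters of row j by w |-> h w and commute with the projector of
    the previous rows. *)
Definition lev j (h : 'M[k]_n) :=
  h \in unitmx /\ forall b : 'I_n, (b <= j)%N ->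
    h *m delta_mx b (0 : 'I_1) = delta_mx b 0.

Lemma levV j h : lev j h -> lev j (invmx h).
Proof.
case=> uh hb; split=> [|b bj]; first by rewrite unitmx_inv.
by rewrite -{1}(hb b bj) mulKmx.
Qed.

Lemma lev_le i j h : (i <= j)%N -> lev j h -> lev i h.
Proof. by move=> ij [uh hb]; split=> // b bi; apply: hb; apply: leq_trans ij. Qed.

Lemma lev_supp j h g : lev j h -> supp j g -> supp j (g *m h).
Proof.
case=> uh hb /suppP sg; apply/suppP => b bj.
by rewrite -dot_delta -mulmxA hb // dot_delta sg.
Qed.

Lemma lev_rowu j h g : (j < n)%N -> lev j h ->
  rowu j g *m h = h *m rowu j (g *m h).
Proof.
move=> jn [uh hb]; rewrite /rowu mulmxDl mul1mx mulmxDr mulmx1 !mulmxA hb //.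
by rewrite idxE.
Qed.

Lemma four_lev j h w : (j < n)%N -> lev j h ->
  four j (h *m w) *m R h = R h *m four j w.
Proof.
move=> jn Lh; have [uh hb] := Lh; have LV := levV Lh.
rewrite /four -scalemxAl -scalemxAr; congr (_ *: _).
rewrite mulmx_suml mulmx_sumr [RHS](reindex_inj (can_inj (mulmxK uh))).
apply: eq_big => [g|g sg].
  apply/idP/idP => [|sg]; first exact: lev_supp.
  by rewrite -(mulmxK uh g) lev_supp.
rewrite -scalemxAl -scalemxAr mulmxA -!RM ?rowu_unit ?lev_supp //.
by rewrite lev_rowu.
Qed.

Lemma whit_lev j h : (j < n)%N -> lev j h -> whit j *m R h = R h *m whit j.
Proof.
elim: j => [|j IH] jn Lh /=; first by rewrite mul1mx mulmx1.
have jn' := ltnW jn; have Lh' := lev_le (leqnSn j) Lh.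
rewrite -mulmxA IH // !mulmxA; congr (_ *m _).
have hw : h *m delta_mx (idx j.+1) (0 : 'I_1) = delta_mx (idx j.+1) 0.
  by case: Lh => _ ->; rewrite ?idxE.
by rewrite -{1}hw four_lev.
Qed.

Lemma sum_psi (g : 'rV[k]_n) j : supp j g -> g != 0 ->
  \sum_(w : 'cV[k]_n | supp j w^T) psi (- (g *m w) 0 0) = 0.
Proof.
move=> sg /rV0Pn[b gb]; have [t tn] := psi_nt.
set S := \sum_(w | _) _; pose u : 'cV[k]_n := (- t / g 0 b) *: delta_mx b 0.
have bj : (j < b)%N.
  by rewrite ltnNge; apply: contraNN gb => bj; apply/eqP; apply: (suppP _ _ sg).
have su : supp j u^T.
  apply/suppP => b' b'j; rewrite !mxE (_ : (b' == b) = false) ?mulr0 //.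
  by apply/negbTE; rewrite neq_ltn (leq_ltn_trans b'j bj).
have gu : (g *m u) 0 0 = - t by rewrite -scalemxAr mxE dot_delta divfK.
have : S = psi t * S.
  rewrite [LHS](reindex_inj (addrI u)) mulr_sumr /=; apply: eq_big => [w|w sw].
    rewrite raddfD /=; apply/idP/idP => [h|h]; last exact: suppD.
    by rewrite -(addKr u^T w^T) suppD ?suppN.
  by rewrite -psiD mulmxDr [X in psi (- X)]mxE gu opprD opprK.
move/eqP; rewrite -subr_eq0 -{1}[S]mul1r -mulrBl mulf_eq0 subr_eq0 eq_sym.
by rewrite (negPf tn) => /eqP.
Qed.

Lemma card_suppT j : #|[pred w : 'cV[k]_n | supp j w^T]| = #|supp j|.
Proof.
rewrite -(card_imset [pred w : 'cV[k]_n | supp j w^T] (@trmx_inj _ n 1)).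
apply: eq_card => g; apply/imsetP/idP => [[w wj ->] //|sg].
by exists g^T; rewrite ?trmxK // inE trmxK.
Qed.

(** Fourier inversion: the w supported beyond j parametrize the characters of row j, and the
    spectral projectors add up to 1. *)
Lemma sum_four j : (j < n)%N -> \sum_(w : 'cV[k]_n | supp j w^T) four j w = 1%:M.
Proof.
move=> jn; rewrite /four -scaler_sumr exchange_big /= (bigD1 0) ?supp0 //=.
rewrite [X in _ + X]big1 => [|g /andP[sg g0]]; last first.
  by rewrite -scaler_suml sum_psi // scale0r.
rewrite addr0 /rowu mulmx0 addr0 R1 (eq_bigr (fun=> 1%:M)) => [|w _]; last first.
  by rewrite mul0mx mxE oppr0 psi0 scale1r.
rewrite sumr_const -scaler_nat scalerA card_suppT mulVf ?scale1r //.
exact: nsupp_neq0.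
Qed.

Definition topp j : 'M[k]_n := \matrix_(a, b) ((a == b) && (a <= j)%N)%:R.

Lemma topp_mul j p (A : 'M_(n, p)) a b : (topp j *m A) a b = (a <= j)%N%:R * A a b.
Proof.
rewrite mxE (bigD1 a) //= mxE eqxx /= big1 ?addr0 // => c ca.
by rewrite mxE eq_sym (negPf ca) mul0r.
Qed.

Lemma mul_topp j p (A : 'M_(p, n)) a b : (A *m topp j) a b = A a b * (b <= j)%N%:R.
Proof.
rewrite mxE (bigD1 b) //= mxE eqxx /= big1 ?addr0 // => c cb.
by rewrite mxE (negPf cb) mulr0.
Qed.

(* The image is fixed by a whole unipotent radical. *)
Lemma four0_whit j : (j.+1 < n)%N -> four j 0 *m whit j = 0.
Proof.
move=> jn1; have jn := ltnW jn1; set X := _ *m _.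
have invj i g : (i <= j)%N -> supp j g -> R (rowu i g) *m X = X.
  rewrite leq_eqVlt => /predU1P[->|ij] sg.
    by rewrite mulmxA four_l // mulmx0 mxE psi0 scale1r.
  rewrite four_whit_l ?ij // ?(supp_le (ltnW ij)) //.
  have /suppP -> := sg; rewrite ?psi0 ?scale1r // idxE //.
  exact: leq_ltn_trans jn.
have inv f : radp (topp j) f -> R (1%:M + f) *m X = X.
  move=> /radpP[pf fp].
  have fz a (b : 'I_n) : (b <= j)%N -> f a b = 0.
    move=> bj; have /matrixP/(_ a b) := fp.
    by rewrite mul_topp bj mulr1 [RHS]mxE.
  have fz' (a : 'I_n) b : (j < a)%N -> f a b = 0.
    by move=> ja; rewrite -pf topp_mul leqNgt ja mul0r.
  have sr a : supp j (row a f) by apply/suppP => b bj; rewrite mxE fz.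
  (* 1 + f is built up one row at a time, since [invj] gives invariance under single rows only. *)
  pose ft t := \sum_(i < t) delta_mx (idx i) (0 : 'I_1) *m row (idx i) f.
  have -> : f = ft n.
    apply/matrixP => a b; rewrite summxE (bigD1 a) //= big1 ?addr0.
      rewrite (_ : idx a = a); last by apply: val_inj; rewrite /= idxE.
      by rewrite !mxE big_ord1 !mxE !eqxx mul1r.
    move=> i ia; rewrite (_ : idx i = i); last by apply: val_inj; rewrite /= idxE.
    by rewrite mxE big_ord1 !mxE eq_sym (negPf ia) mul0r.
  suff : forall t, (t <= n)%N -> 1%:M + ft t \in unitmx /\ R (1%:M + ft t) *m X = X.
    by case/(_ n) => //.
  elim=> [_|t IH tn]; first by rewrite /ft big_ord0 addr0 unitmx1 R1 mul1mx.
  have [ut Rt] := IH (ltnW tn).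
  have ftS : ft t.+1 = ft t + delta_mx (idx t) 0 *m row (idx t) f.
    by rewrite /ft big_ord_recr.
  have [tj|jt] := leqP t j; last first.
    rewrite ftS (_ : row _ _ = 0) ?mulmx0 ?addr0 //.
    by apply/matrixP => a b; rewrite [LHS]mxE [RHS]mxE fz' // idxE.
  have e : 1%:M + ft t.+1 = (1%:M + ft t) *m rowu t (row (idx t) f).
    rewrite ftS /rowu mulmxDl mul1mx mulmxDr mulmx1 mulmxA.
    rewrite [ft t *m delta_mx _ _](_ : _ = 0) ?mul0mx ?addr0 1?addrAC ?addrA //.
    rewrite /ft mulmx_suml big1 // => i _; rewrite -mulmxA -colE.
    apply/matrixP => a b; rewrite mxE big1 ?mxE // => l _.
    by rewrite !mxE fz ?mulr0 // idxE.
  have st := supp_le tj (sr (idx t)).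
  rewrite e unitmx_mul ut rowu_unit // RM ?rowu_unit //; split=> //.
  by rewrite -mulmxA invj.
have p0 : topp j != 0.
  apply/eqP => /matrixP/(_ (idx 0) (idx 0)); rewrite !mxE eqxx idxE ?leq0n //.
    by move/eqP; rewrite oner_eq0.
  exact: leq_ltn_trans jn.
have p1 : topp j != 1%:M.
  apply/eqP => /matrixP/(_ (idx j.+1) (idx j.+1)); rewrite !mxE eqxx idxE // ltnn.
  by move/esym/eqP; rewrite oner_eq0.
have pp : topp j *m topp j = topp j.
  apply/matrixP => a b; rewrite topp_mul !mxE.
  by case: (a == b); case: (a <= j)%N; rewrite ?mulr1 ?mulr0 ?mul1r.
have /(congr1 (mulmx^~ X)) := Rcusp pp p0 p1; rewrite mul0mx mulmx_suml.
rewrite (eq_bigr (fun=> X)) => [|f pf]; last exact: inv.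
rewrite sumr_const -scaler_nat => /eqP; rewrite scaler_eq0 pnatr_eq0 => /orP[|/eqP//].
rewrite eqn0Ngt => /negP[]; apply/card_gt0P; exists 0.
by apply/radpP; rewrite mulmx0 mul0mx.
Qed.

Lemma trans_lev j (w : 'cV[k]_n) : (j.+1 < n)%N -> supp j w^T -> w != 0 ->
  exists2 h, lev j h & h *m delta_mx (idx j.+1) 0 = w.
Proof.
move=> jn /suppP sw w0.
have [b|h [uh hw hb]] := @trans_unitmx _ _ (idx j.+1) w _ w0.
  by rewrite idxE // ltnS => bj; rewrite -[w]trmxK mxE sw.
by exists h => //; split=> // b bj; rewrite hb // idxE.
Qed.

Lemma lev_unit j h : lev j h -> h \in unitmx. Proof. by case. Qed.

Lemma four_conj j h : (j.+1 < n)%N -> lev j h ->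
  four j (h *m delta_mx (idx j.+1) 0) *m whit j = R h *m whit j.+1 *m R (invmx h).
Proof.
move=> jn Lh; have LV := levV Lh; have uh := lev_unit Lh; have jn' := ltnW jn.
have hV : R h *m R (invmx h) = 1%:M by rewrite -RM ?unitmx_inv // mulmxV.
rewrite -[LHS]mulmx1 -hV -[in LHS]mulmxA (mulmxA (whit j)) whit_lev // !mulmxA.
by rewrite four_lev.
Qed.

(* The nsupp j - 1 nontrivial characters of row j are conjugate under the
   stabilizer of the Whittaker character of the previous rows. *)
Lemma trace_whit j : (j.+1 < n)%N ->
  \tr (whit j) = (nsupp j - 1) * \tr (whit j.+1).
Proof.
move=> jn; have jn' := ltnW jn.
rewrite -[whit j in LHS]mul1mx -(sum_four jn') mulmx_suml raddf_sum /=.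
rewrite (bigD1 0) ?supp0 //=; last by rewrite raddf0 supp0.
rewrite four0_whit // raddf0 add0r (eq_bigr (fun=> \tr (whit j.+1))).
  rewrite sumr_const -[LHS]mulr_natl; congr (_ * _).
  rewrite /nsupp -card_suppT [in RHS](cardD1 0) inE raddf0 supp0 natrD addrAC subrr add0r.
  by congr (_%:R); apply: eq_card => w; rewrite !inE andbC.
move=> w /andP[sw w0]; have [h Lh <-] := trans_lev jn sw w0.
rewrite four_conj // mxtrace_mulC mulmxA -RM ?unitmx_inv ?(lev_unit Lh) //.
by rewrite mulVmx ?(lev_unit Lh) // R1 mul1mx.
Qed.

Lemma card_supp j : (j < n)%N -> #|supp j| = (#|k| ^ (n - j.+1))%N.
Proof.
move=> jn; pose f (g : 'rV[k]_n) : {ffun 'I_n -> k} := [ffun b => g 0 b].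
have fI : injective f.
  by move=> g g' /ffunP e; apply/rowP => b; have := e b; rewrite !ffunE.
rewrite -(card_imset (supp j) fI).
have -> : (n - j.+1)%N = #|[pred b : 'I_n | (j < b)%N]|.
  have e : #|[pred b : 'I_n | (b < j.+1)%N]| = j.+1.
    rewrite -sum1_card; transitivity (\sum_(i < n | (i < j.+1)%N) 1)%N.
      by apply: eq_bigl => b; rewrite inE.
    by rewrite (big_ord_narrow jn) sum_nat_const card_ord muln1.
  rewrite -[X in (X - _)%N](card_ord n) -(cardC [pred b : 'I_n | (b < j.+1)%N]) e addKn.
  by apply: eq_card => b; rewrite !inE ltnS -ltnNge.
rewrite -(card_pffun_on 0); apply: eq_card => g; apply/imsetP/pffun_onP => [[h sh ->]|[sg _]].
  split=> //; apply/subsetP => b; rewrite !inE ffunE ltnNge; apply: contraNN => bj.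
  by have /suppP -> := sh.
exists (\row_b g b); last by apply/ffunP => b; rewrite ffunE mxE.
apply/suppP => b bj; rewrite mxE; apply/eqP; apply: contraTT bj => gb.
by have /subsetP/(_ b) := sg; rewrite !inE -ltnNge; exact.
Qed.

(** The trace is d at j = 0, and row j divides it by q^(n-j-1) - 1; the product of these factors is
    the assumed dimension. *)
Lemma whit_trace1 : (0 < n)%N ->
  d%:R = \prod_(1 <= i < n) ((#|k| ^ i)%N%:R - 1) :> C -> \tr (whit n.-1) = 1.
Proof.
move=> n0 hd; have k1 : (1 < #|k|)%N by exact: card_finNzRing_gt1.
have fac i : (0 < i)%N -> (#|k| ^ i)%N%:R - 1 != 0 :> C.
  move=> i0; rewrite subr_eq0 (eqr_nat _ _ 1) -(expn0 #|k|) eqn_exp2l //.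
  by rewrite -lt0n.
have key j : (j < n)%N -> \prod_(n - j <= i < n) ((#|k| ^ i)%N%:R - 1) * \tr (whit j) = d%:R.
  elim: j => [|j IH] jn; first by rewrite subn0 big_geq // mul1r mxtrace1.
  rewrite -IH ?(ltnW jn) // (trace_whit jn) /nsupp card_supp ?(ltnW jn) //.
  have -> : (n - j = (n - j.+1).+1)%N by rewrite subnSK ?(ltnW jn).
  by rewrite [in LHS]big_ltn ?mulrA ?[_ * (_ - 1)]mulrC // ltn_subrL.
have := key n.-1; rewrite prednK // => /(_ (leqnn _)); rewrite hd.
have -> : (n - n.-1 = 1)%N by rewrite -subn1 subKn.
set P := \prod_(_ <= _ < _) _; rewrite -[RHS]mulr1; apply: mulfI.
rewrite prodf_seq_neq0; apply/allP => i; rewrite mem_index_iota => /andP[i0 _].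
exact: fac.
Qed.

Lemma whit_fun_rank1 (x y : 'rV[C]_d) : (0 < n)%N ->
  d%:R = \prod_(1 <= i < n) ((#|k| ^ i)%N%:R - 1) :> C ->
  y *m whit n.-1 != 0 -> exists c, x *m whit n.-1 = c *: (y *m whit n.-1).
Proof.
move=> n0 hd; apply: idem_trace1; first exact: pchar_num.
  by rewrite whitM // leqnn ltn_predL.
exact: whit_trace1.
Qed.

(** * Shalika functionals are detected by the Whittaker projector *)

Section Shalika.
Variables (m : nat) (X Y : 'M[k]_(n, m)).
Hypothesis nE : n = (m + m)%N.
Hypothesis m0 : (0 < m)%N.
(** The halves are interleaved as x_0, y_0, x_1, y_1, ..., so that the diagonal entries of Q, which
    carry the Shalika character, fall on the superdiagonal places (2a, 2a+1). The other
    superdiagonal places are reached through the diagonal action of GL_m. *)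
Hypothesis XE : forall a : 'I_m, X *m delta_mx a (0 : 'I_1) = delta_mx (idx (2 * a)) 0.
Hypothesis YE : forall a : 'I_m, Y *m delta_mx a (0 : 'I_1) = delta_mx (idx (2 * a).+1) 0.
Hypotheses (XX : X^T *m X = 1%:M) (YY : Y^T *m Y = 1%:M) (XY : X^T *m Y = 0).
Variable zeta : 'M[k]_m -> C.
Hypothesis zeta_transv : forall (a b : 'I_m) c, (a < b)%N ->
  zeta (1%:M + c *: delta_mx a b) = 1.

Definition shalika_fun (lam : 'rV[C]_d) :=
  (forall Q : 'M[k]_m, lam *m R (1%:M + X *m Q *m Y^T) = psi (\tr Q) *: lam) /\
  (forall P : 'M[k]_m, P \in unitmx ->
     lam *m R (X *m P *m X^T + Y *m P *m Y^T) = zeta P *: lam).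

Lemma YX : Y^T *m X = 0.
Proof. by apply: trmx_inj; rewrite trmx_mul trmxK XY trmx0. Qed.

Lemma ltx (a : 'I_m) : (2 * a < n)%N.
Proof. by rewrite nE addnn -mul2n ltn_pmul2l. Qed.

Lemma lty (a : 'I_m) : ((2 * a).+1 < n)%N.
Proof.
rewrite nE addnn -mul2n; apply: (@leq_trans (2 * a.+1)); first by rewrite mulnS.
by rewrite leq_mul2l ltn_ord.
Qed.

Lemma idx_cases (b : 'I_n) :
  (exists a : 'I_m, b = idx (2 * a)) \/ (exists a : 'I_m, b = idx (2 * a).+1).
Proof.
have hb : (b./2 < m)%N by rewrite ltn_half_double -addnn -nE.
case ob : (odd b); [right|left]; exists (Ordinal hb); apply: val_inj => /=.
  by rewrite idxE ?(lty (Ordinal hb)) //= mul2n -[LHS]odd_double_half ob.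
by rewrite idxE ?(ltx (Ordinal hb)) //= mul2n -[LHS]odd_double_half ob.
Qed.

(** If h acts on lam by a scalar and moves the standard character of row j to another one, then lam
    kills the component of the latter once it kills that of the former. *)
Lemma fun_lev j h z (lam : 'rV[C]_d) : (j.+1 < n)%N -> lev j h ->
  lam *m R h = z *: lam -> lam *m whit j.+1 = 0 ->
  lam *m (four j (h *m delta_mx (idx j.+1) 0) *m whit j) = 0.
Proof.
move=> jn Lh lh; rewrite four_conj //; move: (whit j.+1) => W l0.
by rewrite -(mulmxA (R h)) mulmxA lh -scalemxAl (mulmxA lam) l0 mul0mx scaler0.
Qed.

Lemma fun_eigen (g : 'M[C]_d) (Z : 'M[C]_d) t t' (lam : 'rV[C]_d) :
  g *m Z = t *: Z -> lam *m g = t' *: lam -> lam *m Z != 0 -> t = t'.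
Proof.
move=> gZ lg nz; apply/eqP; rewrite -subr_eq0; apply: contraNT nz => tt.
have : (t - t') *: (lam *m Z) = 0.
  by rewrite scalerBl scalemxAr -gZ scalemxAl -lg mulmxA subrr.
by move/eqP; rewrite scaler_eq0 (negPf tt).
Qed.

Lemma XtE (a : 'I_m) : X^T *m delta_mx (idx (2 * a)) (0 : 'I_1) = delta_mx a 0.
Proof. by rewrite -XE mulmxA XX mul1mx. Qed.
Lemma YtE (a : 'I_m) : Y^T *m delta_mx (idx (2 * a).+1) (0 : 'I_1) = delta_mx a 0.
Proof. by rewrite -YE mulmxA YY mul1mx. Qed.
Lemma XtE' (a : 'I_m) : X^T *m delta_mx (idx (2 * a).+1) (0 : 'I_1) = 0.
Proof. by rewrite -YE mulmxA XY mul0mx. Qed.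
Lemma YtE' (a : 'I_m) : Y^T *m delta_mx (idx (2 * a)) (0 : 'I_1) = 0.
Proof. by rewrite -XE mulmxA YX mul0mx. Qed.

Lemma delta_Xt (b : 'I_m) : delta_mx (0 : 'I_1) b *m X^T = delta_mx 0 (idx (2 * b)).
Proof. by apply: trmx_inj; rewrite trmx_mul trmxK !trmx_delta XE. Qed.

Lemma delta_Yt (b : 'I_m) : delta_mx (0 : 'I_1) b *m Y^T = delta_mx 0 (idx (2 * b).+1).
Proof. by apply: trmx_inj; rewrite trmx_mul trmxK !trmx_delta YE. Qed.

Lemma delta_XY (a b : 'I_m) : X *m delta_mx a b *m Y^T =
  delta_mx (idx (2 * a)) (idx (2 * b).+1).
Proof.
by rewrite -(mul_delta_mx (0 : 'I_1)) mulmxA XE -mulmxA delta_Yt mul_delta_mx.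
Qed.

Lemma delta_XX (a b : 'I_m) : X *m delta_mx a b *m X^T =
  delta_mx (idx (2 * a)) (idx (2 * b)).
Proof.
by rewrite -(mul_delta_mx (0 : 'I_1)) mulmxA XE -mulmxA delta_Xt mul_delta_mx.
Qed.

Lemma delta_YY (a b : 'I_m) : Y *m delta_mx a b *m Y^T =
  delta_mx (idx (2 * a).+1) (idx (2 * b).+1).
Proof.
by rewrite -(mul_delta_mx (0 : 'I_1)) mulmxA YE -mulmxA delta_Yt mul_delta_mx.
Qed.

Lemma rowu_delta j b c : rowu j (c *: delta_mx 0 b) = 1%:M + c *: delta_mx (idx j) b.
Proof. by rewrite /rowu -scalemxAr mul_delta_mx. Qed.

Lemma dot_deltaZ b c (w : 'cV[k]_n) : ((c *: delta_mx (0 : 'I_1) b : 'rV_n) *m w) 0 0 = c * w b 0.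
Proof. by rewrite -scalemxAl mxE -rowE mxE. Qed.

Lemma supp_delta j (b : 'I_n) c : (j < b)%N -> supp j (c *: delta_mx 0 b).
Proof.
move=> jb; apply/suppP => b' b'j; rewrite !mxE (_ : (b' == b) = false) ?mulr0 //.
by apply/negbTE; rewrite neq_ltn (leq_ltn_trans b'j jb).
Qed.

Lemma idx_inj i j : (i < n)%N -> (j < n)%N -> (idx i == idx j) = (i == j).
Proof. by move=> lin ljn; rewrite -val_eqE /= !idxE. Qed.

Lemma entry_X (u : 'cV[k]_n) (a : 'I_m) : u (idx (2 * a)) 0 = (X^T *m u) a 0.
Proof.
have : delta_mx (0 : 'I_1) a *m (X^T *m u) = delta_mx 0 (idx (2 * a)) *m u.
  by rewrite mulmxA delta_Xt.
by rewrite -!rowE => /matrixP/(_ 0 0); rewrite [LHS]mxE [RHS]mxE.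
Qed.

Lemma entry_Y (u : 'cV[k]_n) (a : 'I_m) : u (idx (2 * a).+1) 0 = (Y^T *m u) a 0.
Proof.
have : delta_mx (0 : 'I_1) a *m (Y^T *m u) = delta_mx 0 (idx (2 * a).+1) *m u.
  by rewrite mulmxA delta_Yt.
by rewrite -!rowE => /matrixP/(_ 0 0); rewrite [LHS]mxE [RHS]mxE.
Qed.

Lemma XY_eq (u w : 'cV[k]_n) : X^T *m u = X^T *m w -> Y^T *m u = Y^T *m w -> u = w.
Proof.
move=> ux uy; apply/colP => b.
by case: (idx_cases b) => -[a ->]; rewrite ?entry_X ?entry_Y ?ux ?uy.
Qed.

Lemma trace_delta (a b : 'I_m) : \tr (delta_mx a b : 'M[k]_m) = (a == b)%:R.
Proof.
rewrite -(mul_delta_mx (0 : 'I_1)) mxtrace_mulC mul_delta_mx_cond raddfMn /= trace_mx11.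
by rewrite mxE eq_sym.
Qed.

Lemma XYsum : X *m X^T + Y *m Y^T = 1%:M.
Proof.
have H (u : 'cV[k]_n) : (X *m X^T + Y *m Y^T) *m u = u.
  apply: XY_eq; rewrite mulmxDl mulmxDr !mulmxA ?XX ?YY ?XY ?YX !mul0mx ?mul1mx.
    by rewrite addr0.
  by rewrite add0r.
apply/matrixP => a b; have := H (delta_mx b 0).
by rewrite -colE => /colP/(_ a); rewrite !mxE eqxx andbT.
Qed.

(* A vector w supported beyond the x_i-th coordinate at which the j-th
   character can occur has y-coordinates 1 at i and 0 elsewhere. *)
Lemma shalika_even lam (i : 'I_m) : shalika_fun lam ->
  lam *m whit (2 * i).+1 = 0 -> lam *m whit (2 * i) = 0.
Proof.
move=> [hQ hP] l0; have lin := lty i; have lin' := ltnW lin; set j := (2 * i)%N in l0 lin lin' *.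
rewrite -[whit j]mul1mx -(sum_four lin') mulmx_suml mulmx_sumr big1 // => w sw.
have [//|nz] := eqVneq (lam *m (four j w *m whit j)) 0.
have wy (a : 'I_m) : (i <= a)%N -> w (idx (2 * a).+1) 0 = (a == i)%:R.
  move=> ia; apply: psi_eq => c.
  have sa : supp j (c *: delta_mx 0 (idx (2 * a).+1)).
    by apply: supp_delta; rewrite idxE ?lty // ltnS leq_mul2l.
  have e1 := @four_l j _ w lin' sa.
  have := hQ (c *: delta_mx i a).
  rewrite -scalemxAr -scalemxAl delta_XY -rowu_delta => e2.
  have := fun_eigen _ e2 nz; rewrite [_ *m (four _ _ *m _)]mulmxA e1 -scalemxAl.
  move=> /(_ _ erefl).
  rewrite dot_deltaZ => ->; congr psi.
  by rewrite mxtraceZ trace_delta eq_sym.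
(* h = 1 + X Q Y^T adds to y_i the x-coordinates of w beyond i, which carries y_i to w. Only places
   (a, i) with a > i are filled, so the trace is 0 and h fixes lam. *)
pose Q : 'M[k]_m := \matrix_(a, b) (((i < a)%N && (b == i))%:R * w (idx (2 * a)) 0).
have trQ : \tr Q = 0.
  rewrite /mxtrace big1 // => a _; rewrite mxE.
  by case: eqVneq => [->|_]; rewrite ?ltnn ?andbF mul0r.
pose h := 1%:M + X *m Q *m Y^T.
have Lh : lev j h.
  split.
    apply: unitmx_1D.
    by rewrite !mulmxA -(mulmxA _ Y^T X) YX mulmx0 !mul0mx.
  move=> b bj; rewrite mulmxDl mul1mx -!mulmxA; case: (idx_cases b) bj => -[a ->].
    by rewrite YtE' !mulmx0 addr0.
  rewrite idxE ?lty // => aj; rewrite YtE -colE.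
  have -> : col a Q = 0.
    apply/matrixP => x y; rewrite !mxE (_ : (a == i) = false) ?andbF ?mul0r //.
    by apply/negbTE; rewrite neq_ltn; move: aj; rewrite /j ltn_mul2l => /andP[_ ->].
  by rewrite mulmx0 addr0.
have w0 (b : 'I_n) : (b <= j)%N -> w b 0 = 0.
  by move=> bj; have /suppP/(_ b bj) := sw; rewrite mxE.
have hw : h *m delta_mx (idx j.+1) 0 = w.
  rewrite mulmxDl mul1mx -!mulmxA YtE; apply: XY_eq; rewrite mulmxDr.
    rewrite XtE' add0r mulmxA XX mul1mx -colE; apply/colP => a.
    rewrite -entry_X !mxE eqxx andbT; case: ltnP => ai; first by rewrite mul1r.
    by rewrite mul0r w0 // idxE ?ltx // leq_mul2l.
  rewrite YtE mulmxA YX mul0mx addr0; apply/colP => a.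
  rewrite -entry_Y !mxE eqxx andbT; case: (leqP i a) => ai; first by rewrite wy.
  have -> : (a == i) = false by apply/negbTE; rewrite neq_ltn ai.
  by rewrite w0 // idxE ?lty // /j ltn_mul2l.
rewrite -hw; apply: (@fun_lev j h 1) => //.
by rewrite hQ trQ psi0.
Qed.

(** The transvection 1 + c e_(i,a), acting diagonally, is a product of elements of rows 2i and 2i+1
    on which zeta is trivial; this kills the y-coordinates of any w that occurs. Such a w is nonzero
    by cuspidality, and some P in GL_m moves x_(i+1) to it while fixing the earlier vectors. *)
Lemma shalika_odd lam (i : 'I_m) : (i.+1 < m)%N -> shalika_fun lam ->
  lam *m whit (2 * i).+2 = 0 -> lam *m whit (2 * i).+1 = 0.
Proof.
move=> im [hQ hP] l0; set i1 := Ordinal im.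
have jn : ((2 * i).+2 < n)%N by have := ltx i1; rewrite /= mulnS.
have j1E : (2 * i).+2 = (2 * i1)%N by rewrite /= mulnS.
set j := (2 * i).+1 in l0 jn j1E *; have jn' := ltnW jn.
rewrite -[whit j]mul1mx -(sum_four jn') mulmx_suml mulmx_sumr big1 // => w sw.
have [//|nz] := eqVneq (lam *m (four j w *m whit j)) 0.
have w0 (b : 'I_n) : (b <= j)%N -> w b 0 = 0.
  by move=> bj; have /suppP/(_ b bj) := sw; rewrite mxE.
have wy (a : 'I_m) : w (idx (2 * a).+1) 0 = 0.
  have [ai|ia] := leqP a i; first by rewrite w0 // idxE ?lty // ltnS leq_mul2l.
  apply: psi_eq => c; rewrite mulr0 psi0.
  have sy : supp j (c *: delta_mx 0 (idx (2 * a).+1)).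
    by apply: supp_delta; rewrite idxE ?lty // ltnS ltn_mul2l.
  have sx : supp (2 * i) (c *: delta_mx 0 (idx (2 * a))).
    by apply: supp_delta; rewrite idxE ?ltx // ltn_mul2l.
  have ji : (2 * i < n)%N by exact: ltx.
  have j2a : (j < 2 * a)%N by rewrite j1E leq_mul2l.
  pose g := rowu (2 * i) (c *: delta_mx 0 (idx (2 * a))) *m
            rowu j (c *: delta_mx 0 (idx (2 * a).+1)).
  have gE : g = X *m (1%:M + c *: delta_mx i a) *m X^T +
      Y *m (1%:M + c *: delta_mx i a) *m Y^T.
    rewrite /g !rowu_delta !mulmxDr !mulmx1 !mulmxDl -!scalemxAr -!scalemxAl.
    rewrite delta_XX delta_YY [RHS]addrACA XYsum !mul1mx mul_delta_mx_cond.
    rewrite idx_inj ?ltx // (_ : (2 * a == j)%N = false) ?mulr0n ?scaler0 ?addr0 -?addrA //.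
    by apply/negbTE; rewrite neq_ltn j2a orbT.
  have e2 : lam *m R g = 1 *: lam.
    rewrite gE hP ?zeta_transv //; apply: unitmx_1D.
    rewrite -scalemxAl -scalemxAr mul_delta_mx_cond (_ : (a == i) = false) ?mulr0n ?scaler0 //.
    by apply/negbTE; rewrite neq_ltn ia orbT.
  have e1 : R g *m (four j w *m whit j) = psi (c * w (idx (2 * a).+1) 0) *: (four j w *m whit j).
    rewrite /g RM ?rowu_unit // -mulmxA [X in _ *m X]mulmxA four_l // -scalemxAl -scalemxAr.
    rewrite four_whit_l ?leqnn // scalerA dot_deltaZ.
    have /suppP -> : supp j (c *: delta_mx 0 (idx (2 * a))).
      by apply: supp_delta; rewrite idxE ?ltx.
      by rewrite psi0 mulr1.
    by rewrite idxE.
  have := fun_eigen e1 e2 nz.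
  by [].
have w_neq0 : w != 0.
  apply: contraNneq nz => ->; rewrite four0_whit ?mulmx0 //.
pose wx : 'cV[k]_m := X^T *m w.
have [b bi||P [uP Pw Pb]] := @trans_unitmx _ _ i1 wx.
- by rewrite -entry_X w0 // idxE ?ltx // (leq_trans _ (leqnSn _)) // leq_mul2l.
- apply: contra_neq w_neq0 => wx0; apply: XY_eq; rewrite mulmx0 //.
  by apply/colP => a; rewrite -entry_Y wy mxE.
pose h := X *m P *m X^T + Y *m P *m Y^T.
have Lh : lev j h.
  split.
    have : h *m (X *m invmx P *m X^T + Y *m invmx P *m Y^T) = 1%:M.
      rewrite /h mulmxDl !mulmxDr !mulmxA -!(mulmxA _ X^T) -!(mulmxA _ Y^T) XX YY XY YX.
      by rewrite !mulmx0 !mul0mx !mulmx1 !mulmxK // addr0 add0r XYsum.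
    by case/mulmx1_unit.
  move=> b bj; rewrite /h mulmxDl -!mulmxA; case: (idx_cases b) bj => -[a ->].
    rewrite idxE ?ltx // XtE YtE' !mulmx0 addr0 => aj.
    rewrite Pb ?XE // ltnS leqNgt; apply: contraL aj => ia.
    by rewrite -ltnNge j1E leq_mul2l.
  rewrite idxE ?lty // YtE XtE' !mulmx0 add0r => aj.
  by rewrite Pb ?YE //; move: aj; rewrite ltnS leq_mul2l.
have hw : h *m delta_mx (idx j.+1) 0 = w.
  rewrite j1E /h mulmxDl -!mulmxA XtE YtE' !mulmx0 addr0 Pw.
  apply: XY_eq; rewrite mulmxA ?XX ?mul1mx // YX mul0mx.
  by apply/colP => a; rewrite -entry_Y wy mxE.
rewrite -hw; apply: (@fun_lev j h (zeta P)) => //; exact: hP.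
Qed.

Lemma shalika_whit lam : shalika_fun lam -> lam *m whit n.-1 = 0 -> lam = 0.
Proof.
have n0 : (0 < n)%N by rewrite nE addn_gt0 m0.
move=> S l0; suff key j t : (t + j = n.-1)%N -> lam *m whit t = 0.
  by rewrite -(key n.-1 0) ?mulmx1.
elim: j t => [|j IH] t; first by rewrite addn0 => ->.
  rewrite -addSnnS => tj; have := IH _ tj.
  have tn : (t.+1 < n)%N by rewrite -(prednK n0) ltnS -tj leq_addr.
  have dm : (2 * m = n)%N by rewrite nE addnn mul2n.
  have := odd_double_half t; case: (odd t) => tE.
    have e : t = (2 * t./2).+1 by rewrite mul2n -[LHS]tE.
    have im : (t./2.+1 < m)%N.
      by rewrite -(ltn_pmul2l (ltn0Sn 1)) dm mulnS add2n -e.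
    by rewrite e; exact: (@shalika_odd lam (Ordinal (ltnW im)) im S).
  have e : t = (2 * t./2)%N by rewrite mul2n -[LHS]tE.
  have im : (t./2 < m)%N by rewrite -(ltn_pmul2l (ltn0Sn 1)) dm -e ltnW.
  by rewrite e; exact: (@shalika_even lam (Ordinal im) S).
Qed.

Theorem shalika_mult_one : d%:R = \prod_(1 <= i < n) ((#|k| ^ i)%N%:R - 1) :> C ->
  exists r : 'rV[C]_d, forall lam, shalika_fun lam -> exists c, lam = c *: r.
Proof.
move=> hd; have n0 : (0 < n)%N by rewrite nE addn_gt0 m0.
have [[r [Sr r0]]|none] := pselect (exists r, shalika_fun r /\ r != 0); last first.
  exists 0 => lam Sl; exists 0; rewrite scale0r; apply/eqP/negPn/negP => l0.
  by apply: none; exists lam.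
have rW : r *m whit n.-1 != 0 by apply: contra_neq r0; exact: shalika_whit.
exists r => lam Sl; have [c cE] := whit_fun_rank1 lam n0 hd rW; exists c.
apply/eqP; rewrite -subr_eq0; apply/eqP/shalika_whit.
  case: Sl Sr => [l1 l2] [r1 r2]; split=> A => [|uA].
    by rewrite mulmxBl l1 -scalemxAl r1 scalerBr !scalerA mulrC.
  by rewrite mulmxBl l2 // -scalemxAl r2 // scalerBr !scalerA mulrC.
by rewrite mulmxBl -scalemxAl cE subrr.
Qed.

End Shalika.

End Whittaker.

(** * Matrices over a local field *)

Section LocalMatrices.
Variables (K : fieldType) (vK : localField K).
Local Notation O := (integers vK).
Local Notation v := (lval vK).

Lemma lvalN x : x != 0 -> v (- x) = v x.
Proof.
move=> x0; have n10 : (-1 : K) != 0 by rewrite oppr_eq0 oner_eq0.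
have e : v (-1) + v (-1) = 0 by rewrite -lvalM // mulrNN mulr1 lval1.
have v1 : v (-1) = 0 by lia.
by rewrite -mulN1r lvalM // v1 add0r.
Qed.

Lemma lvalV x : x != 0 -> v x^-1 = - v x.
Proof.
move=> x0; have := lvalM vK x0 (invr_neq0 x0); rewrite mulfV // lval1; lia.
Qed.

Lemma lvalXz x (i : int) : x != 0 -> v (x ^ i) = i * v x.
Proof.
move=> x0; have nat_case (k : nat) : v (x ^+ k) = k%:Z * v x.
  elim: k => [|k IH]; first by rewrite expr0 lval1 mul0r.
  by rewrite exprS lvalM ?expf_neq0 // IH -addn1 PoszD mulrDl mul1r addrC.
case: i => k; first exact: nat_case.
by rewrite NegzE -exprnN lvalV ?expf_neq0 // nat_case mulNr.
Qed.

Lemma ideal_nz N x : x != 0 -> (x \in ideal vK N) = (N <= v x).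
Proof. by move=> x0; rewrite inE (negPf x0). Qed.

Lemma idealN N x : (- x \in ideal vK N) = (x \in ideal vK N).
Proof.
have [->|x0] := eqVneq x 0; first by rewrite oppr0.
by rewrite !ideal_nz ?oppr_eq0 // lvalN.
Qed.

Lemma integers_subring : subring_closed O.
Proof.
split=> [|x y Ox Oy|x y Ox Oy]; first exact: integers1.
  by apply: idealD => //; rewrite idealN.
by have := idealM Ox Oy; rewrite addr0.
Qed.

HB.instance Definition _ :=
  GRing.isSubringClosed.Build K (integers vK) integers_subring.

Lemma int0 : 0 \in O. Proof. exact: (@rpred0 _ (integers vK)). Qed.
Lemma int1 : 1 \in O. Proof. exact: (@rpred1 _ (integers vK)). Qed.
Lemma intN x : x \in O -> - x \in O.
Proof. by rewrite (@rpredN _ (integers vK)). Qed.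
Lemma intD x y : x \in O -> y \in O -> x + y \in O.
Proof. exact: (@rpredD _ (integers vK)). Qed.
Lemma intB x y : x \in O -> y \in O -> x - y \in O.
Proof. exact: (@rpredB _ (integers vK)). Qed.
Lemma intMul x y : x \in O -> y \in O -> x * y \in O.
Proof. exact: (@rpredM _ (integers vK)). Qed.
Lemma intX x i : x \in O -> x ^+ i \in O.
Proof. exact: (@rpredX _ (integers vK)). Qed.
Lemma int_sum (I : Type) (r : seq I) (P : pred I) (G : I -> K) :
  (forall i, P i -> G i \in O) -> \sum_(i <- r | P i) G i \in O.
Proof. exact: (@rpred_sum _ (integers vK)). Qed.
Lemma int_prod (I : Type) (r : seq I) (P : pred I) (G : I -> K) :
  (forall i, P i -> G i \in O) -> \prod_(i <- r | P i) G i \in O.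
Proof. exact: (@rpred_prod _ (integers vK)). Qed.

Lemma idealMl N x y : x \in O -> y \in ideal vK N -> x * y \in ideal vK N.
Proof. by move=> Ox Iy; have := idealM Ox Iy; rewrite add0r. Qed.

Lemma redN x : x \in O -> red vK (- x) = - red vK x.
Proof.
move=> Ox; have ON := intN Ox.
apply: (addrI (red vK x)); rewrite -(redD Ox ON) !subrr.
exact: red0.
Qed.

Lemma redB x y : x \in O -> y \in O -> red vK (x - y) = red vK x - red vK y.
Proof. by move=> Ox Oy; rewrite redD ?redN // intN. Qed.

Lemma red_ideal1 x : x \in ideal vK 1 -> red vK x = 0.
Proof.
by move=> Px; apply/eqP; rewrite red_eq0 //; apply: ideal_le Px.
Qed.

Lemma red_eq x y : x \in O -> y \in O -> (red vK x == red vK y) = (x - y \in ideal vK 1).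
Proof.
by move=> Ox Oy; rewrite -subr_eq0 -redB // red_eq0 // intB.
Qed.

Lemma red_unit x : x \in O -> red vK x != 0 -> x != 0 /\ v x = 0.
Proof.
move=> Ox; rewrite red_eq0 // => nP; have x0 : x != 0.
  by apply: contraNneq nP => ->; exact: ideal0.
by move: nP Ox; rewrite !ideal_nz //; split=> //; lia.
Qed.

Lemma integersV x : x \in O -> red vK x != 0 -> x^-1 \in O.
Proof.
move=> Ox /(red_unit Ox)[x0 vx]; rewrite ideal_nz ?invr_eq0 //.
by rewrite lvalV // vx.
Qed.

Lemma red_V x : x \in O -> red vK x != 0 -> red vK x^-1 = (red vK x)^-1.
Proof.
move=> Ox rx; have [x0 _] := red_unit Ox rx.
by apply: (mulfI rx); rewrite -redM ?integersV // !mulfV // red1.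
Qed.

Lemma red_prod (I : Type) (r : seq I) (P : pred I) (G : I -> K) :
  (forall i, G i \in O) ->
  red vK (\prod_(i <- r | P i) G i) = \prod_(i <- r | P i) red vK (G i).
Proof.
move=> h; elim: r => [|i r IH]; first by rewrite !big_nil red1.
rewrite !big_cons; case: (P i) => //; rewrite redM ?IH //.
by rewrite int_prod.
Qed.

Lemma lift_int (a : resField vK) : lift a \in O.
Proof. by case: (liftP a). Qed.

Lemma red_lift (a : resField vK) : red vK (lift a) = a.
Proof. by case: (liftP a). Qed.

Definition intmx p q (A : 'M[K]_(p, q)) := forall i j, A i j \in O.
Definition redmx p q (A : 'M[K]_(p, q)) := map_mx (red vK) A.
Definition liftmx p q (A : 'M[resField vK]_(p, q)) : 'M[K]_(p, q) := map_mx (@lift K vK) A.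

Lemma intmx_lift p q (A : 'M_(p, q)) : intmx (liftmx A).
Proof. by move=> i j; rewrite mxE lift_int. Qed.

Lemma redmx_lift p q (A : 'M_(p, q)) : redmx (liftmx A) = A.
Proof. by apply/matrixP => i j; rewrite !mxE red_lift. Qed.

Lemma intmxM p q r (A : 'M_(p, q)) (B : 'M_(q, r)) : intmx A -> intmx B -> intmx (A *m B).
Proof. by move=> hA hB i j; rewrite mxE int_sum // => l _; rewrite intMul. Qed.

Lemma intmxD p q (A B : 'M_(p, q)) : intmx A -> intmx B -> intmx (A + B).
Proof. by move=> hA hB i j; rewrite mxE intD. Qed.

Lemma intmxN p q (A : 'M_(p, q)) : intmx A -> intmx (- A).
Proof. by move=> hA i j; rewrite mxE intN. Qed.

Lemma intmxZ p q c (A : 'M_(p, q)) : c \in O -> intmx A -> intmx (c *: A).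
Proof. by move=> hc hA i j; rewrite mxE intMul. Qed.

Lemma intmx0 p q : intmx (0 : 'M_(p, q)).
Proof. by move=> i j; rewrite mxE int0. Qed.

Lemma intmx1 p : intmx (1%:M : 'M_p).
Proof. by move=> i j; rewrite mxE; case: (_ == _); [exact: int1 | exact: int0]. Qed.

Lemma intmx_delta p q i j : intmx (delta_mx i j : 'M_(p, q)).
Proof. by move=> x y; rewrite mxE; case: (_ && _); [exact: int1 | exact: int0]. Qed.

Lemma redmxM p q r (A : 'M_(p, q)) (B : 'M_(q, r)) : intmx A -> intmx B ->
  redmx (A *m B) = redmx A *m redmx B.
Proof.
move=> hA hB; apply/matrixP => i j; rewrite !mxE red_sum => [|l].
  by apply: eq_bigr => l _; rewrite redM ?mxE.
by rewrite intMul.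
Qed.

Lemma redmxD p q (A B : 'M_(p, q)) : intmx A -> intmx B ->
  redmx (A + B) = redmx A + redmx B.
Proof. by move=> hA hB; apply/matrixP => i j; rewrite !mxE redD. Qed.

Lemma redmxN p q (A : 'M_(p, q)) : intmx A -> redmx (- A) = - redmx A.
Proof. by move=> hA; apply/matrixP => i j; rewrite !mxE redN. Qed.

Lemma redmxZ p q c (A : 'M_(p, q)) : c \in O -> intmx A ->
  redmx (c *: A) = red vK c *: redmx A.
Proof. by move=> hc hA; apply/matrixP => i j; rewrite !mxE redM. Qed.

Lemma redmx0 p q : redmx (0 : 'M_(p, q)) = 0.
Proof. by apply/matrixP => i j; rewrite !mxE red0. Qed.

Lemma redmx1 p : redmx (1%:M : 'M_p) = 1%:M.
Proof. exact: red_mx1. Qed.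

Lemma det_int p (A : 'M_p) : intmx A -> \det A \in O.
Proof.
move=> hA; rewrite int_sum // => s _; rewrite intMul ?int_prod //.
exact/intX/intN/int1.
Qed.

Lemma red_det p (A : 'M_p) : intmx A -> red vK (\det A) = \det (redmx A).
Proof.
move=> hA; have hs (s : 'S_p) : (-1) ^+ s \in O by exact/intX/intN/int1.
have hp (s : 'S_p) : \prod_i A i (s i) \in O by rewrite int_prod.
rewrite /determinant red_sum => [|s]; last by rewrite intMul.
apply: eq_bigr => s _; rewrite redM // red_prod //; congr (_ * _).
  by case: (odd_perm s); rewrite ?expr0 ?red1 // expr1 redN ?red1 //; exact: int1.
by apply: eq_bigr => i _; rewrite mxE.
Qed.

Lemma intmx_unit p (A : 'M_p) : intmx A -> redmx A \in unitmx ->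
  A \in unitmx /\ intmx (invmx A).
Proof.
move=> hA; rewrite unitmxE unitfE -red_det // => rd.
have [d0 _] := red_unit (det_int hA) rd.
have uA : A \in unitmx by rewrite unitmxE unitfE.
split=> // i j; rewrite /invmx uA mxE intMul ?integersV ?det_int //.
rewrite mxE intMul //; first exact/intX/intN/int1.
by apply: det_int => x y; rewrite !mxE.
Qed.

Lemma intmx_GL p (A : 'M_p) : intmx A -> redmx A \in unitmx ->
  GLint vK (mkGL A) /\ redGL vK (mkGL A) = mkGL (redmx A).
Proof.
move=> hA rA; have [uA hV] := intmx_unit hA rA.
have hG : GLint vK (mkGL A).
  move=> i j; split; first by rewrite mkGLE.
  by rewrite -[GLval (mkGL A)^-1%g]/(invmx (mkGL A)) mkGLE.
by split=> //; apply: val_inj; rewrite /= redGLE // !mkGLE.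
Qed.

End LocalMatrices.

(** * The embedding of GL_m(E) *)

Section Embedding.
Variables (F : fieldType) (E : fieldExtType F) (m : nat) (delta : E).
Hypothesis dimE : \dim {:E} = 2%N.
Hypothesis deltaNF : delta \notin 1%VS.
Variable c : F.
Hypothesis delta2 : delta ^+ 2 = c%:A.
Local Notation emb := (@embedMx F E m delta).
Local Notation "A ^E" := (map_mx (in_alg E) A) (at level 8, format "A ^E").

Definition pairmx p q (t : E) (P Q : 'M[F]_(p, q)) : 'M[E]_(p, q) := P^E + t *: Q^E.

Lemma pairmxE p q (t : E) (P Q : 'M[F]_(p, q)) i j :
  pairmx t P Q i j = (P i j)%:A + t * (Q i j)%:A.
Proof. by rewrite !mxE. Qed.

(* the F-linear map of multiplication by P + t Q, for t ^+ 2 = c' *)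
Definition quadmx (c' : F) (P Q : 'M[F]_m) : 'M[F]_(m + m) :=
  block_mx P Q (c' *: Q) P.

Lemma coord_delta : [/\ coord (quadBasis delta) 0 delta = 1, coord (quadBasis delta) 1 delta = 0,
  coord (quadBasis delta) 0 1 = 0 & coord (quadBasis delta) 1 1 = 1].
Proof.
have f := quadBasis_free deltaNF.
have h00 := coord_free (0 : 'I_2) (0 : 'I_2) f.
have h01 := coord_free (0 : 'I_2) (1 : 'I_2) f.
have h10 := coord_free (1 : 'I_2) (0 : 'I_2) f.
have h11 := coord_free (1 : 'I_2) (1 : 'I_2) f.
by split; [exact: h00|exact: h01|exact: h10|exact: h11].
Qed.

Lemma coord_pair (x y : F) : coord (quadBasis delta) 0 (x%:A * delta + y%:A) = x /\
  coord (quadBasis delta) 1 (x%:A * delta + y%:A) = y.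
Proof.
have [h1 h2 h3 h4] := coord_delta.
rewrite !mulr_algl !raddfD /= !linearZ /= h1 h2 h3 h4.
by rewrite !(mulr0, mulr1, addr0, add0r).
Qed.

Lemma vecCoord_pair (x y : 'cV[F]_m) :
  vecCoord delta (pairmx delta y x) = col_mx x y.
Proof.
apply/colP => i; rewrite !mxE; case: fintype.split => j; rewrite !mxE.
  by rewrite addrC mulrC; case: (coord_pair (x j 0) (y j 0)).
by rewrite addrC mulrC; case: (coord_pair (x j 0) (y j 0)).
Qed.

Lemma pairmxM p q r (t : E) c' (P Q : 'M_(p, q)) (P' Q' : 'M_(q, r)) : t ^+ 2 = c'%:A ->
  pairmx t P Q *m pairmx t P' Q' = pairmx t (P *m P' + c' *: (Q *m Q')) (P *m Q' + Q *m P').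
Proof.
move=> tt; rewrite /pairmx !(map_mxD, map_mxM, map_mxZ) /= mulmxDl !mulmxDr.
rewrite -!scalemxAr -!scalemxAl scalerA -expr2 tt.
move: (P^E *m P'^E) (P^E *m Q'^E) (Q^E *m P'^E) (Q^E *m Q'^E) => a b a' b'.
by apply/matrixP => i j; rewrite !mxE; ring.
Qed.

Lemma embedMx_pair P Q : emb (pairmx delta P Q) = quadmx c P Q.
Proof.
apply/matrixP => i j; rewrite mxE.
have := vecCoord_basis (m := m) deltaNF j.
rewrite -[delta_mx j 0](@vsubmxK _ m m) -vecCoord_pair.
move/(vecCoord_inj dimE deltaNF) => ->.
rewrite (pairmxM _ _ _ _ delta2) vecCoord_pair.
set x := usubmx _; set y := dsubmx _.
have -> : quadmx c P Q i j = (quadmx c P Q *m delta_mx j (0 : 'I_1)) i 0.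
  by rewrite -colE [RHS]mxE.
rewrite -[delta_mx j 0](@vsubmxK _ m m) -/x -/y mul_block_col.
by rewrite -scalemxAl (addrC (P *m y)).
Qed.

Lemma quadmx_cent c' (M : 'M[F]_(m + m)) :
  M *m quadmx c' 0 1%:M = quadmx c' 0 1%:M *m M ->
  exists P Q, M = quadmx c' P Q.
Proof.
rewrite -[M]submxK /quadmx !mulmx_block !(mul0mx, mulmx0, mulmx1, mul1mx, add0r, addr0).
move/eq_block_mx => [e1 e2 e3 e4].
exists (ulsubmx M), (ursubmx M); congr block_mx => //.
by move: e1; rewrite -scalemxAr mulmx1.
Qed.

Lemma quadmx1 c' : quadmx c' 1%:M 0 = 1%:M.
Proof. by rewrite /quadmx scaler0 -scalar_mx_block. Qed.

Lemma quadmxM c' P Q P' Q' : quadmx c' P Q *m quadmx c' P' Q' =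
  quadmx c' (P *m P' + c' *: (Q *m Q')) (P *m Q' + Q *m P').
Proof.
rewrite /quadmx mulmx_block -!scalemxAl -!scalemxAr; congr block_mx.
  by rewrite scalerDr addrC.
by rewrite addrC.
Qed.

Lemma quadmxC c' P Q : quadmx c' P Q *m quadmx c' 0 1%:M = quadmx c' 0 1%:M *m quadmx c' P Q.
Proof. by rewrite !quadmxM !(mul0mx, mulmx0, mulmx1, mul1mx, add0r, addr0). Qed.

(** The inverse over F commutes with the matrix of delta, so it is again of the form [quadmx] and
    yields an inverse over E. *)
Lemma pairmx_unit P Q : quadmx c P Q \in unitmx -> pairmx delta P Q \in unitmx.
Proof.
move=> uM; have : invmx (quadmx c P Q) *m quadmx c 0 1%:M =
    quadmx c 0 1%:M *m invmx (quadmx c P Q).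
  apply: (can_inj (mulKmx uM)); apply: (can_inj (mulmxK uM)).
  by rewrite mulKVmx // !mulmxA mulmxKV // quadmxC.
case/quadmx_cent=> P' [Q' e]; have := mulmxV uM; rewrite e quadmxM -(quadmx1 c).
move/eq_block_mx=> [e1 e2 _ _].
have : pairmx delta P Q *m pairmx delta P' Q' = 1%:M.
  rewrite (pairmxM _ _ _ _ delta2) e1 e2 /pairmx map_mx1 map_mx0 scaler0 addr0.
  by [].
by case/mulmx1_unit.
Qed.

Lemma embedGL_pair P Q : quadmx c P Q \in unitmx ->
  embedGL dimE deltaNF (mkGL (pairmx delta P Q)) = quadmx c P Q :> 'M_(m + m).
Proof. by move=> uM; rewrite /= mkGLE ?pairmx_unit // embedMx_pair. Qed.

Lemma pairmx_scale p q (t : F) (P Q : 'M[F]_(p, q)) (e : E) :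
  pairmx (t%:A * e) P Q = pairmx e P (t *: Q).
Proof.
by rewrite /pairmx map_mxZ scalerA [in RHS]mulrC.
Qed.

End Embedding.

(** * Determinants over F expressed through determinants over E *)

Lemma quadmx_mul_conj (K : comUnitRingType) m (e : K) (P Q : 'M[K]_m) :
  block_mx P Q (e ^+ 2 *: Q) P *m block_mx 1%:M 1%:M e%:M (- e%:M) =
  block_mx 1%:M 1%:M e%:M (- e%:M) *m block_mx (P + e *: Q) 0 0 (P - e *: Q).
Proof.
rewrite !mulmx_block !(mulmx0, mul1mx, mulmx1, addr0, add0r, mulmxN, mulNmx).
rewrite !mul_mx_scalar !mul_scalar_mx.
by congr block_mx; apply/matrixP => i j; rewrite !mxE; ring.
Qed.

(** The block columns of the conjugating matrix span the eigenspaces, for e and -e, of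
    multiplication by the square root; an anticommuting map exchanges them. *)
Lemma quadmx_anti_conj (K : comUnitRingType) m (e : K) (A B : 'M[K]_m) :
  block_mx A B (- (e ^+ 2 *: B)) (- A) *m block_mx 1%:M 1%:M e%:M (- e%:M) =
  block_mx 1%:M 1%:M e%:M (- e%:M) *m block_mx 0 (A - e *: B) (A + e *: B) 0.
Proof.
rewrite !mulmx_block !(mulmx0, mul1mx, mulmx1, addr0, add0r, mulmxN, mulNmx, opprK).
rewrite !mul_mx_scalar !mul_scalar_mx.
by congr block_mx; apply/matrixP => i j; rewrite !mxE; ring.
Qed.

Lemma det_conj_block (K : idomainType) m (e : K) :
  2%:R != 0 :> K -> e != 0 -> \det (block_mx 1%:M 1%:M e%:M (- e%:M) : 'M[K]_(m + m)) != 0.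
Proof.
move=> two0 e0; have : (block_mx 1%:M 1%:M e%:M (- e%:M) : 'M[K]_(m + m)) *m
    block_mx e%:M 1%:M e%:M (- 1%:M) = (2%:R * e)%:M.
  rewrite mulmx_block !(mul1mx, mulmx1, mulmxN, mulNmx, subrr, opprK).
  have -> : e%:M + e%:M = (2%:R * e)%:M :> 'M[K]_m by rewrite -raddfD mulr_natl mulr2n.
  by rewrite -scalar_mx_block.
move/(congr1 determinant)/eqP; rewrite det_mulmx det_scalar; apply: contraTneq => ->.
by rewrite mul0r eq_sym expf_eq0 mulf_eq0 (negPf two0) (negPf e0) andbF.
Qed.

Lemma det_quadmx (K : idomainType) m (e : K) (P Q : 'M[K]_m) :
  2%:R != 0 :> K -> e != 0 ->
  \det (block_mx P Q (e ^+ 2 *: Q) P) = \det (P + e *: Q) * \det (P - e *: Q).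
Proof.
move=> two0 e0; apply: (mulIf (det_conj_block m two0 e0)).
by rewrite -det_mulmx quadmx_mul_conj det_mulmx det_ublock mulrC.
Qed.

(** Here (A - e B)(A + e B) is the square of the anticommuting map on one eigenspace, and block
    elimination leaves its determinant. This is the source of the hypothesis [nu_sq] of the Gelfand
    argument. *)
Lemma det_1D_anti (K : idomainType) m (e : K) (A B : 'M[K]_m) :
  2%:R != 0 :> K -> e != 0 ->
  \det (1%:M + block_mx A B (- (e ^+ 2 *: B)) (- A)) =
  \det (1%:M - (A - e *: B) *m (A + e *: B)).
Proof.
move=> two0 e0; apply: (mulIf (det_conj_block m two0 e0)).
rewrite -det_mulmx mulmxDl mul1mx quadmx_anti_conj -{1}[block_mx _ _ _ _]mulmx1 -mulmxDr.
rewrite det_mulmx mulrC; congr (_ * _).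
set X := A - _; set Y := A + _.
have e1 : block_mx 1%:M (- X) 0 1%:M *m (1%:M + block_mx 0 X Y 0) =
    block_mx (1%:M - X *m Y) 0 Y 1%:M.
  rewrite (@scalar_mx_block _ m m) add_block_mx mulmx_block.
  by rewrite !(mul1mx, mulmx1, mul0mx, mulmx0, addr0, add0r, mulNmx) subrr.
have := congr1 determinant e1; rewrite det_mulmx det_ublock det_lblock !det1 !mulr1 mul1r.
by [].
Qed.

Lemma det_1D_rank1 (K : fieldType) n (u : 'cV[K]_n) (z : 'rV[K]_n) :
  \det (1%:M + u *m z) = 1 + (z *m u) 0 0.
Proof.
have e1 : block_mx 1%:M (- z) u 1%:M *m block_mx 1%:M z 0 1%:M =
    block_mx 1%:M 0 u (1%:M + u *m z).
  by rewrite mulmx_block !(mul1mx, mulmx1, mul0mx, mulmx0, addr0, add0r) subrr addrC.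
have e2 : block_mx 1%:M z 0 1%:M *m block_mx 1%:M (- z) u 1%:M =
    block_mx (1%:M + z *m u) 0 u 1%:M.
  by rewrite mulmx_block !(mul1mx, mulmx1, mul0mx, mulmx0, addr0, add0r) addNr.
have := congr1 determinant e1; have := congr1 determinant e2.
rewrite !det_mulmx !det_ublock !det_lblock !det1 !mulr1 !mul1r => -> <-.
by rewrite det_mx11 mxE [_%:M _ _]mxE.
Qed.

(** * Functionals on the induced representation *)

Section HomLine.
Variables (C : fieldType) (G H : groupType) (V : lmodType C).
Variables (pi : representation G V) (emb : H -> G) (mu : H -> C).
Local Notation Hom := (HomSpace pi emb mu).

Lemma homE (l : Hom) : (forall a v w, l (a *: v + w) = a * l v + l w) /\
  (forall h v, l (pi (emb h) v) = mu h * l v).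
Proof. by have /asboolP := homP l. Qed.

Lemma hom_eq0 (l : Hom) : (forall v, l v = 0) -> l = 0.
Proof. by move=> h; apply/val_inj/funext => v; rewrite /= h. Qed.

Definition hom_eval (v : V) (l : Hom) : C^o := l v.

Lemma hom_eval_linear v : linear (hom_eval v).
Proof. by []. Qed.

HB.instance Definition _ v :=
  GRing.isLinear.Build C Hom C^o _ (hom_eval v) (hom_eval_linear v).

Lemma hom_line (l0 : Hom) v : l0 v != 0 -> (forall l : Hom, l v = 0 -> l = 0) ->
  exists phi : {linear Hom -> C^o}, bijective phi.
Proof.
move=> l0v h; exists (hom_eval v); exists (fun c : C^o => (c / l0 v : C) *: l0) => [l|c].
  apply/eqP; rewrite -subr_eq0; apply/eqP/h.
  rewrite -[LHS]/(hom_eval v _) linearB linearZ /= /hom_eval -[_ *: _]/(_ * _).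
  by rewrite mulfVK // subrr.
by rewrite linearZ -[LHS]/(_ * _) /hom_eval mulfVK.
Qed.

End HomLine.

(** * Functions supported on one coset K g, and the rows lam_g *)

Section LocalGL.
Variables (n : nat) (F : fieldType) (vF : localField F).
Local Notation G := (GL n F).
Implicit Types g h k : G.

Lemma GLint_mx k : GLint vF k <-> intmx vF k /\ intmx vF (invmx k).
Proof. by split=> [h|[h h'] i j]; first split=> i j; have [] := h i j. Qed.

Lemma GLintM k h : GLint vF k -> GLint vF h -> GLint vF (k * h)%g.
Proof.
move=> ik ih i j; split; first by apply: intmxM => x y; [case: (ik x y)|case: (ih x y)].
by rewrite invMg; apply: intmxM => x y; [case: (ih x y)|case: (ik x y)].
Qed.

Lemma GLintV k : GLint vF k -> GLint vF k^-1%g.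
Proof. by move=> ik i j; rewrite invgK; case: (ik i j). Qed.

Lemma redGLM k h : GLint vF k -> GLint vF h -> redGL vF (k * h)%g = (redGL vF k * redGL vF h)%g.
Proof.
move=> ik ih; have e := redGLE (GLintM ik ih); apply: val_inj.
rewrite /= e (redGLE ik) (redGLE ih) -[LHS]/(redmx vF (k *m h)).
by rewrite redmxM // => i j; [case: (ik i j)|case: (ih i j)].
Qed.

Lemma redGL_repm (C : numClosedFieldType) d (rho : mx_representation C [set: GL n (resField vF)] d) k :
  GLint vF k -> rho (redGL vF k) = repm rho (redmx vF (k : 'M_n)).
Proof. by move=> ik; rewrite /repm /redmx -redGLE // mkGL_val. Qed.

Lemma GLint_modcenter k : GLint vF k -> GLmodcenter vF k.
Proof. by move=> ik; exists 1, k; rewrite oner_neq0 scale1r. Qed.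

Lemma GLmodcenterM g h : GLmodcenter vF g -> GLmodcenter vF h -> GLmodcenter vF (g * h)%g.
Proof.
move=> [x [k [x0 ik gE]]] [y [k' [y0 ik' hE]]]; exists (x * y), (k * k')%g.
split; [by rewrite mulf_neq0|exact: GLintM|].
by rewrite -[LHS]/(g *m h) gE hE -scalemxAl -scalemxAr scalerA.
Qed.

Lemma GLmodcenterV g : GLmodcenter vF g -> GLmodcenter vF g^-1%g.
Proof.
move=> [x [k [x0 ik gE]]]; exists x^-1, k^-1%g; split; [by rewrite invr_eq0|exact: GLintV|].
by rewrite -[LHS]/(invmx g) gE invmxZ // -gE; case: g {gE}.
Qed.

Lemma GLcongr_int N u : (0 < N)%N -> GLcongr vF N u -> GLint vF u /\ redmx vF (u : 'M_n) = 1%:M.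
Proof.
move=> N0 hu; have h1 i j : ((u : 'M_n) - 1%:M) i j \in ideal vF 1.
  by apply: ideal_le (hu i j).
have iu : intmx vF ((u : 'M_n) - 1%:M) by move=> i j; apply: ideal_le (h1 i j).
have uE : (u : 'M_n) = 1%:M + ((u : 'M_n) - 1%:M) by rewrite addrC subrK.
have ru : redmx vF u = 1%:M.
  rewrite {1}uE redmxD ?redmx1 //; last exact: intmx1.
  by rewrite -[RHS]addr0; congr (_ + _); apply/matrixP => i j; rewrite [LHS]mxE red_ideal1 // mxE.
split=> //; have iu' : intmx vF u by rewrite uE; apply: intmxD => //; exact: intmx1.
by apply/GLint_mx; split=> //; have [] := intmx_unit iu' _; rewrite ?ru ?unitmx1.
Qed.

Section Lambda.
Variables (C : numClosedFieldType) (L : fieldExtType F) (chi : L -> C).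
Hypothesis chi1 : chi 1 = 1.
Hypothesis chiM : forall x y, x != 0 -> y != 0 -> chi (x * y) = chi x * chi y.
Variables (d : nat) (rho : mx_representation C [set: GL n (resField vF)] d).
Variable lam : G -> 'M[C]_d.
Hypothesis hlam : isLambda chi rho lam.
Local Notation K := (GLmodcenter vF).

Lemma lam_int k : GLint vF k -> lam k = repm rho (redmx vF (k : 'M_n)).
Proof.
move=> ik; rewrite (hlam (oner_neq0 F) ik (esym (scale1r _))) scale1r chi1 scale1r.
exact: redGL_repm.
Qed.

Lemma lamM g h : K g -> K h -> lam (g * h)%g = lam g *m lam h.
Proof.
move=> [x [k [x0 ik gE]]] [y [k' [y0 ik' hE]]].
rewrite (hlam x0 ik gE) (hlam y0 ik' hE).
have ghE : ((g * h)%g : 'M_n) = (x * y) *: ((k * k')%g : 'M_n).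
  by rewrite -[LHS]/(g *m h) gE hE -scalemxAl -scalemxAr scalerA.
rewrite (hlam (mulf_neq0 x0 y0) (GLintM ik ik') ghE) redGLM // repr_mxM ?inE //.
have alg0 (z : F) : z != 0 -> z%:A != 0 :> L by rewrite scaler_eq0 oner_eq0 orbF.
rewrite -scalemxAl -scalemxAr scalerA -chiM ?alg0 // mulr_algl scalerA.
by [].
Qed.

Definition coset_fun (g : G) (w : 'cV[C]_d) : G -> 'cV[C]_d := fun x =>
  if `[< K (x * g^-1)%g >] then lam (x * g^-1)%g *m w else 0.

Lemma coset_fun_mem g w : coset_fun g w \in cIndPred vF K lam.
Proof.
apply/asboolP; split=> [k x Kk||].
- rewrite /coset_fun -mulgA; case: asboolP => [Kkx|nKkx]; case: asboolP => Kx.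
  + by rewrite (lamM Kk Kx) mulmxA.
  + by case: Kx; rewrite -[(x * _)%g](mulKg k); apply: GLmodcenterM => //; exact: GLmodcenterV.
  + by case: nKkx; exact: GLmodcenterM.
  by rewrite mulmx0.
(* Smoothness: for u close to 1 the conjugate g u g^-1 reduces to 1 in the finite group, so [lam] is
   trivial on it. *)
- have [M M0 hM] := GLcongr_conj vF g^-1%g 1; exists M => // x u /hM.
  rewrite invgK => cu; have [iv rv] := GLcongr_int (ltn0Sn 0) cu.
  have Kv := GLint_modcenter iv.
  have e : (x * u * g^-1 = x * g^-1 * (g * u * g^-1))%g by rewrite !mulgA mulgKV.
  rewrite /coset_fun e; case: asboolP => [Kxv|nKxv]; case: asboolP => Kx //.
  + by rewrite (lamM Kx Kv) (lam_int iv) rv repm1 mulmx1.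
  + by case: Kx; rewrite -[(x * g^-1)%g](mulgK (g * u * g^-1)%g); apply: GLmodcenterM => //; exact: GLmodcenterV.
  by case: nKxv; exact: GLmodcenterM.
exists [:: g] => x; rewrite /coset_fun; case: asboolP => [Kx _|_ /eqP//].
by exists (x * g^-1)%g, g; rewrite mem_seq1 eqxx mulgKV.
Qed.

Definition coset_cInd g w : cInd vF K lam := MkCInd (coset_fun_mem g w).

Lemma coset_mull k g w : K k -> coset_cInd (k * g)%g w = coset_cInd g (lam k^-1%g *m w).
Proof.
move=> Kk; apply/val_inj/funext => x; rewrite /= /coset_fun invMg mulgA.
have Kk' := GLmodcenterV Kk.
case: asboolP => [K1|nK1]; case: asboolP => K2 //.
- by rewrite (lamM K2 Kk') mulmxA.
- by case: K2; rewrite -[(x * g^-1)%g](mulgK k^-1%g); apply: GLmodcenterM => //; exact: GLmodcenterV.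
by case: nK1; exact: GLmodcenterM.
Qed.

Lemma coset_mulr y g w : cInd_transl y (coset_cInd g w) = coset_cInd (g * y^-1)%g w.
Proof. by apply/val_inj/funext => x; rewrite /= /coset_fun invMg invgK mulgA. Qed.

Lemma coset_linear g a w w' : coset_cInd g (a *: w + w') = a *: coset_cInd g w + coset_cInd g w'.
Proof.
apply/val_inj/funext => x; rewrite -[RHS]/(a *: coset_fun g w x + coset_fun g w' x) /= /coset_fun.
by case: asboolP => _; rewrite ?scaler0 ?addr0 // mulmxDr scalemxAr.
Qed.

(** The support of f meets finitely many cosets, and subtracting the coset function of f g removes
    the coset of g from the list. *)
Lemma coset_span (l : cInd vF K lam -> C) :
  (forall a v w, l (a *: v + w) = a * l v + l w) ->
  (forall g w, l (coset_cInd g w) = 0) -> forall f, l f = 0.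
Proof.
move=> ll l0 f; have /asboolP[_ _ [s hs]] := cIndP f.
have lz : l 0 = 0.
  have := ll 1 0 0; rewrite scale1r mul1r addr0 => /eqP.
  by rewrite -{1}[l 0]addr0 (inj_eq (addrI _)) eq_sym => /eqP.
elim: s f hs => [|g s IH] f hs.
  have -> : f = 0 by apply/val_inj/funext => x; apply/eqP/negPn/negP => /hs[k [g' []]].
  exact: lz.
have fK := cIndP f; case/asboolP: fK => fK _ _.
have fE : f = 1 *: coset_cInd g (f g) + (f - coset_cInd g (f g)) by rewrite scale1r addrC subrK.
rewrite fE ll l0 mulr0 add0r; apply: IH => x.
rewrite -[(f - _) x]/(f x - coset_fun g (f g) x) /coset_fun; case: asboolP => [Kx|nKx].
  by rewrite -fK // mulgKV subrr eqxx.
rewrite subr0 => /hs[k [g' [Kk]]]; rewrite inE => /orP[/eqP->|g's] xE.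
  by case: nKx; rewrite xE mulgK.
by exists k, g'.
Qed.

Definition coset_row (l : cInd vF K lam -> C) (g : G) : 'rV[C]_d :=
  \row_j l (coset_cInd g (delta_mx j 0)).

Lemma coset_rowE l g w : (forall a v w, l (a *: v + w) = a * l v + l w) ->
  l (coset_cInd g w) = (coset_row l g *m w) 0 0.
Proof.
move=> ll; have lz : l (coset_cInd g 0) = 0.
  have := ll (-1) (coset_cInd g 0) (coset_cInd g 0); rewrite -coset_linear scaler0 addr0.
  by rewrite mulN1r addNr.
rewrite {1}[w]matrix_sum_delta mxE; under eq_bigr do rewrite big_ord1.
elim: (index_enum _) => [|i s IH]; first by rewrite !big_nil.
by rewrite !big_cons coset_linear ll IH mxE mulrC.
Qed.

Lemma coset_row_eq l g (v : 'rV[C]_d) : (forall a v w, l (a *: v + w) = a * l v + l w) ->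
  (forall w, l (coset_cInd g w) = (v *m w) 0 0) -> coset_row l g = v.
Proof. by move=> ll h; apply/rowP => j; rewrite mxE h -colE mxE. Qed.

Lemma coset_row_mull l k g : (forall a v w, l (a *: v + w) = a * l v + l w) -> K k ->
  coset_row l (k * g)%g = coset_row l g *m lam k^-1%g.
Proof.
move=> ll Kk; apply: coset_row_eq => // w.
by rewrite coset_mull // coset_rowE // mulmxA.
Qed.

End Lambda.
End LocalGL.

(** * The dimension of the cuspidal representation *)

Section GreenDim.
Variables (C : numClosedFieldType) (F : fieldType) (vF : localField F).
Variables (L : fieldExtType F) (vL : localField L).
Hypothesis unrL : unramified vF vL.
Local Notation iota := (resEmb vF vL).

Lemma alg_ideal N (x : F) : x \in ideal vF N -> x%:A \in ideal vL N.
Proof.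
have [->|x0] := eqVneq x 0; first by move=> _; rewrite scale0r ideal0.
by rewrite !ideal_nz ?scaler_eq0 ?oner_eq0 ?orbF // unrL.
Qed.

Lemma resEmb_red (x : F) : x \in integers vF -> iota (red vF x) = red vL x%:A.
Proof.
move=> Ox; apply/eqP; rewrite /resEmb red_eq ?alg_ideal ?lift_int // -scalerBl.
by rewrite alg_ideal // -red_eq ?lift_int // red_lift.
Qed.

(** Green's formula at the identity, with f = X - 1, e = 1 and the whole space as eigenspace; the
    sign (-1)^(n-1) turns the n - 1 factors 1 - q^j into q^j - 1. *)
Lemma green_dim n d (rho : mx_representation C [set: GL n (resField vF)] d) (chi : L -> C) :
  (0 < n)%N -> (forall x, x \in ideal vL 1 -> chi (1 + x) = 1) ->
  greenCharacter rho iota (resChar vL chi) ->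
  d%:R = \prod_(1 <= i < n) ((#|resField vF| ^ i)%N%:R - 1) :> C.
Proof.
move=> n0 chi1 [green _].
(* [resEmb] is a bare function defined by chosen lifts, so its values at the entries that occur, 0,
   1 and -1, are computed by hand. *)
have i0 : iota 0 = 0 by rewrite -(red0 vF) resEmb_red ?int0 // scale0r red0.
have i1 : iota 1 = 1 by rewrite -(red1 vF) resEmb_red ?int1 // scale1r red1.
have iN1 : iota (-1) = -1.
  by rewrite -(red1 vF) -redN ?int1 // resEmb_red ?intN ?int1 // scaleN1r redN ?int1 // red1.
have charE : char_poly (1%g : GL n (resField vF)) = ('X - 1%:P) ^+ n.
  rewrite /char_poly /char_poly_mx map_mx1 -raddfB /=.
  by rewrite det_scalar.
have rt : root (map_poly iota ('X - 1%:P)) 1.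
  rewrite /root (@horner_coef_wide _ 2); last first.
    by rewrite (leq_trans (size_poly _ _)) // size_XsubC.
  rewrite !big_ord_recl big_ord0 /= !coef_map_id0 // !coefB !coefX !coefC /=.
  by rewrite sub0r subr0 iN1 i1 !expr1n !mulr1 addr0 addNr.
have := green 1%g _ n 1 (irredp_XsubC 1) charE rt.
rewrite size_XsubC /= big_ord1 expn0 expr1.
have -> : resChar vL chi 1 = 1.
  rewrite /resChar -[lift 1](subrK 1) addrC chi1 //.
  by rewrite -red_eq ?lift_int ?int1 // red_lift red1.
have -> : map_mx iota (1%g : GL n (resField vF)) = 1%:M.
  by apply/matrixP => i j; rewrite !mxE; case: (i == j).
rewrite /eigenspace subrr mxrank_ker mxrank0 subn0 repr_mx1 mxtrace1 mulr1 => ->.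
rewrite -subn1 -prodr_const_nat -big_split /=.
by apply: eq_bigr => j _; rewrite muln1 natrX mulN1r opprB.
Qed.

End GreenDim.

(** * Equivariant functionals on the cuspidal representation *)

Lemma ideal_all0 (K : fieldType) (vK : localField K) x :
  (forall N : nat, x \in ideal vK N%:Z) -> x = 0.
Proof.
move=> h; apply/eqP/negPn/negP => x0; have := h (`|lval vK x|.+1)%N.
rewrite ideal_nz //; lia.
Qed.

(* Newton iteration for a square root. *)
Lemma hensel_sqrt (K : fieldType) (vK : localField K) (e : K) (t : resField vK) :
  2%:R != 0 :> resField vK -> e \in integers vK -> red vK e != 0 ->
  t * t = red vK e -> exists l, l * l = e.
Proof.
move=> two0 Oe re tt; have t0 : t != 0.
  by apply: contraNneq re => t0; rewrite -tt t0 mulr0.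
have O2 : (2%:R : K) \in integers vK by rewrite intD ?int1.
have r2E : red vK 2%:R = 2%:R by rewrite (redD (int1 vK) (int1 vK)) red1.
have r2 : red vK 2%:R != 0 by rewrite r2E.
have [u [u0E uS]] : exists u : nat -> K, u 0%N = lift t /\ forall i, u i.+1 = 2%:R^-1 * (u i + e / u i).
  by exists (fun i => iter i (fun y => 2%:R^-1 * (y + e / y)) (lift t)).
have key i : [/\ u i \in integers vK, red vK (u i) = t &
    u i * u i - e \in ideal vK (i.+1)%:Z].
  elim: i => [|i [Ou ru Iu]].
    by rewrite u0E lift_int red_lift -red_eq ?intMul ?lift_int // redM ?lift_int // red_lift tt.
  have ru0 : red vK (u i) != 0 by rewrite ru.
  have [u0 _] := red_unit Ou ru0; have OV := integersV Ou ru0.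
  have [two0' _] := red_unit O2 r2; have O2V := integersV O2 r2.
  have Oq : e / u i \in integers vK by rewrite intMul.
  split; first by rewrite uS intMul // intD.
    rewrite uS redM ?intD // redD // redM // !red_V // r2E ru -tt mulfK //.
    by rewrite -mulr2n -(mulr_natl t 2) mulKf.
  have -> : u i.+1 * u i.+1 - e = (2%:R^-1 * (u i)^-1) ^+ 2 * (u i * u i - e) ^+ 2.
    by rewrite uS; field; rewrite u0.
  apply: idealMl; first by rewrite intX // intMul.
  rewrite expr2; apply: (@ideal_le _ _ (i.+1%:Z + i.+1%:Z)); last exact: idealM.
  by rewrite -PoszD lez_nat addSn addnS !ltnS leq_addr.
have step i : u i.+1 - u i \in ideal vK (i.+1)%:Z.
  have [Ou ru Iu] := key i; have ru0 : red vK (u i) != 0 by rewrite ru.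
  have [u0 _] := red_unit Ou ru0; have OV := integersV Ou ru0.
  have [two0' _] := red_unit O2 r2; have O2V := integersV O2 r2.
  have -> : u i.+1 - u i = - (2%:R^-1 * (u i)^-1) * (u i * u i - e).
    by rewrite uS; field; rewrite u0.
  by apply: idealMl => //; rewrite intN ?intMul.
have step2 i j : (i <= j)%N -> u j - u i \in ideal vK (i.+1)%:Z.
  move=> ij; rewrite -(subnK ij); elim: (j - i)%N => [|r IH].
    by rewrite add0n subrr ideal0.
  have -> : u (r.+1 + i)%N - u i = (u (r + i).+1 - u (r + i)%N) + (u (r + i)%N - u i).
    by rewrite addrA subrK.
  apply: idealD => //; apply: ideal_le (step _).
  by rewrite lez_nat ltnS leq_addl.
have cau N : exists n0, forall i j, (n0 <= i)%N -> (n0 <= j)%N ->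
    u i - u j \in pideal (lval vK) N.
  exists `|N|%N => i j hi hj; rewrite -[_ \in _]/(_ \in ideal vK N).
  case: (leqP j i) => [ij|/ltnW ij]; last rewrite -opprB idealN;
    by apply: ideal_le (step2 _ _ ij); clear -hi hj; lia.
have [l hl] := lcomplete cau; exists l.
apply/eqP; rewrite -subr_eq0; apply/eqP; apply: (@ideal_all0 _ vK) => N.
have [n0 hn] := hl N; pose i := (maxn n0 N).
have hi := hn i (leq_maxl _ _); have [Ou _ Iu] := key i.
have Ol : l \in integers vK.
  have -> : l = u i - (u i - l) by rewrite subKr.
  by rewrite intB //; apply: ideal_le hi; rewrite lez_nat.
have -> : l * l - e = - (l + u i) * (u i - l) + (u i * u i - e) by ring.
apply: idealD; first by apply: idealMl => //; rewrite intN // intD.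
by apply: ideal_le Iu; rewrite lez_nat leqW // leq_maxr.
Qed.

Section Main.
Variables (C : numClosedFieldType) (m : nat).
Variables (F : fieldType) (vF : localField F).
Hypothesis two0 : 2%:R != 0 :> resField vF.
Variables (E : fieldExtType F) (vE : localField E).
Hypotheses (dimE : \dim {:E} = 2%N) (unrE : unramified vF vE).
Variable delta : E.
Hypothesis deltaNF : delta \notin 1%VS.
Variable c : F.
Hypothesis delta2 : delta ^+ 2 = c%:A.
Variables (d : nat) (rho : mx_representation C [set: GL (m + m) (resField vF)] d).
Hypotheses (irr : mx_irreducible rho) (cusp : cuspidal rho).
Variable mu : E -> C.
Hypothesis mu_neq0 : forall x, x != 0 -> mu x != 0.
Hypothesis muM : forall x y, x != 0 -> y != 0 -> mu (x * y) = mu x * mu y.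
Hypothesis m0 : (0 < m)%N.
Variable w : F.
Hypotheses (w0 : w != 0) (vw : lval vF w = 1).
Local Notation O := (integers vF).
Local Notation R := (repm rho).
Local Notation n := (m + m)%N.

Lemma algF_eq0 (x : F) : (x%:A == 0 :> E) = (x == 0).
Proof. by rewrite scaler_eq0 oner_eq0 orbF. Qed.

Lemma algFM (x y : F) : (x * y)%:A = x%:A * y%:A :> E.
Proof. by rewrite mulr_algl scalerA. Qed.

Lemma algFD (x y : F) : (x + y)%:A = x%:A + y%:A :> E.
Proof. exact: scalerDl. Qed.

Lemma algFN (x : F) : (- x)%:A = - x%:A :> E.
Proof. exact: scaleNr. Qed.

Lemma delta_neq0 : delta != 0.
Proof. by apply: contraNneq deltaNF => ->; exact: mem0v. Qed.

Lemma c_neq0 : c != 0.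
Proof. by rewrite -algF_eq0 -delta2 expf_neq0 // delta_neq0. Qed.

Lemma twoF : 2%:R != 0 :> F.
Proof.
have := red_unit (intD (int1 vF) (int1 vF)).
by rewrite (redD (int1 vF) (int1 vF)) red1 => /(_ two0)[].
Qed.

Lemma mu1 : mu 1 = 1.
Proof. by apply: (mulfI (mu_neq0 (oner_neq0 E))); rewrite -muM ?oner_neq0 // !mulr1. Qed.

(** delta is not assumed to be a unit. As E/F is unramified, a power of w corrects its valuation to
    any prescribed value. *)
Definition ramd : int := lval vE delta.

Lemma v_c : lval vF c = ramd + ramd.
Proof. by rewrite -(unrE c_neq0) -delta2 expr2 lvalM ?delta_neq0. Qed.

(* epsE a is the multiple of delta by a power of w which has valuation a, and e2 a
   is its square. *)
Definition pa (a : nat) : F := w ^ (a%:Z - ramd).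
Definition epsE a : E := (pa a)%:A * delta.
Definition e2 a : F := pa a * pa a * c.

Lemma pa_neq0 a : pa a != 0. Proof. by rewrite expfz_neq0. Qed.

Lemma v_pa a : lval vF (pa a) = a%:Z - ramd.
Proof. by rewrite lvalXz // vw mulr1. Qed.

Lemma v_e2 a : lval vF (e2 a) = a%:Z + a%:Z.
Proof.
by rewrite lvalM ?mulf_neq0 ?pa_neq0 ?c_neq0 // lvalM ?pa_neq0 // v_pa v_c; ring.
Qed.

Lemma e2_neq0 a : e2 a != 0. Proof. by rewrite !mulf_neq0 ?pa_neq0 ?c_neq0. Qed.

Lemma int_e2 a : e2 a \in O.
Proof. by rewrite ideal_nz ?e2_neq0 // v_e2. Qed.

Lemma red_e2 a : (0 < a)%N -> red vF (e2 a) = 0.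
Proof.
move=> a0; apply: red_ideal1; rewrite ideal_nz ?e2_neq0 // v_e2 -PoszD lez_nat.
by rewrite addn_gt0 a0.
Qed.

Lemma epsE2 a : epsE a ^+ 2 = (e2 a)%:A.
Proof. by rewrite exprMn delta2 expr2 -!algFM. Qed.

Lemma epsE_neq0 a : epsE a != 0.
Proof. by rewrite mulf_neq0 ?delta_neq0 // algF_eq0 pa_neq0. Qed.

Lemma w_int : w \in O. Proof. by rewrite ideal_nz // vw. Qed.
Lemma red_w : red vF w = 0. Proof. by apply: red_ideal1; rewrite ideal_nz // vw. Qed.

Lemma w_div x : x \in ideal vF 1 -> exists2 y, y \in O & x = w * y.
Proof.
have [->|x0] := eqVneq x 0; first by exists 0; rewrite ?int0 ?mulr0.
rewrite ideal_nz // => vx; exists (w^-1 * x); last by rewrite mulVKf.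
rewrite ideal_nz ?mulf_neq0 ?invr_eq0 // lvalM ?invr_eq0 // lvalV // vw.
by rewrite addrC subr_ge0.
Qed.

Lemma delta_nonsq (l : F) : l * l != e2 0.
Proof.
apply/eqP => ll; have : (epsE 0 - l%:A) * (epsE 0 + l%:A) == 0.
  by rewrite -subr_sqr epsE2 expr2 -algFM ll subrr.
have inF (x : F) : x%:A != epsE 0.
  apply: contraNneq deltaNF => e; apply/vlineP; exists ((pa 0)^-1 * x).
  have p0 : (pa 0)%:A != 0 :> E by rewrite algF_eq0 pa_neq0.
  by apply: (mulfI p0); rewrite -/(epsE 0) -e -algFM mulVKf ?pa_neq0.
rewrite mulf_eq0 subr_eq0 addr_eq0 -algFN => /orP[] /eqP e.
  by case/eqP: (inF l).
by case/eqP: (inF (- l)).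
Qed.

(** By Hensel's lemma a square root in k_F would lift to F, while [epsE 0] lies outside F. So the
    reduction of [e2 0] generates the quadratic extension of k_F. *)
Lemma red_nonsq (t : resField vF) : t * t != red vF (e2 0).
Proof.
apply/eqP => tt; have [||l ll] := hensel_sqrt two0 _ _ tt; first exact: int_e2.
  by rewrite red_eq0 ?int_e2 // ideal_nz ?e2_neq0 // v_e2.
by case/eqP: (delta_nonsq l).
Qed.

(* The functionals lam on C^d which come from Hom_H(pi, mu) through the
   functions supported on the double coset of g. *)
Definition Eqv (g : 'M[F]_n) (lam : 'rV[C]_d) := forall P Q : 'M[F]_m,
  let X := g *m quadmx c P Q *m invmx g in
  intmx vF X -> redmx vF X \in unitmx ->
  lam *m R (redmx vF X) = mu (\det (pairmx delta P Q)) *: lam.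

(** J f + f J commutes with J because J^2 is scalar. For f = x z it is the E-linear map of rank one
    (x2 + delta x1)(z1 + delta z2), so adding 1 gives an element of H whose determinant over E is
    explicit. *)
Lemma quad_rank1 (x1 x2 : 'cV[F]_m) (z1 z2 : 'rV[F]_m) :
  quadmx c 0 1%:M *m (col_mx x1 x2 *m row_mx z1 z2) +
  (col_mx x1 x2 *m row_mx z1 z2) *m quadmx c 0 1%:M =
  quadmx c (x2 *m z1 + c *: (x1 *m z2)) (x2 *m z2 + x1 *m z1).
Proof.
rewrite mul_col_row /quadmx !mulmx_block add_block_mx !(mul0mx, mulmx0, mulmx1, mul1mx, add0r, addr0).
rewrite -!scalemxAl -!scalemxAr !mul1mx !mulmx1 scalerDr.
congr block_mx => //.
  by rewrite addrC.
by rewrite addrC.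
Qed.

Lemma lam_trivial_radical (lam : 'rV[C]_d) (p : 'M_n) : lam != 0 -> p *m p = p -> p != 0 -> p != 1%:M ->
  ~ (forall f, radp p f -> lam *m R (1%:M + f) = lam).
Proof.
move=> lam0 pp p0 p1 h; have := cuspidal_sum cusp pp p0 p1.
move/(congr1 (mulmx lam)); rewrite mulmx0 mulmx_sumr (eq_bigr (fun _ => lam)) //.
rewrite sumr_const -scaler_nat => /eqP; rewrite scaler_eq0 (negPf lam0) orbF pnatr_eq0.
rewrite (cardD1 0) unfold_in /radp mulmx0 mul0mx !eqxx.
by [].
Qed.

Lemma mulmx1D0 p (f h : 'M[resField vF]_p) : f *m h = 0 ->
  (1%:M + f) *m (1%:M + h) = 1%:M + (f + h).
Proof. by move=> e; rewrite mulmxDl mul1mx mulmxDr mulmx1 e addr0 -addrA (addrC h). Qed.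

Lemma sum_delta_row p q (A : 'M[resField vF]_(p, q)) : A = \sum_i delta_mx i (0 : 'I_1) *m row i A.
Proof.
apply/matrixP => i j; rewrite summxE (bigD1 i) //= big1 => [|l li].
  by rewrite mxE big_ord1 !mxE !eqxx mul1r addr0.
by rewrite mxE big_ord1 !mxE eq_sym (negPf li) mul0r.
Qed.

(** Expanding f along its rows shows that the rank one elements generate the radical. *)
Lemma lam_trivial_rank1 (lam : 'rV[C]_d) (p : 'M_n) :
  lam != 0 -> p *m p = p -> p != 0 -> p != 1%:M ->
  ~ (forall (x : 'cV_n) (z : 'rV_n), p *m x = x -> z *m p = 0 ->
      lam *m R (1%:M + x *m z) = lam).
Proof.
move=> lam0 pp p0 p1 h; apply: (lam_trivial_radical lam0 pp p0 p1) => f /radpP[pf fp].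
have -> : f = \sum_i p *m delta_mx i 0 *m row i f.
  rewrite -{1}pf {1}[f]sum_delta_row mulmx_sumr; apply: eq_bigr => i _.
  by rewrite mulmxA.
have zp i : row i f *m p = 0 by rewrite -row_mul fp row0.
have [_ ->] // : radp p (\sum_i p *m delta_mx i 0 *m row i f) /\
  lam *m R (1%:M + \sum_i p *m delta_mx i 0 *m row i f) = lam.
elim/big_ind: _ => [|h1 h2 [p1h lh1] [p2h lh2]|i _].
- by rewrite addr0 repm1 mulmx1; split=> //; apply/radpP; rewrite mul0mx mulmx0.
- split; first exact: radpD.
  rewrite -mulmx1D0 ?(radp_mul p1h p2h) // repmM ?unitmx_1D ?(radp_mul p1h p1h) ?(radp_mul p2h p2h) //.
  by rewrite mulmxA lh1.
split; last by apply: h => //; rewrite mulmxA pp.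
apply/radpP; split; first by rewrite !mulmxA pp.
by rewrite -(mulmxA _ (row i f)) zp mulmx0.
Qed.

(** * What a nonzero functional imposes on g *)

Section FixedG.
Variables (g : 'M[F]_n) (lam : 'rV[C]_d).
Hypotheses (ug : g \in unitmx) (lam0 : lam != 0) (heq : Eqv g lam).
Let T := g *m quadmx c 0 1%:M *m invmx g.
Variable a : nat.
Variable eps : 'M[F]_n.
Hypothesis eps_def : eps = pa a *: T.
Hypothesis int_eps : intmx vF eps.

Lemma eps_sq : eps *m eps = (e2 a)%:M.
Proof.
rewrite eps_def -scalemxAl -scalemxAr scalerA /T !mulmxA mulmxKV // -(mulmxA g) quadmxM.
rewrite !(mul0mx, mulmx0, mulmx1, addr0, add0r) /quadmx scaler0 scalemx1.
rewrite -scalar_mx_block mul_mx_scalar -scalemxAl mulmxV // scale_scalar_mx mulr1.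
by rewrite scale_scalar_mx.
Qed.

Lemma eqv_rank1 (x : 'cV[F]_n) (z : 'rV[F]_n) : intmx vF x -> intmx vF z ->
  let f := redmx vF eps *m (redmx vF x *m redmx vF z) +
           redmx vF x *m redmx vF z *m redmx vF eps in
  1%:M + f \in unitmx ->
  lam *m R (1%:M + f) =
  mu (1 + ((z *m eps *m x) 0 0)%:A + ((z *m x) 0 0)%:A * epsE a) *: lam.
Proof.
move=> ix iz f uf; pose xz := x *m z; pose f' := eps *m xz + xz *m eps.
have ixz : intmx vF xz by exact: intmxM.
have if' : intmx vF f' by apply: intmxD; apply: intmxM.
have rf' : redmx vF (1%:M + f') = 1%:M + f.
  rewrite redmxD ?redmx1 //; last exact: intmx1.
  by rewrite redmxD ?redmxM //; apply: intmxM => //; exact: intmxM.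
pose x' := invmx g *m x; pose z' := z *m g.
set x1 := usubmx (m1 := m) x'; set x2 := dsubmx (m1 := m) x'.
set z1 := lsubmx (n1 := m) z'; set z2 := rsubmx (n1 := m) z'.
have x'E : x' = col_mx x1 x2 by rewrite vsubmxK.
have z'E : z' = row_mx z1 z2 by rewrite hsubmxK.
pose P := x2 *m z1 + c *: (x1 *m z2); pose Q := x2 *m z2 + x1 *m z1.
have XE : g *m quadmx c (1%:M + pa a *: P) (pa a *: Q) *m invmx g = 1%:M + f'.
  have -> : quadmx c (1%:M + pa a *: P) (pa a *: Q) = 1%:M + pa a *: quadmx c P Q.
    rewrite /quadmx (@scalar_mx_block _ m m) scale_block_mx add_block_mx !add0r.
    by rewrite !scalerA (mulrC c).
  rewrite mulmxDr mulmx1 mulmxDl mulmxV // -quad_rank1 -x'E -z'E; congr (_ + _).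
  have e1 : eps *m xz = pa a *: (g *m (quadmx c 0 1%:M *m (x' *m z')) *m invmx g).
    rewrite eps_def /T /xz /x' /z' -scalemxAl; congr (_ *: _).
    by rewrite !mulmxA mulmxK.
  have e2 : xz *m eps = pa a *: (g *m ((x' *m z') *m quadmx c 0 1%:M) *m invmx g).
    rewrite eps_def /T /xz /x' /z' -scalemxAr; congr (_ *: _).
    by rewrite !mulmxA mulmxV // mul1mx.
  by rewrite /f' e1 e2 -scalemxAr -scalemxAl mulmxDr mulmxDl scalerDr.
have := @heq (1%:M + pa a *: P) (pa a *: Q); rewrite /= XE rf' => -> //; last first.
  by apply: intmxD => //; exact: intmx1.
congr (mu _ *: _).
have -> : pairmx delta (1%:M + pa a *: P) (pa a *: Q) =
    1%:M + ((pa a)%:A *: pairmx delta x2 x1) *m pairmx delta z1 z2.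
  rewrite -scalemxAl (pairmxM _ _ _ _ delta2) /pairmx map_mxD map_mx1 !map_mxZ -addrA.
  by rewrite scalerDr !scalerA (mulrC delta).
rewrite det_1D_rank1 -scalemxAr (pairmxM _ _ _ _ delta2) mxE.
rewrite pairmxE mulrDr addrA; congr (_ + _ + _).
  rewrite -algFM; congr (_%:A).
  have -> : z *m eps *m x = pa a *: (z' *m quadmx c 0 1%:M *m x').
    by rewrite eps_def /T /x' /z' -scalemxAr -scalemxAl !mulmxA.
  rewrite [RHS]mxE; congr (_ * _); rewrite x'E z'E /quadmx mul_row_block mul_row_col.
  rewrite !(mulmx0, mulmx1, add0r, addr0) -scalemxAr mulmx1 -scalemxAl.
  by rewrite [in RHS]addrC.
rewrite mulrA -/(epsE a) mulrC; congr (_%:A * _).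
have -> : z *m x = z' *m x' by rewrite /z' /x' mulmxA mulmxK.
by rewrite x'E z'E mul_row_col addrC.
Qed.

Let eb := redmx vF eps.

(** Scaling x by w makes the group element reduce to 1, so its eigenvalue on lam is 1. *)
Lemma mu_rank1 (x : 'cV[F]_n) (z : 'rV[F]_n) : intmx vF x -> intmx vF z ->
  mu (1 + (w * (z *m eps *m x) 0 0)%:A + (w * (z *m x) 0 0)%:A * epsE a) = 1.
Proof.
move=> ix iz; have iwx : intmx vF (w *: x) by apply: intmxZ => //; exact: w_int.
have /= := eqv_rank1 iwx iz.
rewrite redmxZ ?w_int // red_w scale0r !mul0mx mulmx0 !addr0 repm1 unitmx1.
rewrite mulmx1 -!scalemxAr => /(_ isT).
have sE (M : 'M[F]_1) : (w *: M) 0 0 = w * M 0 0 by rewrite mxE.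
rewrite !sE.
set t := mu _; move=> e; apply/eqP; rewrite -subr_eq0.
have : (t - 1) *: lam == 0 by rewrite scalerBl scale1r -e subrr.
by rewrite scaler_eq0 (negPf lam0) orbF.
Qed.

(** Take a unit entry (i, j) of eps, x = e_j and z0 the i-th coordinate form divided by this entry.
    On z0 and z1 = z0 eps the two values are (1, h) and (e h, 1), where e = [e2 a] is divisible by
    w; the determinant 1 - e h^2 is therefore a unit. *)
Lemma eps_rank1_surj : (0 < a)%N -> eb != 0 -> exists2 x : 'cV[F]_n, intmx vF x &
  forall al be, al \in O -> be \in O -> exists2 z : 'rV[F]_n, intmx vF z &
    (z *m eps *m x) 0 0 = al /\ (z *m x) 0 0 = be.
Proof.
move=> a0 /matrix0Pn[i [j]]; rewrite mxE => ij0.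
have OV := integersV (int_eps i j) ij0; have [e0 _] := red_unit (int_eps i j) ij0.
pose x : 'cV[F]_n := delta_mx j 0; exists x; first exact: intmx_delta.
pose z0 : 'rV[F]_n := (eps i j)^-1 *: delta_mx 0 i.
have iz0 : intmx vF z0 by apply: intmxZ => //; exact: intmx_delta.
have ix : intmx vF x by exact: intmx_delta.
have z0e : (z0 *m eps *m x) 0 0 = 1.
  by rewrite -!scalemxAl -rowE -colE mxE [X in _ * X]mxE [X in _ * X]mxE mulVf.
pose h := (z0 *m x) 0 0; have Oh : h \in O by exact: intmxM.
pose z1 := z0 *m eps; have iz1 : intmx vF z1 by exact: intmxM.
have [e [eE Oe re]] : exists e, [/\ e2 a = e, e \in O & red vF e = 0].
  by exists (e2 a); split; [|exact: int_e2|exact: red_e2].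
have z1e : (z1 *m eps *m x) 0 0 = e * h.
  by rewrite /z1 -(mulmxA z0) eps_sq eE mul_mx_scalar -scalemxAl [LHS]mxE.
pose u := 1 - h * h * e.
have Ou : u \in O by rewrite intB ?int1 // !intMul.
have ru : red vF u = 1 by rewrite redB ?int1 ?intMul // redM ?intMul // re mulr0 red1 subr0.
have ru0 : red vF u != 0 by rewrite ru oner_neq0.
have [u0 _] := red_unit Ou ru0; have OuV := integersV Ou ru0.
move=> al be Oal Obe; pose r := (al - be * (e * h)) / u.
have Or : r \in O by rewrite intMul // intB // !intMul.
exists (be *: z1 + r *: (z0 - h *: z1)).
  apply: intmxD; first exact: intmxZ.
  by apply: intmxZ => //; apply: intmxD => //; apply: intmxN; exact: intmxZ.
have entry (f : 'rV[F]_n -> 'M[F]_1) : linear f ->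
    (f (be *: z1 + r *: (z0 - h *: z1))) 0 0 = be * f z1 0 0 + r * (f z0 0 0 - h * f z1 0 0).
  move=> lf; have f0 : f 0 = 0.
    have := lf 1 0 0; rewrite !scale1r addr0 => /eqP.
    by rewrite -{1}[f 0]addr0 (inj_eq (addrI _)) eq_sym => /eqP.
  have fE t y : f (t *: y) = t *: f y by have := lf t y 0; rewrite f0 !addr0.
  have fD y y' : f (y + y') = f y + f y' by have := lf 1 y y'; rewrite !scale1r.
  by rewrite fD (fE be) (fE r) fD -scaleNr (fE (- h)) !mxE mulNr.
split.
  rewrite (entry (fun z => z *m eps *m x)); last first.
    by move=> t y y'; rewrite !mulmxDl -!scalemxAl.
  by rewrite z0e z1e /r; have : u != 0 := u0; rewrite /u => {}u0; field.
rewrite (entry (fun z => z *m x)); last by move=> t y y'; rewrite !mulmxDl -!scalemxAl.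
by rewrite -/h z0e !mulr1 subrr mulr0 addr0.
Qed.

Lemma mu_level : (0 < a)%N -> eb != 0 -> forall al be, al \in O -> be \in O ->
  mu (1 + (w * al)%:A + (w * be)%:A * epsE a) = 1.
Proof.
move=> a0 eb0 al be Oal Obe; have [x ix h] := eps_rank1_surj a0 eb0.
by have [z iz [<- <-]] := h _ _ Oal Obe; exact: mu_rank1.
Qed.

Lemma eb_sqE : eb *m eb = (red vF (e2 a))%:M.
Proof.
rewrite -redmxM // eps_sq; apply/matrixP => i j; rewrite !mxE.
by case: (i == j); rewrite ?mulr1n ?mulr0n ?red0.
Qed.

Lemma eb_sq : (0 < a)%N -> eb *m eb = 0.
Proof. by move=> a0; rewrite eb_sqE red_e2 // raddf0. Qed.

Lemma lam_rank1 (x : 'cV_n) (z : 'rV_n) : (0 < a)%N -> eb != 0 ->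
  z *m eb = 0 -> z *m x = 0 -> lam *m R (1%:M + eb *m x *m z) = lam.
Proof.
move=> a0 eb0 ze zx; have ix := intmx_lift x; have iz := intmx_lift z.
have /= := eqv_rank1 ix iz; rewrite !redmx_lift -[redmx vF eps]/eb -(mulmxA x z) ze mulmx0 addr0 mulmxA.
move=> ->; last by apply: unitmx_1D; rewrite !mulmxA -(mulmxA (eb *m x) z) ze mulmx0 !mul0mx.
have r0 (M : 'M[F]_1) : intmx vF M -> redmx vF M = 0 -> exists2 y, y \in O & M 0 0 = w * y.
  move=> iM /matrixP/(_ 0 0); rewrite !mxE => e; apply: w_div.
  by rewrite -red_eq0 ?e.
have [| |al Oal ->] := r0 (liftmx z *m eps *m liftmx x).
- by apply: intmxM => //; exact: intmxM.
- by rewrite !redmxM ?redmx_lift ?ze ?mul0mx //; exact: intmxM.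
have [| |be Obe ->] := r0 (liftmx z *m liftmx x).
- exact: intmxM.
- by rewrite redmxM ?redmx_lift.
by rewrite mu_level // scale1r.
Qed.

(** The upper bound is eb^2 = 0. If the rank were smaller, some z0 with z0 eb = 0 and some v with eb
    v = 0 would satisfy z0 v <> 0. Replacing x by x - t v leaves eb x unchanged and achieves z x =
    0, so [lam_rank1] applies whenever z v <> 0; any other z is the difference of z + z0 and z0. *)
Lemma rank_eb : (0 < a)%N -> eb != 0 -> \rank eb = m.
Proof.
move=> a0 eb0; have e2 := eb_sq a0.
apply/eqP; rewrite eqn_leq; apply/andP; split.
  by have := mulmx0_rank_max e2; lia.
rewrite leqNgt; apply/negP => rlt.
have [i [j nz]] : exists i j, (row i (kermx eb) *m col j (cokermx eb)) 0 0 != 0.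
  have : kermx eb *m cokermx eb != 0.
    apply: contraTneq rlt => /mulmx0_rank_max; rewrite mxrank_ker mxrank_coker.
    by have := rank_leq_row eb; lia.
  case/matrix0Pn => i [j h]; exists i, j; rewrite colE mulmxA -row_mul -colE.
  by rewrite [X in X != 0]mxE [X in X != 0]mxE.
pose z0 := row i (kermx eb); pose v := col j (cokermx eb).
have z0e : z0 *m eb = 0 by rewrite -row_mul mulmx_ker row0.
have ve : eb *m v = 0 by rewrite /v colE mulmxA mulmx_coker mul0mx.
have key1 (x : 'cV_n) (z : 'rV_n) : z *m eb = 0 -> (z *m v) 0 0 != 0 -> lam *m R (1%:M + eb *m x *m z) = lam.
  move=> ze zv; pose t := (z *m x) 0 0 / (z *m v) 0 0.
  have -> : eb *m x = eb *m (x - t *: v) by rewrite mulmxBr -scalemxAr ve scaler0 subr0.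
  apply: lam_rank1 => //; rewrite mulmxBr -scalemxAr; apply/matrixP => y y'.
  have sE (M : 'M[resField vF]_1) : (t *: M) 0 0 = t * M 0 0 by rewrite mxE.
  by rewrite !ord1 [LHS]mxE [X in _ + X]mxE sE mulfVK // subrr mxE.
have key2 (x : 'cV_n) (z : 'rV_n) : z *m eb = 0 -> lam *m R (1%:M + eb *m x *m z) = lam.
  move=> ze; have [zv|zv] := eqVneq ((z *m v) 0 0) 0; last exact: key1.
  have zz0e : (z + z0) *m eb = 0 by rewrite mulmxDl ze z0e addr0.
  have -> : 1%:M + eb *m x *m z =
      (1%:M + eb *m x *m (z + z0)) *m (1%:M + eb *m (- x) *m z0).
    rewrite mulmx1D0; last by rewrite !mulmxA -(mulmxA (eb *m x)) zz0e mulmx0 !mul0mx.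
    by rewrite mulmxDr mulmxN mulNmx addrK.
  have z0v : (z0 *m v) 0 0 != 0 by [].
  have u1 (x' : 'cV_n) (z' : 'rV_n) : z' *m eb = 0 -> 1%:M + eb *m x' *m z' \in unitmx.
    by move=> z'e; apply: unitmx_1D; rewrite !mulmxA -(mulmxA (eb *m x') z') z'e mulmx0 !mul0mx.
  rewrite repmM ?u1 // mulmxA !key1 //.
  by rewrite mulmxDl mxE zv add0r.
pose p := eb *m pinvmx eb.
have pe : p *m eb = eb by rewrite mulmxKpV.
apply: (@lam_trivial_rank1 lam p) => //.
- by rewrite /p mulmxA pe.
- by apply: contraNneq eb0 => p0; rewrite -pe p0 mul0mx.
- apply/eqP => p1; have := mulmx1_unit p1 => -[ue _].
  by case/eqP: eb0; rewrite -[eb](mulKmx ue) e2 mulmx0.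
move=> x z px zp.
have ze : z *m eb = 0 by rewrite -pe mulmxA zp mul0mx.
by rewrite -px -(mulmxA eb); exact: key2.
Qed.

End FixedG.

(** Here and in the next lemma, k^n is shown to be free of rank m over the algebra generated by
    f. *)
Lemma nilp_basis (k : fieldType) (f : 'M[k]_n) : f *m f = 0 -> \rank f = m ->
  exists V : 'M_(n, m), row_mx (f *m V) V \in unitmx.
Proof.
move=> ff; move: (col_base_full f) (row_base_free f) (mulmx_base f).
move: (col_base f) (row_base f); move: (\rank f) => r cb rb; move=> cf rf fE rm; subst r.
have [pr rb1] : exists pr, rb *m pr = 1%:M by exists (pinvmx rb); exact: mulmxVp.
have [pc cb1] : exists pc, pc *m cb = 1%:M by exists (pinvmx cb); exact: mulVpmx.
have rc : rb *m cb = 0.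
  have : pc *m (f *m f) *m pr = 0 by rewrite ff mulmx0 mul0mx.
  by rewrite -fE !mulmxA cb1 mul1mx -(mulmxA _ rb pr) rb1 mulmx1.
have fV : f *m pr = cb by rewrite -fE -mulmxA rb1 mulmx1.
exists pr; have : col_mx pc rb *m row_mx (f *m pr) pr \in unitmx.
  by rewrite fV mul_col_row cb1 rb1 rc unitmxE det_ublock !det1 mulr1 unitr1.
by rewrite unitmx_mul => /andP[].
Qed.

Lemma semilin_basis (k : fieldType) (f : 'M[k]_n) (D : k) :
  (forall x, x * x != D) -> f *m f = D%:M ->
  exists V : 'M_(n, m), row_mx (f *m V) V \in unitmx.
Proof.
move=> Dns ff; have JJ : f^T *m f^T = D%:M by rewrite -trmx_mul ff tr_scalar_mx.
have [||| r [X [_ sub rk]]] := lbasis_ext JJ Dns (A := 0) (B := 1%:M : 'M_n).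
- by rewrite mul0mx sub0mx.
- by rewrite submx1.
- by rewrite sub0mx.
have rm : r = m by move: rk; rewrite mxrank1 mxrank0; lia.
subst r; exists X^T; rewrite -unitmx_tr tr_row_mx trmx_mul trmxK.
rewrite -row_full_unit -sub1mx -addsmxE addsmxC addsmxE.
by rewrite adds0mx in sub.
Qed.

(* Representatives of the cosets K \ G / H which can support a functional. *)
Definition gA a : 'M[F]_n := block_mx ((pa a)^-1)%:M 0 0 1%:M.

Lemma gA_unit a : gA a \in unitmx.
Proof.
by rewrite unitmxE /gA det_ublock det1 mulr1 det_scalar unitfE expf_neq0 ?invr_eq0 ?pa_neq0.
Qed.

Lemma paS a : pa a.+1 = w * pa a.
Proof. by rewrite /pa -addn1 PoszD addrAC [LHS]expfzDr // mulrC. Qed.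

Lemma intmx_row p q r (A : 'M[F]_(p, q)) (B : 'M_(p, r)) :
  intmx vF A -> intmx vF B -> intmx vF (row_mx A B).
Proof. by move=> iA iB i j; rewrite mxE; case: splitP => l _. Qed.

Lemma eqv_decomp (g : 'M_n) (lam : 'rV[C]_d) : g \in unitmx -> lam != 0 -> Eqv g lam ->
  exists a B P Q, [/\ intmx vF B, redmx vF B \in unitmx, quadmx c P Q \in unitmx &
    g = B *m gA a *m quadmx c P Q].
Proof.
move=> ug lam0 heq; set T := g *m quadmx c 0 1%:M *m invmx g.
have ex : exists a, `[< intmx vF (pa a *: T) >].
  have sq := eps_sq ug (erefl (pa 0 *: T)).
  have u0 : pa 0 *: T \in unitmx.
    have : (pa 0 *: T) *m ((e2 0)^-1 *: (pa 0 *: T)) = 1%:M.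
      by rewrite -[LHS]scalemxAr sq scale_scalar_mx mulVf ?e2_neq0.
    by case/mulmx1_unit.
  have [b hb] := GLbound vF (mkGL (pa 0 *: T)).
  exists b; apply/asboolP => i j; have := hb i j; rewrite mkGLE // => hij.
  have -> : (pa b *: T) i j = w ^+ b * (pa 0 *: T) i j.
    rewrite !mxE mulrA; congr (_ * _); elim: b {hb hij} => [|b IH]; first by rewrite mul1r.
    by rewrite paS IH exprS mulrA.
  have vwb : w ^+ b \in ideal vF b.
    by rewrite ideal_nz ?expf_neq0 // exprnP lvalXz // vw mulr1.
  by have := idealM vwb hij; rewrite subrr.
case: (ex_minnP ex) => a /asboolP ia amin; set eps := pa a *: T in ia.
pose eb := redmx vF eps.
have [V uV] : exists V : 'M_(n, m), row_mx (eb *m V) V \in unitmx.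
  case: (posnP a) => [a0|a0].
    apply: (semilin_basis red_nonsq); rewrite -a0.
    exact: (eb_sqE ug (erefl _) ia).
  (* By minimality of a: otherwise eps could be divided by w. *)
  have eb0 : eb != 0.
    apply/eqP => eb0; case: a a0 @eps ia amin @eb eb0 => // a _ eps ia amin eb eb0.
    suff /asboolP/amin : intmx vF (pa a *: T) by rewrite ltnn.
    move=> i j; have [|y Oy yE] := @w_div (eps i j).
      by rewrite -red_eq0 //; have /matrixP/(_ i j) := eb0; rewrite !mxE => ->.
    rewrite [(_ *: T) i j]mxE; suff -> : pa a * T i j = y by [].
    by apply: (mulfI w0); rewrite -yE /eps [RHS]mxE paS mulrA.
  apply: nilp_basis; first exact: (eb_sq ug (erefl _) ia a0).
  exact: (rank_eb ug lam0 heq (erefl _) ia a0 eb0).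
(* The columns of B form a basis of O^n in which eps has its standard shape. Up to [gA a], B and g
   then transport the matrix of delta to the same operator, so they differ by an element of H. *)
pose B := row_mx (eps *m liftmx V) (liftmx V).
have iV := @intmx_lift _ vF _ _ V.
have iB : intmx vF B by apply: intmx_row => //; exact: intmxM.
have rB : redmx vF B = row_mx (eb *m V) V.
  by rewrite /redmx map_row_mx -!/(redmx _ _) redmxM ?redmx_lift //; exact: intmx_lift.
have uB : redmx vF B \in unitmx by rewrite rB.
have [uB' _] := intmx_unit iB uB.
pose V' := invmx g *m liftmx V.
pose V1 := usubmx (m1 := m) V'; pose V2 := dsubmx (m1 := m) V'.
have gB : invmx g *m B *m gA a = quadmx c V2 V1.
  have e1 : invmx g *m (eps *m liftmx V) = pa a *: (quadmx c 0 1%:M *m V').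
    rewrite /eps /T /V' -!scalemxAl -scalemxAr; congr (_ *: _).
    by rewrite !mulmxA mulVmx // mul1mx.
  rewrite /B mul_mx_row e1 -/V' /gA mul_row_block !mulmx0 addr0 add0r mulmx1.
  rewrite mul_mx_scalar scalerA mulVf ?pa_neq0 // scale1r.
  have -> : V' = col_mx V1 V2 by rewrite vsubmxK.
  rewrite /quadmx mul_block_col !mul0mx add0r addr0 mul1mx -scalemxAl mul1mx.
  by rewrite -block_mxEh.
have uq : quadmx c V2 V1 \in unitmx.
  by rewrite -gB !unitmx_mul unitmx_inv ug uB' gA_unit.
have [P [Q PQ]] : exists P Q, invmx (quadmx c V2 V1) = quadmx c P Q.
  apply: quadmx_cent; apply: (can_inj (mulKmx uq)); apply: (can_inj (mulmxK uq)).
  by rewrite mulKVmx // !mulmxA mulmxKV // quadmxC.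
exists a, B, P, Q; split=> //; first by rewrite -PQ unitmx_inv.
have -> : B *m gA a = g *m quadmx c V2 V1.
  by rewrite -gB -(mulmxA _ B) mulKVmx.
by rewrite -PQ mulmxK.
Qed.

(** Conjugation by [gA a] replaces delta by [epsE a]; the integral matrices in the conjugate of H
    are then those with P and Q integral. *)
Definition EqvA a (lam : 'rV[C]_d) := forall P Q : 'M[F]_m,
  intmx vF P -> intmx vF Q -> redmx vF (quadmx (e2 a) P Q) \in unitmx ->
  lam *m R (redmx vF (quadmx (e2 a) P Q)) = mu (\det (pairmx (epsE a) P Q)) *: lam.

Lemma gA_conj a P Q :
  gA a *m quadmx c P (pa a *: Q) *m invmx (gA a) = quadmx (e2 a) P Q.
Proof.
have ug := gA_unit a; apply: (can_inj (mulmxK ug)); rewrite mulmxKV //.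
rewrite /gA /quadmx !mulmx_block !(mul0mx, mulmx0, addr0, add0r, mul1mx, mulmx1).
rewrite !mul_scalar_mx !mul_mx_scalar !scalerA mulVf ?pa_neq0 // scale1r; congr block_mx.
congr (_ *: _); rewrite /e2; field; exact: pa_neq0.
Qed.

Lemma intmx_block p q r s (A : 'M[F]_(p, q)) (B : 'M_(p, r)) (A' : 'M_(s, q)) (B' : 'M_(s, r)) :
  intmx vF A -> intmx vF B -> intmx vF A' -> intmx vF B' -> intmx vF (block_mx A B A' B').
Proof.
by move=> iA iB iA' iB' i j; rewrite mxE; case: splitP => l _; rewrite mxE; case: splitP => l' _.
Qed.

Lemma intmx_quad a (P Q : 'M_m) : intmx vF P -> intmx vF Q -> intmx vF (quadmx (e2 a) P Q).
Proof. by move=> iP iQ; apply: intmx_block => //; apply: intmxZ => //; exact: int_e2. Qed.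

Lemma redmx_quad a (P Q : 'M_m) : intmx vF Q ->
  redmx vF (quadmx (e2 a) P Q) = quadmx (red vF (e2 a)) (redmx vF P) (redmx vF Q).
Proof.
move=> iQ; rewrite /redmx /quadmx map_block_mx -!/(redmx _ _) redmxZ //.
exact: int_e2.
Qed.

Lemma eqv_gA a lam : Eqv (gA a) lam -> EqvA a lam.
Proof.
move=> h P Q iP iQ u; have := @h P (pa a *: Q); rewrite /= gA_conj pairmx_scale.
by apply=> //; exact: intmx_quad.
Qed.

(** * The representative g_a: what a functional reveals about mu *)

Section FixedA.
Variables (a : nat) (lam : 'rV[C]_d).
Hypotheses (lam0 : lam != 0) (hlam : EqvA a lam).

Lemma lam_cancel (x y : C) : x *: lam = y *: lam -> x = y.
Proof.
move/eqP; rewrite -subr_eq0 -scalerBl scaler_eq0 (negPf lam0) orbF subr_eq0.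
by move/eqP.
Qed.

(** Both values are the eigenvalue on lam of one and the same operator of the finite group. *)
Lemma mu_red_det (P Q P' Q' : 'M_m) : intmx vF P -> intmx vF Q -> intmx vF P' -> intmx vF Q' ->
  redmx vF P = redmx vF P' -> redmx vF Q = redmx vF Q' ->
  redmx vF (quadmx (e2 a) P Q) \in unitmx ->
  mu (\det (pairmx (epsE a) P Q)) = mu (\det (pairmx (epsE a) P' Q')).
Proof.
move=> iP iQ iP' iQ' eP eQ u; apply: lam_cancel; rewrite -hlam //.
have e : redmx vF (quadmx (e2 a) P Q) = redmx vF (quadmx (e2 a) P' Q').
  by rewrite !redmx_quad // eP eQ.
by rewrite e hlam // -e.
Qed.

Lemma det_pair_scalar1 (t : E) (x y : F) :
  \det (pairmx t (1%:M + x *: delta_mx (Ordinal m0) (Ordinal m0)) (y *: delta_mx (Ordinal m0) (Ordinal m0)) : 'M_m) =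
  1 + (x%:A + y%:A * t).
Proof.
set i := Ordinal m0.
have -> : pairmx t (1%:M + x *: delta_mx i i) (y *: delta_mx i i) =
   1%:M + ((x%:A + y%:A * t) *: delta_mx i 0) *m delta_mx (0 : 'I_1) i :> 'M_m.
  rewrite /pairmx map_mxD map_mx1 !map_mxZ !map_delta_mx -addrA; congr (_ + _).
  by rewrite -scalemxAl mul_delta_mx scalerA -scalerDl mulrC.
rewrite det_1D_rank1 -scalemxAr mul_delta_mx; congr (_ + _).
by rewrite mxE mxE !eqxx mulr1.
Qed.

Lemma mu_congr1 al be : al \in O -> be \in O ->
  mu (1 + ((w * al)%:A + (w * be)%:A * epsE a)) = 1.
Proof.
move=> Oal Obe; rewrite -det_pair_scalar1; set i := Ordinal m0.
have i1 : intmx vF (delta_mx i i : 'M_m) by exact: intmx_delta.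
have iw x : x \in O -> intmx vF ((w * x) *: (delta_mx i i : 'M_m)).
  by move=> Ox; apply: intmxZ => //; rewrite intMul // w_int.
have rw x : x \in O -> redmx vF ((w * x) *: (delta_mx i i : 'M_m)) = 0.
  by move=> Ox; rewrite redmxZ ?intMul ?w_int // redM ?w_int // red_w mul0r scale0r.
rewrite (@mu_red_det _ _ 1%:M 0) //.
- by rewrite /pairmx map_mx1 map_mx0 scaler0 addr0 det1 mu1.
- by apply: intmxD; [exact: intmx1 | exact: iw].
- exact: iw.
- exact: intmx1.
- exact: intmx0.
- by rewrite redmxD ?rw ?addr0 //; [exact: intmx1 | exact: iw].
- by rewrite rw // redmx0.
rewrite redmx_quad ?rw //; last exact: iw.
rewrite redmxD ?rw ?addr0 ?redmx1 ?quadmx1 ?unitmx1 //; [exact: intmx1 | exact: iw].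
Qed.

Lemma red_e2_block (x : 'cV[resField vF]_m) (z : 'rV_m) : (0 < a)%N ->
  lam *m R (1%:M + block_mx 0 (x *m z) 0 0) =
  mu (1 + epsE a * ((liftmx z *m liftmx x) 0 0)%:A) *: lam.
Proof.
move=> a0; have ix := intmx_lift x; have iz := intmx_lift z.
have ixz : intmx vF (liftmx x *m liftmx z) by exact: intmxM.
have e : redmx vF (quadmx (e2 a) 1%:M (liftmx x *m liftmx z)) = 1%:M + block_mx 0 (x *m z) 0 0.
  rewrite redmx_quad // redmx1 redmxM // !redmx_lift red_e2 //.
  by rewrite /quadmx scale0r (@scalar_mx_block _ m m) add_block_mx !addr0 add0r.
rewrite -e hlam //; first last.
- rewrite e; apply: unitmx_1D.
  by rewrite mulmx_block !(mul0mx, mulmx0, addr0) (block_mx0).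
- exact: intmx1.
congr (mu _ *: _); rewrite /pairmx map_mx1 map_mxM /= scalemxAl det_1D_rank1.
by rewrite -scalemxAr mxE -map_mxM mxE.
Qed.

Lemma mu_nontrivial : (0 < a)%N -> exists2 be, be \in O & mu (1 + epsE a * be%:A) != 1.
Proof.
move=> a0; apply: contrapT => h.
pose p : 'M[resField vF]_n := block_mx 1%:M 0 0 0.
have d1 : delta_mx (Ordinal m0) (Ordinal m0) != 0 :> 'M[resField vF]_m.
  by apply/matrix0Pn; exists (Ordinal m0), (Ordinal m0); rewrite mxE !eqxx oner_neq0.
have one0 : 1%:M != 0 :> 'M[resField vF]_m.
  by apply: contraNneq d1 => e; rewrite -[delta_mx _ _]mul1mx e mul0mx.
apply: (@lam_trivial_rank1 lam p lam0).
- by rewrite /p mulmx_block !(mul1mx, mul0mx, addr0).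
- by apply: contraNneq one0; rewrite /p -(@block_mx0 _ m m m m) => /eq_block_mx[-> _ _ _].
- by apply: contraNneq one0; rewrite /p (@scalar_mx_block _ m m) => /eq_block_mx[_ _ _ <-].
move=> x z; rewrite -[x]vsubmxK -[z]hsubmxK; set x1 := usubmx x; set x2 := dsubmx x.
set z1 := lsubmx z; set z2 := rsubmx z.
rewrite mul_block_col mul_row_block !(mul1mx, mul0mx, mulmx0, mulmx1, addr0).
move=> /eq_col_mx[_ <-] /(congr1 (@lsubmx _ 1 m m)); rewrite row_mxKl linear0 => ->.
rewrite mul_col_row !mul0mx mulmx0 red_e2_block //.
suff -> : mu (1 + epsE a * ((liftmx z2 *m liftmx x1) 0 0)%:A) = 1 by rewrite scale1r.
apply/eqP/negPn/negP => ne; apply: h; exists ((liftmx z2 *m liftmx x1) 0 0) => //.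
by apply: intmxM; exact: intmx_lift.
Qed.

End FixedA.

Lemma paD a b : pa (a + b) = w ^+ b * pa a.
Proof.
elim: b => [|b IH]; first by rewrite addn0 mul1r.
by rewrite addnS paS IH exprS mulrA.
Qed.

(** By [mu_congr1] and [mu_nontrivial], a is the depth of mu. If a1 < a2, then [epsE a2] is a
    multiple of w [epsE a1], so mu would be both trivial and nontrivial on 1 + O [epsE a2]. *)
Lemma eqvA_uniq a a' lam lam' : lam != 0 -> EqvA a lam -> lam' != 0 -> EqvA a' lam' -> a = a'.
Proof.
suff key a1 a2 l1 l2 : (a1 < a2)%N -> l1 != 0 -> EqvA a1 l1 -> l2 != 0 -> EqvA a2 l2 -> False.
  move=> l0 h l0' h'; case: (ltngtP a a') => // lt.
    by case: (key _ _ _ _ lt l0 h l0' h').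
  by case: (key _ _ _ _ lt l0' h' l0 h).
move=> lt l10 h1 l20 h2; have a20 : (0 < a2)%N by exact: leq_ltn_trans lt.
have [be Obe] := mu_nontrivial l20 h2 a20; case/eqP.
have Ob : w ^+ (a2 - a1).-1 * be \in O by rewrite intMul // intX // w_int.
have := mu_congr1 l10 h1 (int0 vF) Ob; rewrite mulr0 scale0r add0r mulrA -exprS.
rewrite prednK ?subn_gt0 // => <-; congr (mu (1 + _)).
rewrite /epsE -{1}(subnKC (ltnW lt)) paD !algFM; ring.
Qed.

Section FixedA.
Variables (a : nat) (lam : 'rV[C]_d).
Hypotheses (lam0 : lam != 0) (hlam : EqvA a lam).

Definition nuA (P Q : 'M[resField vF]_m) : C :=
  mu (\det (pairmx (epsE a) (liftmx P) (liftmx Q))).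

Lemma nuAE P Q : intmx vF P -> intmx vF Q -> redmx vF (quadmx (e2 a) P Q) \in unitmx ->
  mu (\det (pairmx (epsE a) P Q)) = nuA (redmx vF P) (redmx vF Q).
Proof.
move=> iP iQ u; apply: (mu_red_det lam0 hlam) => //; try exact: intmx_lift.
- by rewrite redmx_lift.
- by rewrite redmx_lift.
Qed.

Lemma eqv_nuA (l : 'rV[C]_d) (P Q : 'M_m) : EqvA a l -> quadmx (red vF (e2 a)) P Q \in unitmx ->
  l *m R (quadmx (red vF (e2 a)) P Q) = nuA P Q *: l.
Proof.
move=> hl u; have iP := @intmx_lift _ vF _ _ P; have iQ := @intmx_lift _ vF _ _ Q.
have e : redmx vF (quadmx (e2 a) (liftmx P) (liftmx Q)) = quadmx (red vF (e2 a)) P Q.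
  by rewrite redmx_quad // !redmx_lift.
by rewrite -e hl // e.
Qed.

Lemma mu_red (x y : F) : x \in O -> y \in O -> red vF x = red vF y -> red vF x != 0 ->
  mu x%:A = mu y%:A.
Proof.
move=> Ox Oy e rx; have ry : red vF y != 0 by rewrite -e.
have [y0 _] := red_unit Oy ry; have OyV := integersV Oy ry.
have [z Oz zE] : exists2 z, z \in O & x - y = w * z.
  by apply: w_div; rewrite -red_eq // e.
have -> : x = y * (1 + w * (y^-1 * z)).
  by rewrite mulrDr mulr1 (mulrCA w) mulVKf // -zE addrC subrK.
have u : 1 + w * (y^-1 * z) != 0.
  have : red vF (1 + w * (y^-1 * z)) != 0.
    by rewrite redD ?int1 ?intMul ?w_int // redM ?intMul ?w_int // red_w mul0r addr0 red1 oner_neq0.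
  by case/(red_unit (intD (int1 vF) (intMul w_int (intMul OyV Oz)))).
rewrite algFM muM ?algF_eq0 //.
have := mu_congr1 lam0 hlam (intMul OyV Oz) (int0 vF).
by rewrite mulr0 scale0r mul0r addr0 algFD scale1r => ->; rewrite mulr1.
Qed.

Definition kapA (z : resField vF) : C := mu (lift z)%:A.

Lemma lift_neq0 (z : resField vF) : z != 0 -> lift z != 0.
Proof. by move=> z0; have := red_unit (lift_int z); rewrite red_lift => /(_ z0)[]. Qed.

Lemma kapAE x : x \in O -> red vF x != 0 -> mu x%:A = kapA (red vF x).
Proof. by move=> Ox rx; apply: mu_red; rewrite ?lift_int ?red_lift. Qed.

Lemma kapA_neq0 z : z != 0 -> kapA z != 0.
Proof. by move=> z0; rewrite mu_neq0 // algF_eq0 lift_neq0. Qed.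

Lemma kapAM x y : x != 0 -> y != 0 -> kapA (x * y) = kapA x * kapA y.
Proof.
move=> x0 y0; rewrite /kapA -muM ?algF_eq0 ?lift_neq0 // -algFM.
by apply: mu_red; rewrite ?intMul ?lift_int ?redM ?lift_int ?red_lift // mulf_neq0.
Qed.

Lemma map_quadmx (e : E) (c' : F) (P Q : 'M[F]_m) : e ^+ 2 = c'%:A ->
  map_mx (in_alg E) (quadmx c' P Q) =
  block_mx (map_mx (in_alg E) P) (map_mx (in_alg E) Q) (e ^+ 2 *: map_mx (in_alg E) Q) (map_mx (in_alg E) P).
Proof. by move=> ee; rewrite /quadmx map_block_mx map_mxZ ee. Qed.

Lemma twoE : 2%:R != 0 :> E.
Proof.
have e : 2%:R%:A = 2%:R :> E by exact: scaler_nat.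
by rewrite -e algF_eq0 twoF.
Qed.

Lemma det_pair_norm (P Q : 'M[F]_m) :
  \det (pairmx (epsE a) P Q) * \det (pairmx (epsE a) P (- Q)) = (\det (quadmx (e2 a) P Q))%:A.
Proof.
rewrite -[RHS]/(in_alg E _) -det_map_mx (map_quadmx _ _ (epsE2 a)).
rewrite det_quadmx ?twoE ?epsE_neq0 //; congr (_ * \det _).
by rewrite /pairmx map_mxN scalerN.
Qed.

Lemma det_pair_anti (A B : 'M[F]_m) :
  (\det (1%:M + block_mx A B (- (e2 a *: B)) (- A)))%:A =
  \det (pairmx (epsE a) (1%:M - (A *m A - e2 a *: (B *m B))) (- (A *m B - B *m A))).
Proof.
rewrite -[LHS]/(in_alg E _) -det_map_mx map_mxD map_mx1 map_block_mx !map_mxN map_mxZ /=.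
rewrite -epsE2 det_1D_anti ?twoE ?epsE_neq0 //; congr (\det _).
rewrite /pairmx !(map_mxD, map_mxN, map_mx1, map_mxM, map_mxZ) /= -epsE2.
rewrite mulmxDr !mulmxBl -!scalemxAr -!scalemxAl scalerA -expr2.
set AA := _ *m _; set BA := _ *m _; set AB := _ *m _; set BB := _ *m _.
by apply/matrixP => i j; rewrite !mxE; ring.
Qed.

End FixedA.

Lemma mult_one_unram lam : lam != 0 -> EqvA 0 lam ->
  exists r, forall l, EqvA 0 l -> exists t, l = t *: r.
Proof.
move=> lam0 hlam; pose D := red vF (e2 0).
pose J : 'M[resField vF]_n := quadmx D 0 1%:M.
(* s is the Galois conjugation of coordinates: -1 on the half of the basis that carries delta. *)
pose s : 'M[resField vF]_n := block_mx (- 1%:M) 0 0 1%:M.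
pose nu (A : 'M[resField vF]_n) := nuA 0 (ulsubmx A) (ursubmx A).
have JJ : J *m J = D%:M.
  rewrite /J quadmxM !(mul0mx, mulmx0, mul1mx, mulmx1, add0r, addr0) /quadmx scaler0.
  by rewrite scalemx1 -scalar_mx_block.
have ss : s *m s = 1%:M.
  by rewrite /s mulmx_block !(mul0mx, mulmx0, mulmx1, addr0, add0r) mulNmx mulmxN mul1mx opprK -scalar_mx_block.
have sJ : s *m J = - (J *m s).
  rewrite /s /J /quadmx !mulmx_block !(mul0mx, mulmx0, mulmx1, mul1mx, addr0, add0r, mulNmx, mulmxN).
  by rewrite opp_block_mx !oppr0 opprK.
have D0 : D != 0 by have := red_nonsq 0; rewrite mul0r eq_sym.
have uD : (D%:M : 'M_n) \in unitmx by rewrite unitmxE det_scalar unitfE expf_neq0.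
have uJ : J \in unitmx by move: uD; rewrite -JJ unitmx_mul => /andP[].
have us : s \in unitmx by case/mulmx1_unit: ss.
have centP A : centJ J A -> exists P Q, A = quadmx D P Q /\ nu A = nuA 0 P Q.
  case/andP=> uA /eqP/quadmx_cent[P [Q ->]]; exists P, Q; split=> //.
  by rewrite /nu /quadmx block_mxKul block_mxKur.
have lamR A : centJ J A -> lam *m R A = nu A *: lam.
  move=> cA; have [P [Q [AE ->]]] := centP A cA.
  by rewrite AE (eqv_nuA hlam) // -/D -AE; case/andP: cA.
have cu A : centJ J A -> A \in unitmx by case/andP.
have cV A : centJ J A -> centJ J (invmx A).
  case/andP=> uA /eqP AJ; rewrite /centJ unitmx_inv uA /=; apply/eqP.
  by apply: (can_inj (mulKmx uA)); apply: (can_inj (mulmxK uA)); rewrite mulKVmx // !mulmxA mulmxKV.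
have nuM A B : centJ J A -> centJ J B -> nu (A *m B) = nu A * nu B.
  move=> cA cB; apply: (lam_cancel lam0); rewrite -lamR; last first.
    rewrite /centJ unitmx_mul !cu //=; apply/eqP.
    by case/andP: cA => _ /eqP AJ; case/andP: cB => _ /eqP BJ; rewrite -mulmxA BJ !mulmxA AJ.
  by rewrite repmM ?cu // mulmxA lamR // -scalemxAl lamR // scalerA.
have nu0 A : centJ J A -> nu A != 0.
  move=> cA; apply: contraNneq lam0 => nA.
  have := lamR _ cA; rewrite nA scale0r => /(congr1 (mulmx^~ (R (invmx A)))).
  by rewrite /= mul0mx -mulmxA -repmM ?unitmx_inv ?cu // mulmxV ?cu // repm1 mulmx1 => ->.
(* s A s is the conjugate P - t Q of A = P + t Q, so the product is mu of a norm, computed on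
   lifts. *)
have nu_kap A : centJ J A -> nu A * nu (s *m A *m s) = kapA (\det A).
  move=> cA; have [P [Q [AE ->]]] := centP A cA; have uA := cu A cA.
  have sAs : s *m A *m s = quadmx D P (- Q).
    rewrite AE /s /quadmx !mulmx_block !(mul0mx, mulmx0, addr0, add0r, mulNmx, mulmxN, mul1mx, mulmx1).
    by rewrite opprK scalerN.
  have usA : s *m A *m s \in unitmx by rewrite !unitmx_mul us uA.
  have iP := @intmx_lift _ vF _ _ P; have iQ := @intmx_lift _ vF _ _ Q.
  have -> : nu (s *m A *m s) = nuA 0 P (- Q).
    by rewrite sAs /nu /quadmx block_mxKul block_mxKur.
  have := nuAE lam0 hlam iP (intmxN iQ).
  rewrite redmxN // !redmx_lift => <-; last first.
    by rewrite redmx_quad ?redmxN ?redmx_lift -/D -?sAs //; exact: intmxN.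
  have iq := intmx_quad 0 iP iQ.
  have rq : red vF (\det (quadmx (e2 0) (liftmx P) (liftmx Q))) = \det A.
    by rewrite red_det // redmx_quad // !redmx_lift AE.
  have rq0 : red vF (\det (quadmx (e2 0) (liftmx P) (liftmx Q))) != 0.
    by rewrite rq -unitfE -unitmxE.
  have [q0 _] := red_unit (det_int iq) rq0.
  have := det_pair_norm 0 (liftmx P) (liftmx Q) => e.
  have : (\det (quadmx (e2 0) (liftmx P) (liftmx Q)))%:A != 0 :> E by rewrite algF_eq0.
  rewrite -e mulf_eq0 negb_or => /andP[n1 n2].
  by rewrite /nuA -muM // e (kapAE lam0 hlam) ?rq ?det_int // -rq.
have nu_sq y : y *m J = - (J *m y) -> 1%:M + y \in unitmx ->
    nu (1%:M - y *m y) = kapA (\det (1%:M + y)).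
  move=> yJ u1y.
  have u2y : 1%:M - y \in unitmx.
    have : (1%:M - y) *m D%:M = J *m (1%:M + y) *m J.
      by rewrite mulmxDr mulmx1 [RHS]mulmxDl -(mulmxA J) yJ mulmxN mulmxA JJ mulmxBl mul1mx mul_mx_scalar mul_scalar_mx.
    move=> e; have : (1%:M - y) *m D%:M \in unitmx by rewrite e !unitmx_mul uJ u1y.
    by rewrite unitmx_mul => /andP[].
  pose A := ulsubmx y; pose B := ursubmx y.
  (* This is the shape of an antilinear matrix. The lift Y keeps it, so the determinant identity can
     be used over F before reducing. *)
  have yE : y = block_mx A B (- (D *: B)) (- A).
    move: yJ; rewrite /A /B -{1 2 3}[y]submxK /J /quadmx !mulmx_block.
    rewrite !(mul0mx, mulmx0, mulmx1, mul1mx, addr0, add0r) opp_block_mx => /eq_block_mx[e1 e2 _ _].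
    transitivity (block_mx (ulsubmx y) (ursubmx y) (dlsubmx y) (drsubmx y)); first by rewrite submxK.
    congr block_mx; last by rewrite e2 opprK.
    by rewrite -[LHS]opprK -e1 -scalemxAr mulmx1.
  have iA := @intmx_lift _ vF _ _ A; have iB := @intmx_lift _ vF _ _ B.
  have ie := int_e2 0.
  pose Y := block_mx (liftmx A) (liftmx B) (- (e2 0 *: liftmx B)) (- liftmx A) : 'M[F]_n.
  have iY : intmx vF Y by apply: intmx_block => //; apply: intmxN => //; exact: intmxZ.
  have rY : redmx vF Y = y.
    rewrite /redmx /Y map_block_mx -!/(redmx _ _) !redmxN ?redmxZ ?redmx_lift //.
    exact: intmxZ.
  have i1Y : intmx vF (1%:M + Y) by apply: intmxD => //; exact: intmx1.
  have r1Y : redmx vF (1%:M + Y) = 1%:M + y.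
    by rewrite redmxD ?redmx1 ?rY //; exact: intmx1.
  pose P := 1%:M - (liftmx A *m liftmx A - e2 0 *: (liftmx B *m liftmx B)).
  pose Q := - (liftmx A *m liftmx B - liftmx B *m liftmx A).
  have iAA : intmx vF (liftmx A *m liftmx A) by exact: intmxM.
  have iAB : intmx vF (liftmx A *m liftmx B) by exact: intmxM.
  have iBA : intmx vF (liftmx B *m liftmx A) by exact: intmxM.
  have iBB : intmx vF (liftmx B *m liftmx B) by exact: intmxM.
  have ieB : intmx vF (e2 0 *: (liftmx B *m liftmx B)) by exact: intmxZ.
  have iS : intmx vF (liftmx A *m liftmx A - e2 0 *: (liftmx B *m liftmx B)).
    by apply: intmxD => //; exact: intmxN.
  have iP : intmx vF P by apply: intmxD; [exact: intmx1 | exact: intmxN].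
  have iQ : intmx vF Q by apply: intmxN; apply: intmxD => //; exact: intmxN.
  have rP : redmx vF P = 1%:M - (A *m A - D *: (B *m B)).
    rewrite redmxD ?redmx1 ?redmxN ?redmxD ?redmxN ?redmxZ ?redmxM ?redmx_lift //; try exact: intmx1; by apply: intmxN.
  have rQ : redmx vF Q = - (A *m B - B *m A).
    by rewrite redmxN ?redmxD ?redmxN ?redmxM ?redmx_lift //; [exact: intmxN | apply: intmxD => //; exact: intmxN].
  have qE : quadmx D (redmx vF P) (redmx vF Q) = 1%:M - y *m y.
    rewrite rP rQ yE /quadmx (@scalar_mx_block _ m m) mulmx_block opp_block_mx add_block_mx.
    rewrite !(mulNmx, mulmxN, opprK, add0r) -!scalemxAl -!scalemxAr.
    move: (A *m A) (A *m B) (B *m A) (B *m B) => AA AB BA BB.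
    by congr block_mx; apply/matrixP => i j; rewrite !mxE; ring.
  have uq : quadmx D (redmx vF P) (redmx vF Q) \in unitmx.
    rewrite qE; have -> : 1%:M - y *m y = (1%:M + y) *m (1%:M - y).
      by rewrite mulmxDl mul1mx mulmxBr mulmx1 addrA subrK.
    by rewrite unitmx_mul u1y.
  have -> : nu (1%:M - y *m y) = nuA 0 (redmx vF P) (redmx vF Q).
    by rewrite -qE /nu /quadmx block_mxKul block_mxKur.
  rewrite -(nuAE lam0 hlam) //; last by rewrite redmx_quad.
  rewrite -det_pair_anti -/Y (kapAE lam0 hlam) ?det_int // red_det // r1Y //.
  by rewrite -unitfE -unitmxE.
have nuN1 : nu (- 1%:M) = kapA (\det s).
  have iN1 p : intmx vF (- 1%:M : 'M_p) by apply: intmxN; exact: intmx1.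
  have rN1 p : redmx vF (- 1%:M : 'M_p) = - 1%:M by rewrite redmxN ?redmx1 //; exact: intmx1.
  have i0 := @intmx0 _ vF m m.
  have uN1 p : (- 1%:M : 'M[resField vF]_p) \in unitmx.
    by rewrite -scaleN1r unitmxZ ?unitmx1 // unitrN unitr1.
  have qE : - 1%:M = quadmx D (redmx vF (- 1%:M : 'M[F]_m)) (redmx vF (0 : 'M[F]_m)).
    rewrite (rN1 m) redmx0 /quadmx scaler0 (@scalar_mx_block _ m m) opp_block_mx oppr0.
    by [].
  rewrite qE /nu /quadmx block_mxKul block_mxKur -/(quadmx _ _ _) -(nuAE lam0 hlam) //; last first.
    by rewrite redmx_quad // -/D -qE.
  have -> : \det s = red vF (\det (- 1%:M : 'M[F]_m)).
    by rewrite /s det_ublock det1 mulr1 red_det // rN1.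
  rewrite -(kapAE lam0 hlam) ?det_int //; last by rewrite red_det // rN1 -unitfE -unitmxE.
  congr mu; rewrite /pairmx map_mx0 scaler0 addr0 -[RHS]/(in_alg E _) -det_map_mx.
  by [].
have [r hr] := gelfand_mult_one irr cusp two0 JJ red_nonsq ss sJ nu0 nuM kapA_neq0 (kapAM lam0 hlam) nu_kap nu_sq nuN1.
exists r => l hl; apply: hr => A cA; have [P [Q [AE ->]]] := centP A cA.
by rewrite AE (eqv_nuA hl) // -/D -AE; case/andP: cA.
Qed.

(** * The additive character and the character of GL_m carried by a functional when a > 0 *)

Section FixedA.
Variables (a : nat) (lam : 'rV[C]_d).
Hypotheses (a0 : (0 < a)%N) (lam0 : lam != 0) (hlam : EqvA a lam).

Definition psiA (x : resField vF) : C := mu (1 + epsE a * (lift x)%:A).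

Lemma psiAE b : b \in O -> mu (1 + epsE a * b%:A) = psiA (red vF b).
Proof.
move=> Ob; set i := Ordinal m0.
have e x : 1 + epsE a * x%:A = \det (pairmx (epsE a) (1%:M + 0 *: delta_mx i i) (x *: delta_mx i i) : 'M[E]_m).
  by rewrite det_pair_scalar1 scale0r add0r mulrC.
have id : intmx vF (delta_mx i i : 'M_m) by exact: intmx_delta.
have Ol := lift_int (red vF b).
rewrite /psiA !e scale0r addr0; apply: (mu_red_det lam0 hlam); rewrite ?redmxZ ?red_lift //;
  try exact: intmx1; try exact: intmxZ.
rewrite redmx_quad ?redmx1; last exact: intmxZ.
by rewrite unitmxE /quadmx red_e2 // scale0r det_ublock !det1 mulr1 unitr1.
Qed.

Lemma eqv_rank1_psi l (x : 'cV_m) (z : 'rV_m) : EqvA a l ->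
  l *m R (1%:M + block_mx 0 (x *m z) 0 0) = psiA ((z *m x) 0 0) *: l.
Proof.
move=> hl; have ix := @intmx_lift _ vF _ _ x; have iz := @intmx_lift _ vF _ _ z.
rewrite (red_e2_block hl) // psiAE; last exact: intmxM.
congr (psiA _ *: _); have /matrixP/(_ 0 0) := redmxM iz ix.
by rewrite !redmx_lift [LHS]mxE.
Qed.

Lemma mulmx_ur (Q Q' : 'M[resField vF]_m) :
  block_mx 0 Q 0 0 *m block_mx 0 Q' 0 0 = 0 :> 'M_n.
Proof. by rewrite mulmx_block !(mul0mx, mulmx0, addr0) block_mx0. Qed.

Lemma ur_mul (Q Q' : 'M[resField vF]_m) :
  R (1%:M + block_mx 0 (Q + Q') 0 0) = R (1%:M + block_mx 0 Q 0 0) *m R (1%:M + block_mx 0 Q' 0 0).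
Proof.
rewrite -repmM ?unitmx_1D ?mulmx_ur // mulmx1D0 ?mulmx_ur //.
by rewrite add_block_mx !addr0.
Qed.

(** Additivity is read off lam: the unipotent matrices with an upper right block multiply by adding
    their blocks. *)
Lemma psiAD x y : psiA (x + y) = psiA x * psiA y.
Proof.
set i := Ordinal m0.
have e t : lam *m R (1%:M + block_mx 0 (t *: delta_mx i i) 0 0) = psiA t *: lam.
  have -> : t *: delta_mx i i = (t *: delta_mx i 0) *m delta_mx (0 : 'I_1) i :> 'M[resField vF]_m.
    by rewrite -scalemxAl mul_delta_mx.
  rewrite eqv_rank1_psi // -scalemxAr mul_delta_mx mxE mxE !eqxx mulr1.
  by [].
by apply: (lam_cancel lam0); rewrite -e scalerDl ur_mul mulmxA e -scalemxAl e scalerA.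
Qed.

Lemma psiA0 : psiA 0 = 1.
Proof.
apply: (lam_cancel lam0); have := eqv_rank1_psi (0 : 'cV_m) (0 : 'rV_m) hlam.
by rewrite !mulmx0 mxE block_mx0 addr0 repm1 mulmx1 scale1r => <-.
Qed.

Lemma psiA_neq0 x : psiA x != 0.
Proof.
apply: contraTneq (oner_neq0 C) => e.
by rewrite -psiA0 -(subrr x) psiAD e mul0r eqxx.
Qed.

Lemma psiA_nt : exists x, psiA x != 1.
Proof.
have [be Obe ne] := mu_nontrivial lam0 hlam a0; exists (red vF be).
by rewrite -psiAE.
Qed.

Lemma eqv_psi_tr l (Q : 'M_m) : EqvA a l ->
  l *m R (1%:M + block_mx 0 Q 0 0) = psiA (\tr Q) *: l.
Proof.
move=> hl; rewrite [Q]sum_delta_row.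
elim/big_ind: _ => [|Q1 Q2 h1 h2|i _].
- by rewrite mxtrace0 psiA0 block_mx0 addr0 repm1 mulmx1 scale1r.
- by rewrite ur_mul mulmxA h1 -scalemxAl h2 scalerA mxtraceD psiAD.
by rewrite eqv_rank1_psi // mxtrace_mulC trace_mx11.
Qed.

Definition zetaA (P : 'M[resField vF]_m) : C := nuA a P 0.

Lemma eqv_zeta l (P : 'M_m) : EqvA a l -> P \in unitmx ->
  l *m R (block_mx P 0 0 P) = zetaA P *: l.
Proof.
move=> hl uP; have := eqv_nuA (Q := 0) (P := P) hl.
rewrite /quadmx scaler0; apply.
by rewrite unitmxE det_ublock unitrM -unitmxE uP.
Qed.

(** [zetaA] is mu of the determinant of a lift, and a transvection lifts to a transvection, of
    determinant 1. *)
Lemma zetaA_transv (i j : 'I_m) t : (i < j)%N -> zetaA (1%:M + t *: delta_mx i j) = 1.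
Proof.
move=> ij; have Ot := lift_int t.
have id : intmx vF (delta_mx i j : 'M_m) by exact: intmx_delta.
have i1 : intmx vF (1%:M : 'M_m) by exact: intmx1.
have i1t : intmx vF (1%:M + lift t *: delta_mx i j : 'M_m) by apply: intmxD => //; exact: intmxZ.
have r1t : redmx vF (1%:M + lift t *: delta_mx i j : 'M_m) = 1%:M + t *: delta_mx i j.
  rewrite redmxD ?redmx1 ?redmxZ ?red_lift //; last exact: intmxZ.
  by congr (_ + _ *: _); apply/matrixP => y y'; rewrite !mxE; case: (_ && _); rewrite ?red1 ?red0.
have ij0 : (j == i) = false by apply/eqP => e; move: ij; rewrite e ltnn.
have u1t : 1%:M + t *: delta_mx i j \in unitmx.
  apply: unitmx_1D; rewrite -scalemxAl -scalemxAr mul_delta_mx_cond ij0.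
  by rewrite mulr0n !scaler0.
have -> : zetaA (1%:M + t *: delta_mx i j) = mu (\det (pairmx (epsE a) (1%:M + lift t *: delta_mx i j) 0)).
  rewrite (nuAE lam0 hlam) ?r1t ?redmx0 //; first exact: intmx0.
  by rewrite redmx_quad ?r1t ?redmx0 /quadmx ?scaler0 ?unitmxE ?det_ublock ?unitrM -?unitmxE ?u1t //; exact: intmx0.
rewrite /pairmx map_mx0 scaler0 addr0 map_mxD map_mx1 map_mxZ map_delta_mx.
rewrite -(mul_delta_mx (0 : 'I_1)) scalemxAl det_1D_rank1 -scalemxAr mul_delta_mx_cond ij0.
by rewrite mulr0n scaler0 mxE addr0 mu1.
Qed.

End FixedA.

Section Interleave.
Variables (K : fieldType) (p : nat).

Definition selmx (f : 'I_m -> 'I_p) : 'M[K]_(p, m) := \matrix_(i, j) (i == f j)%:R.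

Lemma selmxE f (j : 'I_m) : selmx f *m delta_mx j (0 : 'I_1) = delta_mx (f j) 0.
Proof. by rewrite -colE; apply/matrixP => i l; rewrite !mxE !ord1 eqxx andbT. Qed.

Lemma tr_selmx_mul f g : (selmx f)^T *m selmx g = \matrix_(i, j) (f i == g j)%:R.
Proof.
apply/matrixP => i j; rewrite !mxE (bigD1 (f i)) //= big1 => [|l li].
  by rewrite !mxE eqxx mul1r addr0.
by rewrite !mxE (negPf li) mul0r.
Qed.

End Interleave.

Lemma mult_one_ram a lam :
  d%:R = \prod_(1 <= i < n) ((#|resField vF| ^ i)%N%:R - 1) :> C ->
  (0 < a)%N -> lam != 0 -> EqvA a lam ->
  exists r, forall l, EqvA a l -> exists t, l = t *: r.
Proof.
move=> dimd a0 lam0 hlam; have n0 : (0 < n)%N by rewrite addn_gt0 m0.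
pose idx (j : nat) : 'I_n := insubd (Ordinal n0) j.
have idxE j : (j < n)%N -> idx j = j :> nat by move=> jn; rewrite val_insubd jn.
have lt0 (i : 'I_m) : (2 * i < n)%N by rewrite addnn -mul2n ltn_pmul2l.
have lt1 (i : 'I_m) : ((2 * i).+1 < n)%N.
  by rewrite addnn -mul2n; apply: (@leq_trans (2 * i.+1)); [rewrite mulnS | rewrite leq_mul2l ltn_ord].
pose X := selmx (resField vF) (fun i => idx (2 * i)%N).
pose Y := selmx (resField vF) (fun i => idx (2 * i).+1%N).
have XX : X^T *m X = 1%:M.
  rewrite tr_selmx_mul; apply/matrixP => i j; rewrite !mxE.
  by rewrite -val_eqE /= !idxE // eqn_pmul2l.
have YY : Y^T *m Y = 1%:M.
  rewrite tr_selmx_mul; apply/matrixP => i j; rewrite !mxE.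
  by rewrite -val_eqE /= !idxE // eqSS eqn_pmul2l.
have XY : X^T *m Y = 0.
  rewrite tr_selmx_mul; apply/matrixP => i j; rewrite !mxE.
  rewrite -val_eqE /= !idxE //; case: eqP => // /(congr1 odd).
  by rewrite /= !oddM.
have YX : Y^T *m X = 0 by apply: trmx_inj; rewrite trmx_mul trmxK XY trmx0.
(* U is the permutation matrix interleaving the two halves of the basis, and [R'] below is [rho]
   read in the interleaved order. *)
pose U := row_mx X Y; have UU : U^T *m U = 1%:M.
  by rewrite tr_row_mx mul_col_row XX XY YX YY -scalar_mx_block.
have UX : U^T *m X = col_mx 1%:M 0 by rewrite tr_row_mx mul_col_mx XX YX.
have UY : U^T *m Y = col_mx 0 1%:M by rewrite tr_row_mx mul_col_mx XY YY.
have XU : X^T *m U = row_mx 1%:M 0 by rewrite mul_mx_row XX XY.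
have YU : Y^T *m U = row_mx 0 1%:M by rewrite mul_mx_row YX YY.
have UU' : U *m U^T = 1%:M by exact: mulmx1C.
have [uT uU] := mulmx1_unit UU.
pose R' (A : 'M[resField vF]_n) := R (U^T *m A *m U).
have R'1 : R' 1%:M = 1%:M by rewrite /R' mulmx1 UU repm1.
have R'M A B : A \in unitmx -> B \in unitmx -> R' (A *m B) = R' A *m R' B.
  move=> uA uB; rewrite /R' -repmM ?unitmx_mul ?uT ?uA ?uB ?uU //; congr repm.
  by rewrite !mulmxA -(mulmxA _ U) UU' mulmx1.
have R'cusp p : p *m p = p -> p != 0 -> p != 1%:M -> \sum_(f | radp p f) R' (1%:M + f) = 0.
  move=> pp p0 p1; pose h (A : 'M[resField vF]_n) := U^T *m A *m U.
  pose h' (A : 'M[resField vF]_n) := U *m A *m U^T.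
  have hK : cancel h h' by move=> A; rewrite /h /h' !mulmxA UU' mul1mx -mulmxA UU' mulmx1.
  have h'K : cancel h' h by move=> A; rewrite /h /h' !mulmxA UU mul1mx -mulmxA UU mulmx1.
  have hM A B : h (A *m B) = h A *m h B by rewrite /h !mulmxA -(mulmxA _ U) UU' mulmx1.
  have h1 : h 1%:M = 1%:M by rewrite /h mulmx1 UU.
  have h0 : h 0 = 0 by rewrite /h mulmx0 mul0mx.
  have hpp : h p *m h p = h p by rewrite -hM pp.
  have e0 A : (h A == 0) = (A == 0) by rewrite -{1}h0 (can_eq hK).
  have hp0 : h p != 0 by rewrite e0.
  have hp1 : h p != 1%:M by rewrite -h1 (can_eq hK).
  rewrite -[RHS](cuspidal_sum cusp hpp hp0 hp1).
  rewrite [RHS](reindex_onto h h') => [|f _]; last exact: h'K.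
  apply: eq_big => [f|f _].
    by rewrite hK eqxx andbT /radp -!hM e0 (can_eq hK).
  by rewrite /R' mulmxDr mulmxDl mulmx1 UU.
have [r hr] := shalika_mult_one R'1 R'M R'cusp idxE (psiAD a0 lam0 hlam)
  (psiA_neq0 a0 lam0 hlam) (psiA_nt a0 lam0 hlam) (erefl _) m0 (selmxE _ _) (selmxE _ _)
  XX YY XY (zetaA_transv lam0 hlam) dimd.
exists r => l hl; apply: hr; split=> [Q|P uP].
  rewrite -(eqv_psi_tr a0 lam0 hlam Q hl); congr (_ *m repm _ _).
  rewrite mulmxDr mulmx1 mulmxDl UU; congr (_ + _).
  have -> : U^T *m (X *m Q *m Y^T) *m U = (U^T *m X) *m Q *m (Y^T *m U) by rewrite !mulmxA.
  by rewrite UX YU mul_col_mx mul_col_row !mul1mx !mul0mx !mulmx0 mulmx1.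
rewrite -(eqv_zeta hl uP); congr (_ *m repm _ _).
have -> : U^T *m (X *m P *m X^T + Y *m P *m Y^T) *m U =
    (U^T *m X) *m P *m (X^T *m U) + (U^T *m Y) *m P *m (Y^T *m U).
  by rewrite mulmxDr mulmxDl !mulmxA.
rewrite UX XU UY YU !mul_col_mx !mul_mx_row !mul1mx !mul0mx !mulmx0 !mulmx1 -!block_mxEv.
by rewrite add_block_mx !addr0 add0r.
Qed.

(** * From the rows lam_g back to the space of functionals *)

Section Final.
Variables (L : fieldExtType F) (chi : L -> C).
Hypothesis chi1 : chi 1 = 1.
Hypothesis chiM : forall x y, x != 0 -> y != 0 -> chi (x * y) = chi x * chi y.
Variable lam : GL n F -> 'M[C]_d.
Hypothesis hlam : isLambda chi rho lam.
Hypothesis dimd : d%:R = \prod_(1 <= i < n) ((#|resField vF| ^ i)%N%:R - 1) :> C.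
Local Notation emb := (embedGL (m := m) dimE deltaNF).
Local Notation Hom := (HomSpace (cIndRep vF (GLmodcenter vF) lam) emb (fun h : GL m E => mu (\det h))).
Local Notation coset_cInd := (coset_cInd chi1 chiM hlam).
Local Notation row_ := (coset_row chi1 chiM hlam).

Lemma hom_lin (l : Hom) a v u : l (a *: v + u) = a * l v + l u.
Proof. by case: (homE l). Qed.

Lemma row_mulr (l : Hom) (g : GL n F) (h : GL m E) :
  row_ l (g * (emb h)^-1)%g = mu (\det h) *: row_ l g.
Proof.
apply: coset_row_eq => [|u]; first exact: hom_lin.
rewrite -coset_mulr; have [_ ->] := homE l.
rewrite (coset_rowE chi1 chiM hlam) ; last exact: hom_lin.
by rewrite -scalemxAl [RHS]mxE.
Qed.

(** With X = g h g^-1 one has g h^-1 = X^-1 g, so the row at this point is computed both by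
    translation under H and by translation under K. *)
Lemma eqv_row (l : Hom) (g : GL n F) : Eqv g (row_ l g).
Proof.
move=> P Q X iX uX; have [uX' _] := intmx_unit iX uX.
have uq : quadmx c P Q \in unitmx.
  by move: uX'; rewrite /X !unitmx_mul => /andP[/andP[_ ->]].
have [ik _] := intmx_GL iX uX.
pose h : GL m E := mkGL (pairmx delta P Q).
have hE : emb h = quadmx c P Q :> 'M_n by exact: embedGL_pair.
have e : (g * (emb h)^-1 = (mkGL X)^-1 * g)%g.
  apply: (mulgI (mkGL X)); rewrite mulKVg; apply: (mulIg (emb h)); rewrite mulgA mulgKV.
  apply: val_inj; rewrite /= mkGLE // [embedMx _ _]hE /X mulmxKV //.
  by case: g {X iX uX uX' ik}.
have := row_mulr l g h; rewrite e coset_row_mull; last 2 first.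
- exact: hom_lin.
- by apply: GLint_modcenter; exact: GLintV.
by rewrite invgK (lam_int chi1 hlam ik) !mkGLE // (pairmx_unit delta2).
Qed.

Lemma row_decomp (l : Hom) (g : GL n F) : row_ l g != 0 ->
  exists2 a, row_ l (mkGL (gA a)) != 0 & EqvA a (row_ l (mkGL (gA a))).
Proof.
move=> nz; have [|a [B [P [Q [iB uB uq gE]]]]] := @eqv_decomp g _ _ nz (@eqv_row l g).
  by case: g {nz}.
have [ik _] := intmx_GL iB uB; have [uB' _] := intmx_unit iB uB.
pose h : GL m E := mkGL (pairmx delta P Q).
have hE : emb h = quadmx c P Q :> 'M_n by exact: embedGL_pair.
have e : (g * (emb h)^-1 = mkGL B * mkGL (gA a))%g.
  apply: (mulIg (emb h)); rewrite mulgKV; apply: val_inj.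
  by rewrite /= (mkGLE uB') (mkGLE (gA_unit a)) gE -hE.
exists a; last by have := @eqv_row l (mkGL (gA a)); rewrite mkGLE ?gA_unit //; exact: eqv_gA.
have := row_mulr l g h; rewrite e coset_row_mull; last 2 first.
- exact: hom_lin.
- exact: GLint_modcenter.
move=> e'; apply: contraNneq nz => z; move: e'; rewrite z mul0mx => /esym/eqP.
rewrite scaler_eq0 (negPf (mu_neq0 _)) // -unitfE -unitmxE.
by case: h {hE e}.
Qed.

Lemma hom_dim1 (l0 : Hom) : l0 != 0 -> exists phi : {linear Hom -> C^o}, bijective phi.
Proof.
move=> l00; have row0 (l : Hom) : (forall g, row_ l g = 0) -> l = 0.
  move=> h; apply: hom_eq0; apply: (coset_span (chi1 := chi1) (chiM := chiM) (hlam := hlam)); first exact: hom_lin.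
  by move=> g u; rewrite coset_rowE ?h ?mul0mx ?mxE //; exact: hom_lin.
have [g nz] : exists g, row_ l0 g != 0.
  apply: contrapT => h; case/eqP: l00; apply: row0 => g; apply/eqP/negPn/negP => nz.
  by apply: h; exists g.
have [a nza hla] := row_decomp nz.
have [r hr] : exists r, forall v, EqvA a v -> exists t, v = t *: r.
  case: (posnP a) => a0; last exact: mult_one_ram hla.
  by rewrite a0 in nza hla *; exact: mult_one_unram hla.
have [i [j nzj]] := matrix0Pn _ nza; rewrite ord1 in nzj.
have evE (l : Hom) : l (coset_cInd (mkGL (gA a)) (delta_mx j 0)) = row_ l (mkGL (gA a)) 0 j.
  by rewrite mxE.
(* This evaluation is injective. If l vanishes there, its row at g_a is zero, the j-th entry of r
   being nonzero; but a nonzero row anywhere would give a nonzero one at some g_a', and a' = a by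
   uniqueness. *)
apply: (hom_line (l0 := l0) (v := coset_cInd (mkGL (gA a)) (delta_mx j 0))); first by rewrite evE.
move=> l; rewrite evE => lj; apply: row0 => g'; apply/eqP/negPn/negP => nz'.
have [a' nza' hla'] := row_decomp nz'.
have aa := eqvA_uniq nza hla nza' hla'; rewrite -aa in nza' hla'.
have [t tE] := hr _ hla'; have [t0 t0E] := hr _ hla.
move: nzj lj nza'; rewrite t0E tE !mxE mulf_eq0 negb_or => /andP[_ rj] /eqP.
by rewrite mulf_eq0 (negPf rj) orbF => /eqP->; rewrite scale0r eqxx.
Qed.

End Final.
End Main.

Theorem proposition4p4 (R : realType) (m : nat)
  (hn : (4 <= m + m)%N)
  (* the local field F, of residual characteristic different from 2 *)
  (F : fieldType) (vF : localField F)
  (hF : 2%N \notin [pchar (resField vF)])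
  (* the unramified quadratic extension E = F(delta) *)
  (E : fieldExtType F) (vE : localField E)
  (hE : \dim {:E} = 2%N) (hEu : unramified vF vE)
  (delta : E) (hdelta : delta \notin 1%VS) (hdelta2 : delta ^+ 2 \in 1%VS)
  (* the unramified extension L of degree n = 2m *)
  (L : fieldExtType F) (vL : localField L)
  (hL : \dim {:L} = (m + m)%N) (hLu : unramified vF vL)
  (* the representation pi(chi) *)
  (chi : L -> R[i]) (hchi : tameAdmissible vL chi)
  (d : nat)
  (rho : mx_representation R[i] [set: GL (m + m) (resField vF)]%G d)
  (hrho : isGreenCuspidal rho (resEmb vF vL) (resChar vL chi))
  (lam : GL (m + m) F -> 'M[R[i]]_d) (hlam : isLambda chi rho lam)
  (* the character mu of E^* *)
  (mu : E -> R[i]) (hmu : character vE mu) :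
  let pi := cIndRep vF (GLmodcenter vF) lam in
  let emb := embedGL (m := m) hE hdelta in
  let muH := fun h : GL m E => mu (\det h) in
  distinguished pi emb muH ->
  exists phi : {linear HomSpace pi emb muH -> (R[i])^o}, bijective phi.
Proof.
move=> pi emb muH [l0 l00].
have m0 : (0 < m)%N by rewrite lt0n; apply: contraTneq hn => ->.
have two0 : 2%:R != 0 :> resField vF by apply: contra hF; rewrite inE.
have [c delta2] := vlineP _ _ hdelta2; have [w w0 vw] := lval_unif vF.
have [irr cusp green] := hrho; have [[chi0 chiM _] chi_tame _] := hchi.
have chi1 : chi 1 = 1 by rewrite -[1]addr0 chi_tame ?ideal0.
have [mu0 muM _] := hmu.
have n0 : (0 < m + m)%N by rewrite addn_gt0 m0.
exact: (hom_dim1 two0 hEu delta2 irr cusp mu0 muM m0 w0 vw chi1 chiM hlam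
  (green_dim hLu n0 chi_tame green) l00).
Qed.
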